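(* Let all parameters except $D>0$ be fixed. Assume that $\omega\subset\mathbb{R}^N$ is a ball, that $\partial_vf(y,0)\equiv-1$ and $\kappa(y)\equiv1$, and that $g$ satisfies $$\langle\partial_ug(0)\rangle:=\frac{1}{|\partial\omega|}\int_{\partial\omega}\partial_ug(y,0)\,dy<0<\mu<\max_{y\in\partial\omega}\partial_ug(y,0).$$ Then $\Lambda_D(0)<0$, hence $c^*(D)>0$, for $D$ small enough, while $\Lambda_D(0)>0$ for $D$ large enough.
   Context: Setting. $N\ge1$; $d,D,\mu,\nu>0$ are constants, $0<r<1$. The functions $f\in C^{1,r}(\omega\times[0,+\infty))$ and $g\in C^{1,r}(\partial\omega\times[0,+\infty))$ satisfy: $f(\cdot,0)\equiv 0\equiv g(\cdot,0)$; $v\mapsto f(\cdot,v)/v$ is decreasing and $u\mapsto g(\cdot,u)/u$ is nonincreasing; there is $M>0$ such that for all $u,v\ge M$, $f(y,v)\le 0$ for all $y\in\omega$ and $g(y,u)\le0$ for all $y\in\partial\omega$. The bulk-surface system is $$\partial_t v=d\Delta v+f(y,v)\ \text{in }\mathbb{R}\times\omega,\quad d\,\partial_nv=\kappa(y)(\mu u-\nu v)\ \text{on }\mathbb{R}\times\partial\omega,\quad \partial_tu=D\Delta u+g(y,u)+\kappa(y)(\nu v-\mu u)\ \text{on }\mathbb{R}\times\partial\omega,$$ for $t>0$, with space variables $(x,y)$, $n$ the exterior normal, and $\Delta$ on $\mathbb{R}\times\partial\omega$ the Laplace–Beltrami operator (with the convention that it reduces to $\partial_{xx}$ when $N=1$).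 For $\alpha\in\mathbb{R}$ and $D>0$ the principal eigenvalue is $$\Lambda_D(\alpha)=\min\Big\{\mathcal{F}_D(\alpha)[U,V]:\ (U,V)\in H^1(\partial\omega)\times H^1(\omega),\ \int_{\partial\omega}U^2+\int_\omega V^2=1\Big\},$$ $$\mathcal{F}_D(\alpha)[U,V]=D\int_{\partial\omega}|\nabla U|^2-\int_{\partial\omega}(D\alpha^2+\partial_u g(y,0))U^2+d\int_\omega|\nabla V|^2-\int_\omega(d\alpha^2+\partial_v f(y,0))V^2+\int_{\partial\omega}\kappa(y)(\sqrt{\mu}U-\sqrt{\nu}V)^2$$ (traces of $V$ on $\partial\omega$; tangential gradient of $U$). When $\Lambda_D(0)<0$, the spreading speed in the $x$-direction of solutions of the system with compactly supported initial data is $c^*(D)=\min_{\alpha>0}\frac{-\Lambda_D(\alpha)}{\alpha}$.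
   Formalization: The claim that Λ_D(0)>0 for D large is stated only for N≥2: for N=1 the boundary is two points, the gradient term on ∂ω vanishes, and Λ_D(0) ≤ μ − max ∂_u g(·,0) < 0 for every D, so the claim is false there. *)

(* Defs.v *)
From HB Require Import structures.
From mathcomp Require Import all_boot all_order all_algebra.
From mathcomp Require Import all_classical all_reals all_analysis.
From mathcomp Require Import measurable_realfun.

Set Implicit Arguments.
Unset Strict Implicit.
Unset Printing Implicit Defensive.

Import Order.TTheory GRing.Theory Num.Theory.
Import numFieldNormedType.Exports.

Local Open Scope classical_set_scope.
Local Open Scope ring_scope.

(** The Borel sigma-algebra of R^n, generated by the coordinate maps. *)

Definition measure_rV_display : measure_display.
Proof. exact: (default_measure_display). Qed.

Section measurable_rV.
Variables (R : realType) (n : nat).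

Definition rV_coord (i : 'I_n) (x : 'rV[R]_n) : R := x ord0 i.

Let rV_set0 : g_sigma_preimage rV_coord set0.
Proof. exact: sigma_algebra0. Qed.

Let rV_setC A : g_sigma_preimage rV_coord A -> g_sigma_preimage rV_coord (~` A).
Proof. exact: sigma_algebraC. Qed.

Let rV_bigcup (F : (set 'rV[R]_n)^nat) :
  (forall i, g_sigma_preimage rV_coord (F i)) ->
  g_sigma_preimage rV_coord (\bigcup_i (F i)).
Proof. exact: sigma_algebra_bigcup. Qed.

HB.instance Definition _ := @isMeasurable.Build measure_rV_display
  'rV[R]_n (g_sigma_preimage rV_coord) rV_set0 rV_setC rV_bigcup.

End measurable_rV.

Section measurable_rV_fun.
Variable R : realType.

Lemma measurable_rV_coord n (i : 'I_n) :
  measurable_fun [set: 'rV[R]_n] (@rV_coord R n i).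
Proof.
move=> _ Y mY; rewrite setTI; apply: sub_sigma_algebra => /=.
rewrite -bigcup_seq/=; exists i => /=; first by rewrite mem_index_enum.
by exists Y => //; rewrite setTI.
Qed.

Lemma measurable_fun_rV d (T : measurableType d) n (f : T -> 'rV[R]_n) :
  (forall i, measurable_fun [set: T] (fun x => f x ord0 i)) ->
  measurable_fun [set: T] f.
Proof.
move=> mf.
suff H : g_sigma_preimage (fun i => @rV_coord R n i \o f) `<=` measurable.
  move=> _ A mA; rewrite setTI; apply: H.
  by rewrite g_sigma_preimage_comp; exists A => //; rewrite setTI.
apply: smallest_sub; first exact: sigma_algebra_measurable.
case: n => [|n] in f mf *; first by rewrite big_ord0.
rewrite -bigcup_mkord_ord; apply: bigcup_sub => i Ii.
by move=> A [B mB <-]; exact: mf.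
Qed.

End measurable_rV_fun.

(** The library's measure structure on [pushforward m f] takes the
    measurability of [f] as an explicit argument; here it is inferred. *)

Section image_measure.
Context d1 d2 (T1 : measurableType d1) (T2 : measurableType d2).
Context (R : realType) (m : {measure set T1 -> \bar R}) (f : {mfun T1 >-> T2}).

Definition image_measure : set T2 -> \bar R := pushforward m f.

Let mpre A : measurable A -> measurable (f @^-1` A).
Proof. exact: measurable_funPTI. Qed.

Let image_measure0 : image_measure set0 = 0%E.
Proof. by rewrite /image_measure /pushforward preimage_set0 measure0. Qed.

Let image_measure_ge0 A : (0 <= image_measure A)%E.
Proof. exact: measure_ge0. Qed.

Let image_measure_sigma_additive : semi_sigma_additive image_measure.
Proof.
move=> F mF tF mUF; rewrite /image_measure /pushforward preimage_bigcup.
apply: measure_semi_sigma_additive.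
- by move=> n; exact: mpre.
- apply/trivIsetP => /= i j _ _ ij; rewrite -preimage_setI.
  by move/trivIsetP : tF => /(_ _ _ _ _ ij) ->//; rewrite preimage_set0.
- by rewrite -preimage_bigcup; exact: mpre.
Qed.

HB.instance Definition _ := isMeasure.Build _ _ _ image_measure
  image_measure0 image_measure_ge0 image_measure_sigma_additive.

End image_measure.

(** N-dimensional Lebesgue measure, as an iterated product. *)

Section lebesgue_rV.
Variable R : realType.

Definition rV_cons n (p : measurableTypeR R * 'rV[R]_n) : 'rV[R]_n.+1 :=
  row_mx (const_mx p.1 : 'rV_1) p.2.

Lemma rV_cons_eq n (p : measurableTypeR R * 'rV[R]_n) (i : 'I_n.+1) :
  rV_cons p ord0 i = if unlift ord0 i is Some j then p.2 ord0 j else p.1.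
Proof.
rewrite mxE; case: unliftP => [j ->|->]; case: splitP => k /=.
- by case: k => -[].
- by rewrite /bump/= => -[/val_inj ->].
- by rewrite mxE.
- by [].
Qed.

Lemma measurable_rV_cons n :
  measurable_fun [set: measurableTypeR R * 'rV[R]_n] (@rV_cons n).
Proof.
apply: measurable_fun_rV => i; under eq_fun do rewrite rV_cons_eq.
case: (unlift ord0 i) => [j|]; last exact: measurable_fst.
by apply: (measurableT_comp (@measurable_rV_coord R n j)); exact: measurable_snd.
Qed.

HB.instance Definition _ n := isMeasurableFun.Build _ _ _ _
  (@rV_cons n) (@measurable_rV_cons n).

Section step.
Variables (n : nat) (mu : {sigma_finite_measure set 'rV[R]_n -> \bar R}).

Definition rV_cons_measure : set 'rV[R]_n.+1 -> \bar R :=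
  image_measure ((@lebesgue_measure R) \x mu)%E (@rV_cons n).

HB.instance Definition _ := Measure.on rV_cons_measure.

Let rV_cons_measure_sigma_finite : sigma_finite setT rV_cons_measure.
Proof.
have /sigma_finiteP[/= F [TF ndF Foo]] := sigma_finiteT (@lebesgue_measure R).
have /sigma_finiteP[/= G [TG ndG Goo]] := sigma_finiteT mu.
pose uncons (x : 'rV[R]_n.+1) : measurableTypeR R * 'rV[R]_n :=
  (x ord0 ord0, \row_j x ord0 (lift ord0 j)).
have unconsK : cancel (@rV_cons n) uncons.
  move=> [a v]; congr pair; first by rewrite rV_cons_eq unlift_none.
  by apply/rowP => j; rewrite mxE rV_cons_eq liftK.
have muncons : measurable_fun setT uncons.
  apply: measurable_fun_pair; first exact: (@measurable_rV_coord R n.+1 ord0).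
  apply: measurable_fun_rV => i; under eq_fun do rewrite mxE.
  exact: (@measurable_rV_coord R n.+1 (lift ord0 i)).
exists (fun k => uncons @^-1` (F k `*` G k)).
  rewrite -preimage_bigcup; apply/seteqP; split => // x _ /=.
  have [k _ Fk] : (\bigcup_k F k) (uncons x).1 by rewrite -TF.
  have [l _ Gl] : (\bigcup_k G k) (uncons x).2 by rewrite -TG.
  exists (maxn k l) => //; split.
  - by move: Fk; apply/subsetPset/ndF/leq_maxl.
  - by move: Gl; apply/subsetPset/ndG/leq_maxr.
move=> k; have [mF Fk] := Foo k; have [mG Gk] := Goo k.
have mFG : measurable (F k `*` G k) by exact: measurableX.
split; first by rewrite -[X in measurable X]setTI; exact: muncons.
rewrite /rV_cons_measure /image_measure /pushforward.
rewrite (_ : _ @^-1` _ = F k `*` G k); last first.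
  by rewrite -comp_preimage (_ : uncons \o _ = id)//; exact/funext.
rewrite [X in (X < _)%E](product_measure1E _ _ mF mG).
by rewrite lte_mul_pinfty// ge0_fin_numE.
Qed.

HB.instance Definition _ := Measure_isSigmaFinite.Build _ _ _
  rV_cons_measure rV_cons_measure_sigma_finite.

End step.

Fixpoint lebesgue_rV (n : nat) : {sigma_finite_measure set 'rV[R]_n -> \bar R} :=
  if n is m.+1 then rV_cons_measure (lebesgue_rV m) else \d_(0 : 'rV[R]_0).

End lebesgue_rV.

(** Euclidean geometry of R^N.  The library norm on ['rV[R]_N] is the sup norm,
    which generates the same topology but not the same balls. *)

Section euclidean.
Variables (R : realType) (N : nat).
Implicit Types u v x z : 'rV[R]_N.

Definition dot u v : R := \sum_i u ord0 i * v ord0 i.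

Definition eucl u : R := Num.sqrt (dot u u).

Definition eball z (rho : {posnum R}) : set 'rV[R]_N :=
  [set x | eucl (x - z) < rho%:num].

Definition esphere z (rho : {posnum R}) : set 'rV[R]_N :=
  [set x | eucl (x - z) = rho%:num].

Definition radial z (rho : {posnum R}) x : 'rV[R]_N :=
  z + (rho%:num / eucl (x - z)) *: (x - z).

Lemma measurable_eucl_sub z :
  measurable_fun [set: 'rV[R]_N] (fun x => eucl (x - z)).
Proof.
have msqrt : measurable_fun [set: R] (@Num.sqrt R).
  by apply: continuous_measurable_fun; exact: sqrt_continuous.
apply: (measurableT_comp msqrt).
apply: measurable_sum => i; under eq_fun do rewrite !mxE.
by apply: measurable_funM; apply: measurable_funD => //;
  exact: measurable_rV_coord.
Qed.

Lemma measurable_eball z rho : measurable (eball z rho).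
Proof.
rewrite -[X in measurable X]setTI.
rewrite (_ : eball z rho = (fun x => eucl (x - z)) @^-1` `]-oo, rho%:num[%classic).
  by apply: measurable_eucl_sub.
by apply/seteqP; split => x /=; rewrite in_itv.
Qed.

Lemma measurable_radial z rho :
  measurable_fun [set: 'rV[R]_N] (radial z rho).
Proof.
apply: measurable_fun_rV => i; under eq_fun do rewrite !mxE.
apply: measurable_funD => //; apply: measurable_funM.
  apply: measurable_funM => //.
  under eq_fun do rewrite -powR_inv1 ?sqrtr_ge0//.
  exact: (measurableT_comp (measurable_powR (-1)) (measurable_eucl_sub z)).
by apply: measurable_funD => //; exact: measurable_rV_coord.
Qed.

HB.instance Definition _ z rho := isMeasurableFun.Build _ _ _ _
  (radial z rho) (measurable_radial z rho).

(** Lebesgue measure on the ball. *)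
Definition ball_measure z rho : {measure set 'rV[R]_N -> \bar R} :=
  mrestr (@lebesgue_rV R N) (measurable_eball z rho).

(** Surface measure of the sphere: the volume of the cone
    [{z + t (y - z) | y in A, 0 < t < 1}] over a subset [A] of the sphere is
    [rho / N] times the area of [A].  For [N = 1] this is the counting measure
    on the two endpoints. *)
Definition sphere_measure z rho : {measure set 'rV[R]_N -> \bar R} :=
  mscale (N%:R / rho%:num)%:nng
    (image_measure (ball_measure z rho) (radial z rho)).

End euclidean.

Section sobolev.
Variables (R : realType) (N : nat) (z : 'rV[R]_N) (rho : {posnum R}).
Local Notation E := 'rV[R]_N.
Implicit Types (phi V T U : E -> R) (G H : E -> E).

Local Notation omega := (eball z rho).
Local Notation leb := (ball_measure z rho).
Local Notation sigma := (sphere_measure z rho).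

Definition partial (i : 'I_N) phi : E -> R := 'D_(delta_mx 0 i) phi.

Definition grad phi (x : E) : E := \row_i partial i phi x.

(** [phi] belongs to C^oo(R^N): all iterated partial derivatives exist and are
    continuous. *)
Definition smooth phi : Prop := forall s : seq 'I_N,
  let psi := foldr partial phi s in
  continuous psi /\ forall i x, derivable psi x (delta_mx 0 i).

Definition outer_normal (y : E) : E := rho%:num^-1 *: (y - z).

Definition tangential_grad phi (y : E) : E :=
  grad phi y - dot (grad phi y) (outer_normal y) *: outer_normal y.

Definition L2 (m : {measure set E -> \bar R}) phi : Prop := phi \in Lfun m 2%:E.

Definition L2_cvg (m : {measure set E -> \bar R}) (u : nat -> E -> R) phi
    : Prop :=
  'N[m]_2%:E%E [EFin \o (u k \- phi)%R]%E @[k --> \oo] --> 0%E.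

Definition L2_vec (m : {measure set E -> \bar R}) G : Prop :=
  forall i, L2 m (fun x => G x ord0 i).

Definition L2_vec_cvg (m : {measure set E -> \bar R}) (u : nat -> E -> E) G
    : Prop :=
  forall i, L2_cvg m (fun k x => u k x ord0 i) (fun x => G x ord0 i).

Definition test_function phi : Prop :=
  smooth phi /\ closure [set x | phi x != 0] `<=` omega.

(** [V] belongs to H^1(omega), with weak gradient [H]. *)
Definition H1_ball V H : Prop :=
  [/\ L2 leb V, L2_vec leb H &
    forall phi, test_function phi -> forall i,
      \int[leb]_(x in omega) (V x * partial i phi x) =
      - \int[leb]_(x in omega) (H x ord0 i * phi x)].

(** [T] is the trace on the sphere of [V], an element of H^1(omega) with weak
    gradient [H]: the trace is the continuous extension to H^1(omega) of the
    restriction of functions that are smooth up to the boundary. *)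
Definition is_trace V H T : Prop :=
  L2 sigma T /\
  exists phi : nat -> E -> R,
    [/\ forall k, smooth (phi k), L2_cvg leb phi V,
        L2_vec_cvg leb (fun k => grad (phi k)) H & L2_cvg sigma phi T].

(** [U] belongs to H^1 of the sphere, the completion of the smooth functions
    for the norm of [(U, tangential gradient of U)] in L^2, and [G] is its
    tangential gradient.  Smooth functions on the sphere are the restrictions
    of smooth functions on R^N. *)
Definition H1_sphere U G : Prop :=
  [/\ L2 sigma U, L2_vec sigma G &
    exists phi : nat -> E -> R,
      [/\ forall k, smooth (phi k), L2_cvg sigma phi U &
          L2_vec_cvg sigma (fun k => tangential_grad (phi k)) G]].

End sobolev.

(** [h(y, v)] is of class C^{1,r} on a subset [A] of R^N x R which need not be
    open: it extends to a C^1 function on an open neighbourhood of [A], whose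
    first derivatives are [r]-Hoelder continuous on compact sets. *)
Definition C1_holder (R : realType) (N : nat) (r : R) (A : set ('rV[R]_N * R))
    (h : 'rV[R]_N -> R -> R) : Prop :=
  exists (O : set ('rV[R]_N * R)) (F : 'rV[R]_N * R -> R),
    [/\ open O, A `<=` O,
        forall p, A p -> F p = h p.1 p.2,
        forall p, O p -> differentiable F p &
        forall (w : 'rV[R]_N * R) (K : set ('rV[R]_N * R)),
          compact K -> K `<=` O ->
          exists C : R, forall p q, K p -> K q ->
            `|'D_w F p - 'D_w F q| <= C * `|p - q| `^ r].

(** The derivative at [0] of a function defined on [0, +oo). *)
Definition right_derive0 (R : realType) (h : R -> R) : R :=
  lim ((h t - h 0) / t @[t --> 0^'+]).

Definition is_min (R : realType) (A : set R) (m : R) : Prop :=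
  A m /\ lbound A m.

Definition is_max (R : realType) (A : set R) (m : R) : Prop :=
  A m /\ ubound A m.

Section eigenvalue.
Variables (R : realType) (N : nat) (z : 'rV[R]_N) (rho : {posnum R}).
Variables (d mu nu : R) (kappa : 'rV[R]_N -> R) (f g : 'rV[R]_N -> R -> R).
Local Notation E := 'rV[R]_N.
Local Notation omega := (eball z rho).
Local Notation domega := (esphere z rho).
Local Notation leb := (ball_measure z rho).
Local Notation sigma := (sphere_measure z rho).

Definition sphere_mean (h : E -> R) : R :=
  (fine (sigma domega))^-1 * \int[sigma]_(y in domega) h y.

(** The functional F_D(alpha)[U, V], where [G] is the tangential gradient of
    [U], [H] the gradient of [V] and [T] the trace of [V]. *)
Definition functional (D alpha : R) (U : E -> R) (G : E -> E)
    (V : E -> R) (H : E -> E) (T : E -> R) : R :=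
  D * (\int[sigma]_(y in domega) dot (G y) (G y))
  - (\int[sigma]_(y in domega)
       ((D * alpha ^+ 2 + right_derive0 (g y)) * U y ^+ 2))
  + d * (\int[leb]_(x in omega) dot (H x) (H x))
  - (\int[leb]_(x in omega)
       ((d * alpha ^+ 2 + right_derive0 (f x)) * V x ^+ 2))
  + (\int[sigma]_(y in domega)
       (kappa y * (Num.sqrt mu * U y - Num.sqrt nu * T y) ^+ 2)).

(** The principal eigenvalue Lambda_D(alpha).  The infimum is attained, by
    compactness of the embeddings of H^1 in L^2. *)
Definition Lambda (D alpha : R) : R :=
  inf [set l | exists U G V H T,
    [/\ H1_sphere z rho U G, H1_ball z rho V H, is_trace z rho V H T,
        \int[sigma]_(y in domega) (U y ^+ 2)
          + \int[leb]_(x in omega) (V x ^+ 2) = 1 &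
        l = functional D alpha U G V H T]].

Definition is_spreading_speed (D c : R) : Prop :=
  is_min [set - Lambda D alpha / alpha | alpha in [set alpha | 0 < alpha]] c.

End eigenvalue.

(* Main.v *)
(* Test functions with [V = 0] that concentrate on the sphere near a maximum of
   [d_u g(., 0)] make the functional negative once [D] is small, because there
   the reaction term beats the loss [mu U^2]. The spreading speed exists because
   [Lambda D] decreases at least like [- min(D, d) alpha^2] and is Lipschitz in
   [alpha^2], so that [- Lambda D alpha / alpha] is continuous and blows up at
   both ends of the half line.

   For large [D] every term involving [V] can be discarded (the choice
   [d_v f(., 0) = -1] makes them nonnegative), and the claim becomes the
   coercivity of [D |grad U|^2 - d_u g(., 0) U^2] on the sphere. It follows from
   the negative mean of [d_u g(., 0)] and a Poincare inequality, which is proved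
   on the annulus [rho / 2 <= |x - z| < rho] for the 0-homogeneous extension of
   a function on the sphere: increments are integrated along segments that stay
   away from the centre, averaging over a third point when the two ends are
   nearly antipodal. This needs only the behaviour of Lebesgue measure under
   homotheties and translations. *)

From HB Require Import structures.
Require Import Defs.
From mathcomp Require Import all_boot all_order all_algebra.
From mathcomp Require Import all_classical all_reals all_analysis.
From mathcomp Require Import measurable_realfun.
From mathcomp Require Import ring lra.

Set Implicit Arguments.
Unset Strict Implicit.
Unset Printing Implicit Defensive.

Import Order.TTheory GRing.Theory Num.Theory.
Import numFieldNormedType.Exports.

Local Open Scope classical_set_scope.
Local Open Scope ring_scope.

(** * Borel sets and Lebesgue measure of R^n *)

(** The obstacle in the Poincare inequality is the centre: the 0-homogeneous extension has a
    gradient of size [1 / |x - z|], so a segment is usable only if it keeps a fixed distance from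
    [z]. Third points visible from both of two antipodal points exist only if there is room to turn,
    which needs [1 < N]. For [N = 1] the sphere has two points and tangential gradients vanish, so
    no such inequality holds.

    Path energies are one-sided: with one end fixed and the other integrated, volume is contracted
    without bound near the fixed end. Each half of a segment is therefore charged to the end nearer
    to it, where the Jacobian is at least [2 ^- N].

    No minimizer of the functional is constructed. What is known about [Lambda] comes from
    inequalities for admissible tuples, passed to the infimum, while coercivity on [H1_sphere] is
    proved for smooth functions and passed to the L^2 limit. The test functions are normalized
    powers of a polynomial peaked at one point, for which smoothness is immediate. *)

Lemma rV_mxnorm_ltP (R : realType) n (x : 'rV[R]_n) (e : R) : 0 < e ->
  (forall i, `|x ord0 i| < e) -> `|x| < e.
Proof.
move=> e0 H; rewrite [`|x|]mx_normrE; apply/bigmax_ltP; split => // -[i j] _ /=.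
by rewrite ord1.
Qed.

Lemma rV_norm_le (R : realType) n (x : 'rV[R]_n) (e : R) : 0 <= e ->
  (forall i, `|x ord0 i| <= e) -> `|x| <= e.
Proof.
move=> e0 H; rewrite [`|x|]mx_normrE; apply/bigmax_leP; split => // -[i j] _ /=.
by rewrite ord1.
Qed.

Lemma rV_coord_le_norm (R : realType) n (x : 'rV[R]_n) i : `|x ord0 i| <= `|x|.
Proof.
by rewrite [leRHS]mx_normrE; apply/bigmax_geP; right => /=; exists (ord0, i).
Qed.

(* [f] is the pointwise limit of functions that are constant on the cells of the
   grids of mesh [1 / k]. *)
Lemma continuous_in_rV_measurable (R : realType) n (D : set 'rV[R]_n)
    (f : 'rV[R]_n -> R) : measurable D ->
  (forall x, D x -> forall e : R, 0 < e -> exists2 d : R, 0 < d &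
    forall y, D y -> `|x - y| < d -> `|f x - f y| < e) ->
  measurable_fun D f.
Proof.
move=> mD cf.
pose cell k (x : 'rV[R]_n) : 'rV[int]_n := \row_i Num.floor (k.+1%:R * x ord0 i).
pose pt k (m : 'rV[int]_n) : 'rV[R]_n :=
  xget 0 [set y | D y /\ cell k y = m].
apply: (measurable_fun_cvg (h := fun k => f \o pt k \o cell k)).
  move=> k; apply: measurable_funTS => _ Y mY; rewrite setTI.
  rewrite (_ : _ @^-1` Y =
      \bigcup_(m in [set m | Y (f (pt k m))]) [set x | cell k x = m]); last first.
    apply/seteqP; split => [x /= Yx|x [m /= Ym xm]].
      by exists (cell k x).
    by rewrite xm.
  rewrite bigcup_mkcond; apply: countable_bigcupT_measurable => // m.
  case: ifP => // _.
  rewrite (_ : [set x | cell k x = m] = \big[setI/setT]_(i < n)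
      [set x : 'rV[R]_n | (m ord0 i)%:~R <= k.+1%:R * x ord0 i < (m ord0 i + 1)%:~R]); last first.
    rewrite -bigcap_seq; apply/seteqP; split => [x /= <- i _ /=|x xm].
      by rewrite mxE; exact: floor_itv.
    by apply/rowP => i; rewrite mxE; apply/floor_def/(xm i); rewrite /= mem_index_enum.
  apply: bigsetI_measurable => i _.
  have mc : measurable_fun [set: 'rV[R]_n] (fun x : 'rV[R]_n => k.+1%:R * x ord0 i).
    by apply: measurable_funM => //; exact: measurable_rV_coord.
  rewrite [X in measurable X](_ : _ = [set: 'rV[R]_n] `&`
    (fun x : 'rV[R]_n => k.+1%:R * x ord0 i) @^-1`
      `[(m ord0 i)%:~R, (m ord0 i + 1)%:~R[%classic); last first.
    by rewrite setTI; apply/seteqP; split => x /=; rewrite in_itv.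
  exact: mc.
move=> x Dx; apply/cvgrPdist_lt => e e0.
have [d d0 Hd] := cf x Dx e e0.
(* From this index on the mesh is below [d]. *)
exists (Num.trunc d^-1) => // k /= Kk.
(* [x] itself belongs to [D] and to its cell, so the default [0] of [xget] is not reached. *)
have [Dy yx] : D (pt k (cell k x)) /\ cell k (pt k (cell k x)) = cell k x.
  by rewrite /pt; case: xgetP => [y -> []//|/(_ x)]; case.
apply: Hd => //; apply: rV_mxnorm_ltP => // i; rewrite !mxE.
have k0 : 0 < k.+1%:R :> R by [].
have kK : k.+1%:R^-1 < d.
  by rewrite invf_plt ?posrE// (lt_le_trans (truncnS_gt _))// ler_nat ltnS.
have /rowP/(_ i) := yx; rewrite !mxE.
move: (pt k _) => y E.
have /andP[fl lf] := floor_itv (k.+1%:R * x ord0 i).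
have /andP[] := floor_itv (k.+1%:R * y ord0 i); rewrite E => fl' lf'.
apply: lt_trans kK; rewrite -(ltr_pM2l k0) divff ?gt_eqF//.
rewrite -[X in X * _](gtr0_norm k0) -normrM mulrBr ltr_norml.
move: lf lf' fl fl'; rewrite intrD; move: (_ * x ord0 i) (_ * y ord0 i) (_%:~R) => a b c.
by move=> *; apply/andP; split; lra.
Qed.

Lemma continuous_rV_measurable (R : realType) n (f : 'rV[R]_n -> R) :
  continuous f -> measurable_fun [set: 'rV[R]_n] f.
Proof.
move=> cf; apply: continuous_in_rV_measurable => // x _ e e0.
have /cvgrPdist_lt/(_ _ e0)/nbhs_ballP[d /= d0 Hd] := cf x.
by exists d => // y _ xy; apply: Hd; rewrite -ball_normE.
Qed.

(** By uniqueness of Lebesgue measure: [t] times its image under [x |-> a + t x] gives half-open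
    intervals their length. *)
Lemma ge0_integral_affine (R : realType) (a t : R) (g : measurableTypeR R -> \bar R) :
  0 < t -> measurable_fun setT g -> (forall x, (0 <= g x)%E) ->
  (\int[@lebesgue_measure R]_x g (a + t * x)%R =
   (t^-1)%:E * \int[@lebesgue_measure R]_x g x)%E.
Proof.
move=> t0 mg g0.
have mphi : measurable_fun [set: measurableTypeR R]
    (fun x => a + t * x : measurableTypeR R).
  by apply: measurable_funD => //; exact: measurable_funM.
pose phi : {mfun measurableTypeR R >-> measurableTypeR R} :=
  HB.pack (fun x => a + t * x : measurableTypeR R)
    (isMeasurableFun.Build _ _ _ _ _ mphi).
have t0' : 0 <= t by exact: ltW.
have E (A : set (measurableTypeR R)) : measurable A ->
    lebesgue_measure A = mscale (NngNum t0') (image_measure lebesgue_measure phi) A.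
  apply: lebesgue_measure_unique => _ [[c d] _ <-] /=.
  rewrite /mscale/= /image_measure /pushforward/=.
  rewrite (_ : _ @^-1` _ = `](c - a) / t, (d - a) / t]%classic); last first.
    apply/seteqP; split => x /=; rewrite !in_itv/= ltr_pdivrMr// ler_pdivlMr//;
      rewrite (mulrC x) ltrBlDl lerBrDl//.
  rewrite !lebesgue_measure_itv/= !lte_fin ltr_pM2r ?invr_gt0//.
  rewrite ltrD2r; case: ifPn => _; last by rewrite mule0.
  rewrite -!EFinD -EFinM; congr EFin.
  by field; exact: lt0r_neq0.
rewrite [X in (_ * X)%E](_ : _ = \int[mscale (NngNum t0') (image_measure lebesgue_measure phi)]_x g x)%E; last first.
  by apply: eq_measure_integral => A mA _; exact: E.
rewrite ge0_integral_mscale//= muleA -EFinM mulVf ?lt0r_neq0// mul1e.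
transitivity (\int[pushforward lebesgue_measure phi]_x g x)%E; last first.
  by apply: eq_measure_integral => A mA _.
by rewrite ge0_integral_pushforward//= => *; exact: g0.
Qed.

Lemma ge0_integral_lebesgue_rVS (R : realType) n (g : 'rV[R]_n.+1 -> \bar R) :
  measurable_fun setT g -> (forall x, (0 <= g x)%E) ->
  (\int[lebesgue_rV R n.+1]_x g x =
   \int[@lebesgue_measure R]_s \int[lebesgue_rV R n]_v g (rV_cons (s, v)))%E.
Proof.
move=> mg g0.
transitivity (\int[pushforward ((@lebesgue_measure R) \x lebesgue_rV R n)
    (@rV_cons R n)]_x g x)%E.
  by apply: eq_measure_integral => A mA _.
rewrite ge0_integral_pushforward//.
have mgc : measurable_fun setT (g \o @rV_cons R n).
  exact: measurableT_comp.
rewrite preimage_setT fubini_tonelli1//.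
by move=> x; exact: g0.
Qed.

Lemma rV_cons_affine (R : realType) n (a : 'rV[R]_n.+1) t s (v : 'rV[R]_n) :
  a + t *: rV_cons (s, v) =
  rV_cons (a ord0 ord0 + t * s, (\row_i a ord0 (lift ord0 i)) + t *: v).
Proof.
apply/rowP => i; rewrite !mxE; case: splitP => j ij; rewrite !mxE.
  by congr (a _ _ + _); apply: val_inj; rewrite /= ij (ord1 j).
by congr (a _ _ + _); apply: val_inj; rewrite /= ij.
Qed.

Lemma measurable_rV_affine (R : realType) n (a : 'rV[R]_n) (t : R) :
  measurable_fun setT (fun x : 'rV[R]_n => a + t *: x).
Proof.
apply: measurable_fun_rV => i; under eq_fun do rewrite !mxE.
apply: measurable_funD => //; apply: measurable_funM => //.
exact: measurable_rV_coord.
Qed.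

(** Tonelli peels off one coordinate at a time, each contributing a factor [t^-1]. *)
Lemma ge0_integral_rV_affine (R : realType) n (a : 'rV[R]_n) (t : R)
    (g : 'rV[R]_n -> \bar R) :
  0 < t -> measurable_fun setT g -> (forall x, (0 <= g x)%E) ->
  (\int[lebesgue_rV R n]_x g (a + t *: x)%R =
   ((t ^+ n)^-1)%:E * \int[lebesgue_rV R n]_x g x)%E.
Proof.
move=> t0; elim: n a g => [|n IH] a g mg g0.
  rewrite expr0 invr1 mul1e; apply: eq_integral => x _; congr g.
  by apply/rowP => -[].
rewrite ge0_integral_lebesgue_rVS//; last first.
  by apply: (measurableT_comp mg); exact: measurable_rV_affine.
have mgc : measurable_fun setT (fun p => g (rV_cons p)).
  by apply: (measurableT_comp mg); exact: measurable_rV_cons.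
under eq_integral => s _.
  under eq_integral do rewrite rV_cons_affine.
  rewrite (IH _ (fun v => g (rV_cons (a ord0 ord0 + t * s, v))))//; last first.
    exact: (measurableT_comp mgc (measurable_pair1 _)).
  over.
have mF : measurable_fun setT
    (fun s => \int[lebesgue_rV R n]_v g (rV_cons (s, v)))%E.
  by apply: (measurable_fun_fubini_tonelli_F (fun p => g (rV_cons p))).
have F0 s : (0 <= \int[lebesgue_rV R n]_v g (rV_cons (s, v)))%E.
  exact: integral_ge0.
rewrite ge0_integralZl//; last 2 first.
- have maf : measurable_fun [set: measurableTypeR R]
      (fun s => a ord0 ord0 + t * s : measurableTypeR R).
    by apply: measurable_funD => //; exact: measurable_funM.
  exact: (measurableT_comp mF maf).
- by rewrite lee_fin invr_ge0 exprn_ge0// ltW.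
rewrite (@ge0_integral_affine R (a ord0 ord0) t (fun s => \int[lebesgue_rV R n]_v g (rV_cons (s, v)))%E)//.
by rewrite -ge0_integral_lebesgue_rVS// muleA -EFinM exprS invfM mulrC.
Qed.

(** A sup-norm ball. As a product of intervals it has an explicit volume, so it stands in for
    Euclidean balls wherever a measure must be shown finite or positive. *)
Definition cube (R : realType) n (c : 'rV[R]_n) (a : R) : set 'rV[R]_n :=
  [set x | forall i, `|x ord0 i - c ord0 i| < a].

Lemma cube_coords (R : realType) n (c : 'rV[R]_n) (a : R) :
  cube c a = \big[setI/setT]_(i < n)
    (rV_coord i @^-1` `]c ord0 i - a, c ord0 i + a[%classic).
Proof.
rewrite -bigcap_seq; apply/seteqP; split => x /= H i.
  by move=> _ /=; rewrite in_itv/= -ltr_distl; exact: H.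
have := H i; rewrite /= mem_index_enum => /(_ isT).
by rewrite /= in_itv/= -ltr_distl.
Qed.

Lemma measurable_cube (R : realType) n (c : 'rV[R]_n) (a : R) :
  measurable (cube c a).
Proof.
rewrite cube_coords; apply: bigsetI_measurable => i _.
rewrite -[X in measurable X]setTI; apply: measurable_rV_coord => //.
Qed.

Lemma lebesgue_cube (R : realType) n (c : 'rV[R]_n) (a : R) : 0 < a ->
  lebesgue_rV R n (cube c a) = ((a *+ 2) ^+ n)%:E.
Proof.
move=> a0; elim: n c => [|n IH] c.
  rewrite expr0 /= diracE (_ : _ \in _)//.
  by rewrite inE => -[].
have -> : lebesgue_rV R n.+1 (cube c a) =
  ((@lebesgue_measure R) \x lebesgue_rV R n)%E (`]c ord0 ord0 - a, c ord0 ord0 + a[%classic `*`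
     cube (\row_i c ord0 (lift ord0 i)) a).
  rewrite [LHS]/= /rV_cons_measure /image_measure /pushforward; congr (_ _).
  apply/seteqP; split => -[s v] /=.
    move=> H; split; first by have := H ord0; rewrite rV_cons_eq unlift_none/= in_itv/= ltr_distl.
    by move=> i; have := H (lift ord0 i); rewrite rV_cons_eq liftK/= mxE.
  move=> [H1 H2] i; rewrite rV_cons_eq; case: unliftP => [j ->|->] /=.
    by have := H2 j; rewrite mxE.
  by move: H1; rewrite in_itv/= -ltr_distl.
rewrite [LHS]product_measure1E//; last exact: measurable_cube.
rewrite [X in (_ * X)%E]IH.
rewrite [X in (X * _)%E]lebesgue_measure_itv/= lte_fin.
rewrite ltrD2l gtrN// -EFinD -EFinM exprS; congr ((_ * _)%:E).
by ring.
Qed.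

Lemma ge0_integral_mrestr d (T : measurableType d) (R : realType)
    (m : {measure set T -> \bar R}) (D A : set T) (mD : measurable D)
    (f : T -> \bar R) : measurable A -> measurable_fun A f ->
  (forall x, A x -> (0 <= f x)%E) ->
  (\int[mrestr m mD]_(x in A) f x = \int[m]_(x in A `&` D) f x)%E.
Proof.
move=> mA mf f0.
have mAD : measurable (A `&` D) by exact: measurableI.
rewrite (@ge0_negligible_integral _ _ _ (mrestr m mD) _ (~` D))//.
- rewrite setDE setCK; apply: eq_measure_integral => B mB BAD.
  by change (m (B `&` D) = m B); rewrite setIidl// => x /BAD[].
- exact: measurableC.
- by change (m (~` D `&` D) = 0%E); rewrite setICl measure0.
Qed.

(** * Euclidean geometry *)

Section euclidean_geometry.
Variables (R : realType) (N : nat).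
Implicit Types u v w : 'rV[R]_N.

Lemma dotC u v : dot u v = dot v u.
Proof. by apply: eq_bigr => i _; rewrite mulrC. Qed.

Lemma dotDl u v w : dot (u + v) w = dot u w + dot v w.
Proof. by rewrite /dot -big_split; apply: eq_bigr => i _; rewrite mxE mulrDl. Qed.

Lemma dotDr u v w : dot u (v + w) = dot u v + dot u w.
Proof. by rewrite dotC dotDl dotC (dotC w). Qed.

Lemma dotZl c u v : dot (c *: u) v = c * dot u v.
Proof. by rewrite /dot mulr_sumr; apply: eq_bigr => i _; rewrite mxE mulrA. Qed.

Lemma dotZr c u v : dot u (c *: v) = c * dot u v.
Proof. by rewrite dotC dotZl dotC. Qed.

Lemma dot_ge0 u : 0 <= dot u u.
Proof. by apply: sumr_ge0 => i _; rewrite -expr2 sqr_ge0. Qed.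

Lemma dot0l u : dot 0 u = 0.
Proof. by rewrite -(scale0r 0) dotZl mul0r. Qed.

Lemma dotNl u v : dot (- u) v = - dot u v.
Proof. by rewrite -scaleN1r dotZl mulN1r. Qed.

Lemma dotNr u v : dot u (- v) = - dot u v.
Proof. by rewrite dotC dotNl dotC. Qed.

Lemma dot_eq0 u : dot u u = 0 -> u = 0.
Proof.
move=> /eqP; rewrite psumr_eq0; last by move=> i _; rewrite -expr2 sqr_ge0.
move=> /allP H; apply/rowP => i; rewrite mxE.
by have := H i (mem_index_enum _); rewrite /= -expr2 sqrf_eq0 => /eqP.
Qed.

Lemma cauchy_schwarz_dot u v : dot u v ^+ 2 <= dot u u * dot v v.
Proof.
have [/eqP/dot_eq0 ->|v0] := boolP (dot v v == 0).
  by rewrite dotC !dot0l mulr0 expr0n.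
have v_gt0 : 0 < dot v v by rewrite lt_neqAle eq_sym v0 dot_ge0.
have := dot_ge0 (dot v v *: u - dot u v *: v).
rewrite dotDl !dotDr !dotNl !dotNr !dotZl !dotZr (dotC v u) => H.
rewrite -subr_ge0 -(pmulr_rge0 _ v_gt0); apply: le_trans H _.
by rewrite le_eqVlt; apply/orP; left; apply/eqP; ring.
Qed.

Lemma eucl_ge0 u : 0 <= eucl u.
Proof. exact: sqrtr_ge0. Qed.

Lemma eucl_sqr u : eucl u ^+ 2 = dot u u.
Proof. by rewrite sqr_sqrtr// dot_ge0. Qed.

Lemma eucl_eq0 u : eucl u = 0 -> u = 0.
Proof. by move=> u0; apply: dot_eq0; rewrite -eucl_sqr u0 expr0n. Qed.

Lemma eucl_gt0 u : u != 0 -> 0 < eucl u.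
Proof.
move=> u0; rewrite lt_neqAle eucl_ge0 andbT eq_sym.
by apply: contra u0 => /eqP/eucl_eq0 ->.
Qed.

Lemma eucl0 : eucl (0 : 'rV[R]_N) = 0.
Proof. by rewrite /eucl dot0l sqrtr0. Qed.

Lemma euclZ c u : eucl (c *: u) = `|c| * eucl u.
Proof.
by rewrite /eucl dotZl dotZr mulrA -expr2 sqrtrM ?sqr_ge0// sqrtr_sqr.
Qed.

Lemma euclN u : eucl (- u) = eucl u.
Proof. by rewrite -scaleN1r euclZ normrN1 mul1r. Qed.

Lemma normr_dot_le u v : `|dot u v| <= eucl u * eucl v.
Proof.
rewrite -ler_sqr ?nnegrE ?mulr_ge0 ?eucl_ge0// real_normK ?num_real//.
by rewrite exprMn !eucl_sqr cauchy_schwarz_dot.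
Qed.

Lemma eucl_triangle u v : eucl (u + v) <= eucl u + eucl v.
Proof.
rewrite -ler_sqr ?nnegrE ?addr_ge0 ?eucl_ge0// eucl_sqr dotDl !dotDr sqrrD.
rewrite !eucl_sqr (dotC v u).
have := le_trans (ler_norm _) (normr_dot_le u v); lra.
Qed.

Lemma coord_le_eucl u i : `|u ord0 i| <= eucl u.
Proof.
rewrite -ler_sqr ?nnegrE ?eucl_ge0// real_normK ?num_real// eucl_sqr.
rewrite /dot (bigD1 i)//= -expr2 lerDl.
by apply: sumr_ge0 => j _; rewrite -expr2 sqr_ge0.
Qed.

(** The factor [N], in place of its square root, is crude but sufficient; [cube_radius] is
    calibrated on it. *)
Lemma eucl_le_coords u (a : R) : (forall i, `|u ord0 i| <= a) ->
  eucl u <= N%:R * a.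
Proof.
case: (posnP N) => [N0|N0] H.
  rewrite /eucl /dot big1 ?sqrtr0 ?N0 ?mul0r// => i _.
  by have := ltn_ord i; rewrite [X in (_ < X)%N]N0.
have a0 : 0 <= a by exact: le_trans (H (Ordinal N0)).
rewrite -ler_sqr ?nnegrE ?eucl_ge0 ?mulr_ge0// eucl_sqr.
apply: (@le_trans _ _ (\sum_(i < N) a ^+ 2)).
  apply: ler_sum => i _; rewrite -expr2 -real_normK ?num_real//.
  by rewrite ler_sqr ?nnegrE.
rewrite sumr_const card_ord exprMn -[leLHS]mulr_natl ler_wpM2r ?sqr_ge0//.
by rewrite -natrX ler_nat expnS leq_pmulr// expn1.
Qed.

Lemma rV_norm_le_eucl u : `|u| <= eucl u.
Proof.
rewrite [`|u|]mx_normrE; apply/bigmax_leP; split; first exact: eucl_ge0.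
by move=> -[i j] _ /=; rewrite ord1 coord_le_eucl.
Qed.

Lemma eucl_le_rV_norm u : eucl u <= N%:R * `|u|.
Proof. by apply: eucl_le_coords => i; exact: rV_coord_le_norm. Qed.

End euclidean_geometry.

Section continuity.
Variables (R : realType) (N : nat).

Lemma continuous_coord (T : topologicalType) (f : T -> 'rV[R]_N) i :
  continuous f -> continuous (fun x => f x ord0 i).
Proof.
move=> cf x.
exact: (continuous_comp (cf x) (@coord_continuous R 1 N ord0 i (f x))).
Qed.

Lemma continuous_row (T : topologicalType) (f : T -> 'rV[R]_N) :
  (forall i, continuous (fun x => f x ord0 i)) -> continuous f.
Proof.
move=> cf x; apply/cvgrPdist_lt => e e0.
have : \forall y \near x, forall i, `|f x ord0 i - f y ord0 i| < e.
  apply: filter_forall => i.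
  by have /cvgrPdist_lt/(_ _ e0) := cf i x.
apply: filterS => y H; apply: rV_mxnorm_ltP => // i.
by rewrite !mxE; exact: H.
Qed.

Lemma continuous_dot_for (T : topologicalType) (f g : T -> 'rV[R]_N) x :
  {for x, continuous f} -> {for x, continuous g} ->
  {for x, continuous (fun x => dot (f x) (g x))}.
Proof.
move=> cf cg; have cc (h : T -> 'rV[R]_N) i : {for x, continuous h} ->
    {for x, continuous (fun y => h y ord0 i)}.
  by move=> ch; exact: (continuous_comp ch (@coord_continuous R 1 N ord0 i (h x))).
rewrite /dot; apply: (@cvg_big _ _ +%R 0 xpredT) => [|i _].
  exact: add_continuous.
exact: (continuousM (cc f i cf) (cc g i cg)).
Qed.

Lemma continuous_dot (T : topologicalType) (f g : T -> 'rV[R]_N) :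
  continuous f -> continuous g -> continuous (fun x => dot (f x) (g x)).
Proof. by move=> cf cg x; exact: (continuous_dot_for (cf x) (cg x)). Qed.

Lemma continuous_eucl (T : topologicalType) (f : T -> 'rV[R]_N) :
  continuous f -> continuous (fun x => eucl (f x)).
Proof.
move=> cf x; have cd := @continuous_dot _ f f cf cf x.
exact: (continuous_comp cd (@sqrt_continuous R _)).
Qed.

End continuity.

(** * The sphere and the radial projection *)

Section sphere.
Variables (R : realType) (N : nat) (z : 'rV[R]_N) (rho : {posnum R}).

Lemma measurable_esphere : measurable (esphere z rho).
Proof.
rewrite -[X in measurable X]setTI.
exact: (measurable_eucl_sub z measurableT (measurable_set1 rho%:num)).
Qed.

Lemma esphere_neq x : esphere z rho x -> x != z.
Proof.
move=> H; apply/eqP => xz; move: H; rewrite /esphere/= xz subrr eucl0.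
by apply/eqP; rewrite lt_eqF.
Qed.

Lemma radial_esphere x : x != z -> esphere z rho (radial z rho x).
Proof.
rewrite -subr_eq0 => /eucl_gt0 xz; rewrite /esphere /radial/= addrAC subrr add0r.
rewrite euclZ ger0_norm ?divr_ge0 ?eucl_ge0// divfK// gt_eqF//.
Qed.

Lemma radial_center : radial z rho z = z.
Proof. by rewrite /radial subrr scaler0 addr0. Qed.

Lemma radial_id x : esphere z rho x -> radial z rho x = x.
Proof.
move=> xS; rewrite /radial.
have -> : eucl (x - z) = rho%:num by [].
by rewrite divff// scale1r addrC subrK.
Qed.

Lemma radial_homogeneous x (c : R) : 0 < c ->
  radial z rho (z + c *: (x - z)) = radial z rho x.
Proof.
move=> c0; rewrite /radial addrAC subrr add0r euclZ gtr0_norm//.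
rewrite scalerA invfM mulrA -(mulrA _ _ c) (mulrC _ c) mulrA mulrVK//.
by rewrite unitfE gt_eqF.
Qed.

Lemma esphere_compact : compact (esphere z rho).
Proof.
apply: bounded_closed_compact.
  exists (`|z| + rho%:num); split => //= M HM x Sx.
  apply/ltW; apply: le_lt_trans HM; rewrite -(subrK z x) addrC.
  rewrite (le_trans (ler_normD _ _))// lerD2l.
  by apply: le_trans (rV_norm_le_eucl _) _; rewrite Sx.
rewrite (_ : esphere z rho =
  (fun x => eucl (x - z)) @^-1` [set x | x = rho%:num])//.
apply: preimage_closed.
  move=> x _; apply: continuous_eucl => y.
  by apply: continuousB => //; exact: cst_continuous.
exact: closed_eq.
Qed.

End sphere.

(** * Functions of class C^1 *)

Section differentiability.
Variables (R : realType) (N : nat).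
Implicit Types (phi : 'rV[R]_N -> R) (x h g : 'rV[R]_N).

Lemma is_derive_line phi x (v : 'rV[R]_N) (s : R) :
  derivable phi (x + s *: v) v ->
  is_derive s 1 (fun t => phi (x + t *: v)) ('D_v phi (x + s *: v)).
Proof.
move=> dphi.
have E : (fun k : R => k^-1 *: (phi (x + (k *: 1 + s) *: v) - phi (x + s *: v))) =
         (fun k : R => k^-1 *: (phi (k *: v + (x + s *: v)) - phi (x + s *: v))).
  by apply/funext => k; rewrite [k *: 1]mulr1 scalerDl addrCA.
by split; [rewrite /derivable|rewrite /derive]; rewrite /= ?E.
Qed.

Lemma line_mvt phi (v : 'rV[R]_N) : (forall y, derivable phi y v) ->
  forall x (s : R), exists2 c : R, `|c| <= `|s| &
    phi (x + s *: v) - phi x = 'D_v phi (x + c *: v) * s.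
Proof.
move=> dphi x s; pose f t := phi (x + t *: v).
have df (t : R) : is_derive t 1 f ('D_v phi (x + t *: v)) by exact: is_derive_line.
have cf : forall a b : R, {within `[a, b], continuous f}.
  by move=> a b; apply: derivable_within_continuous => t _; case: (df t).
have f0 : f 0 = phi x by rewrite /f scale0r addr0.
rewrite -f0 -/(f s); have [s0|s0] := leP 0 s.
  have [c /itvP cs H] := MVT_segment s0 (fun t _ => df t) (cf _ _).
  by exists c; rewrite ?H ?subr0// !ger0_norm ?cs.
have [c /itvP cs H] := MVT_segment (ltW s0) (fun t _ => df t) (cf _ _).
exists c; first by rewrite !ler0_norm ?(ltW s0) ?cs// lerN2 cs.
by apply: oppr_inj; rewrite opprB H; ring.
Qed.

Lemma dot_is_linear g : linear (dot g : _ -> R^o).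
Proof. by move=> c u v; rewrite dotDr dotZr. Qed.

(* Telescoping along the coordinates reduces the increment to the
   one-dimensional mean value theorem. *)
Lemma C1_increment phi x :
  (forall i y, derivable phi y (delta_mx 0 i)) ->
  (forall i, {for x, continuous (partial i phi)}) ->
  forall e : R, 0 < e -> \forall h \near (0 : 'rV[R]_N),
    `|phi (x + h) - phi x - dot (grad phi x) h| <= e * `|h|.
Proof.
move=> dphi cphi e e0.
(* One share of the error per coordinate; [N.+1] keeps the denominator nonzero when [N = 0]. *)
pose e' := e / N.+1%:R.
have e'0 : 0 < e' by rewrite divr_gt0.
have : \forall y \near nbhs x, forall i : 'I_N, `|partial i phi x - partial i phi y| < e'.
  apply: filter_forall => i.
  by have /cvgrPdist_lt/(_ _ e'0) := cphi i.
case/nbhs_ballP => r /= r0 Hr.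
have H0 : \forall h \near (0 : 'rV[R]_N), `|h| < r by exact: nbhs0_lt.
near=> h.
have hr : `|h| < r by near: h.
pose tr k := \row_(i < N) (if (i < k)%N then h ord0 i else 0) : 'rV[R]_N.
have trS (k : 'I_N) : tr k.+1 = tr k + h ord0 k *: delta_mx 0 k.
  apply/rowP => i; rewrite !mxE eqxx/= ltnS leq_eqVlt.
  have [->|ik] := eqVneq i k; first by rewrite eqxx ltnn mulr1 add0r.
  by rewrite (_ : (i == k :> nat) = false) ?mulr0 ?addr0//; exact/negbTE.
have telescope : phi (x + h) - phi x =
    \sum_(k < N) (phi (x + tr k.+1) - phi (x + tr k)).
  rewrite -(big_mkord xpredT (fun k => phi (x + tr k.+1) - phi (x + tr k))).
  rewrite telescope_sumr//; congr (phi (x + _) - phi _).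
    by apply/rowP => i; rewrite mxE ltn_ord.
  by rewrite -[LHS]addr0; congr (_ + _); apply/rowP => i; rewrite !mxE.
rewrite telescope /dot -sumrB; apply: le_trans (ler_norm_sum _ _ _) _.
apply: (@le_trans _ _ (\sum_(k < N) e' * `|h|)); last first.
  rewrite sumr_const card_ord -mulrnAl ler_wpM2r// /e' -mulr_natl mulrCA.
  by rewrite ler_piMr ?(ltW e0)// ler_pdivrMr// mul1r ler_nat.
apply: ler_sum => k _.
rewrite trS addrA.
have [c ck ->] := line_mvt (dphi k) (x + tr k) (h ord0 k).
rewrite /grad mxE -mulrBl normrM ler_pM//; last exact: rV_coord_le_norm.
rewrite distrC; apply/ltW/Hr; rewrite -ball_normE /= -addrA opprD addrA subrr.
rewrite add0r normrN; apply: le_lt_trans hr; apply: rV_norm_le => // i.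
rewrite !mxE eqxx/=; have [->|ik] := eqVneq i k.
  by rewrite ltnn mulr1 add0r (le_trans ck)// rV_coord_le_norm.
by rewrite mulr0 addr0; case: ifPn => _; rewrite ?normr0// rV_coord_le_norm.
Unshelve. all: by end_near. Qed.

(** [smooth] speaks of partial derivatives only, whereas the chain rule along projected segments
    needs the total differential. The increment estimate says exactly that [dot (grad phi x)] is
    that differential. *)
Lemma C1_differentiable phi x :
  (forall i y, derivable phi y (delta_mx 0 i)) ->
  (forall i, {for x, continuous (partial i phi)}) ->
  differentiable phi x /\ forall v, 'D_v phi x = dot (grad phi x) v.
Proof.
move=> dphi cphi.
pose L : {linear 'rV[R]_N -> R^o} := HB.pack (dot (grad phi x) : _ -> R^o)
  (GRing.isLinear.Build _ _ _ _ _ (dot_is_linear (grad phi x))).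
have cL : continuous L.
  have cg : continuous (cst (grad phi x) : 'rV[R]_N -> 'rV[R]_N).
    exact: cst_continuous.
  have ci : continuous (id : 'rV[R]_N -> 'rV[R]_N) by move=> y; exact: cvg_id.
  exact: (continuous_dot cg ci).
have E : phi \o shift x = cst (phi x) + L +o_ (0 : 'rV[R]_N) id.
  apply/eqaddoP => e e0; near=> h => /=.
  rewrite [X in `|X|](_ : _ = phi (x + h) - phi x - dot (grad phi x) h).
    by near: h; exact: C1_increment.
  change (phi (h + x) - (phi x + dot (grad phi x) h) =
    phi (x + h) - phi x - dot (grad phi x) h).
  by rewrite [h + x]addrC opprD addrA.
have dE := diff_unique cL E.
have dx : differentiable (phi : _ -> R^o) x.
  by apply/diff_locallyP; rewrite dE.
by split => // v; rewrite deriveE// dE.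
Unshelve. all: by end_near. Qed.

Lemma derivable_curve phi (c : R -> 'rV[R]_N) (c' : 'rV[R]_N) (t : R) :
  (forall i y, derivable phi y (delta_mx 0 i)) ->
  (forall i, {for c t, continuous (partial i phi)}) ->
  (forall i, is_derive t 1 (fun s => c s ord0 i) (c' ord0 i)) ->
  is_derive t 1 (phi \o c) (dot (grad phi (c t)) c').
Proof.
move=> dphi cphi dc.
have [dpc De] := C1_differentiable dphi cphi.
have dct : derivable c t 1.
  by apply/derivable_mxP => i j; rewrite ord1; case: (dc j).
have dcd : differentiable c t by apply/derivable1_diffP.
have Dc : 'd c t 1 = c'.
  rewrite -deriveE// derive_mx//; apply/rowP => i; rewrite mxE.
  by case: (dc i).
split.
  by apply/derivable1_diffP; exact: differentiable_comp.
rewrite deriveE; last exact: differentiable_comp.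
by rewrite diff_comp//= Dc -De deriveE.
Qed.

Lemma smooth_continuous phi : smooth phi -> continuous phi.
Proof. by move=> /(_ [::])[]. Qed.

Lemma smooth_partial_continuous phi i : smooth phi -> continuous (partial i phi).
Proof. by move=> /(_ [:: i])[]. Qed.

Lemma smooth_derivable phi : smooth phi ->
  forall i x, derivable phi x (delta_mx 0 i).
Proof. by move=> /(_ [::])[]. Qed.

Lemma continuous_grad phi : smooth phi -> continuous (grad phi).
Proof.
move=> sphi; apply: continuous_row => i.
rewrite (_ : (fun _ => _) = partial i phi).
  exact: smooth_partial_continuous.
by apply/funext => x; rewrite mxE.
Qed.

End differentiability.

(** * Increments along radial projections of segments *)

Section increments.
Variable R : realType.
Local Notation leb := (@lebesgue_measure R).

(** Cauchy-Schwarz for the fundamental theorem of calculus: the integral of [(h' - c) ^+ 2] is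
    nonnegative, and [c], the mean slope, is the constant for which this is sharpest. *)
Lemma sqr_increment_le (h h' : R -> R) (a b : R) : a < b ->
  {in `[a, b], forall t : R, is_derive t 1 h (h' t)} ->
  {in `[a, b], forall t : R, {for t, continuous h'}} ->
  (h b - h a) ^+ 2 <= (b - a) * \int[leb]_(t in `[a, b]) (h' t ^+ 2).
Proof.
move=> ab dh ch'.
have ch'w : {within `[a, b], continuous h'}.
  by apply: continuous_in_subspaceT => t; rewrite inE; exact: ch'.
have mI : measurable (`[a, b]%classic : set (measurableTypeR R)) by [].
have ih' : leb.-integrable `[a, b] (EFin \o h').
  exact: continuous_compact_integrable (@segment_compact _ _ _) ch'w.
have ih'2 : leb.-integrable `[a, b] (EFin \o (fun t => h' t ^+ 2)).
  apply: continuous_compact_integrable; first exact: segment_compact.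
  apply: continuous_in_subspaceT => t; rewrite inE => tab.
  rewrite (_ : (fun _ => _) = (h' \* h')); last by apply/funext => s; rewrite expr2.
  by apply: continuousM; exact: ch'.
have chw : {within `[a, b], continuous h}.
  by apply: derivable_within_continuous => t tab; case: (dh t tab).
have dhoo : derivable_oo_LRcontinuous h a b.
  have /(continuous_within_itvP _ ab)[_ ha hb] := chw.
  split => // t tab; have /dh[] // : t \in `[a, b].
  by apply: subset_itv_oo_cc tab.
have I1 : \int[leb]_(t in `[a, b]) h' t = h b - h a.
  rewrite /Rintegral (continuous_FTC2 ab ch'w dhoo)// => t tab.
  have /dh[_ <-] : t \in `[a, b] by apply: subset_itv_oo_cc tab.
  by rewrite derive1E.
pose c := (h b - h a) / (b - a).
have icst (k : R) : leb.-integrable `[a, b] (EFin \o cst k).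
  apply: continuous_compact_integrable; first exact: segment_compact.
  by apply: continuous_in_subspaceT => t _; exact: cst_continuous.
have i1 : leb.-integrable `[a, b] (EFin \o (fun t => c * 2 * h' t)).
  by rewrite (_ : _ \o _ = (fun t => (c * 2)%:E * (h' t)%:E)%E)//; exact: integrableZl.
have i2 : leb.-integrable `[a, b] (EFin \o (fun t => h' t ^+ 2 - c * 2 * h' t)).
  by rewrite (_ : _ \o _ = (fun t => (h' t ^+ 2)%:E - (c * 2 * h' t)%:E)%E)//; exact: integrableB.
have : 0 <= \int[leb]_(t in `[a, b]) ((h' t - c) ^+ 2).
  by apply: Rintegral_ge0 => t _; exact: sqr_ge0.
have -> : \int[leb]_(t in `[a, b]) ((h' t - c) ^+ 2) =
    \int[leb]_(t in `[a, b]) ((h' t ^+ 2 - c * 2 * h' t) + c ^+ 2).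
  by apply: eq_Rintegral => t _; ring.
rewrite RintegralD//; last exact: icst.
rewrite RintegralB// RintegralZl// I1 Rintegral_cst//.
rewrite [X in fine X]lebesgue_measure_itv/= lte_fin ab /=.
have ba : 0 < b - a by rewrite subr_gt0.
move=> H; rewrite -ler_pdivrMl// -subr_ge0; apply: le_trans H _; rewrite le_eqVlt; apply/orP; left; apply/eqP.
by rewrite /c; field; exact: lt0r_neq0.
Qed.

End increments.

Section radial_path.
Variables (R : realType) (N : nat) (z : 'rV[R]_N) (rho : {posnum R}).
Implicit Types (phi : 'rV[R]_N -> R) (x u v w p : 'rV[R]_N).

(* the velocity of [radial] along a line of direction [v], at the point [z + p] *)
Definition radial_velocity p v : 'rV[R]_N :=
  (rho%:num / eucl p) *: (v - (dot p v / eucl p ^+ 2) *: p).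

Lemma is_derive_radial_line x v (t : R) i : x + t *: v != z ->
  is_derive t 1 (fun s => radial z rho (x + s *: v) ord0 i)
    (radial_velocity (x + t *: v - z) v ord0 i).
Proof.
pose u := x - z => xtz.
have pE (s : R) : x + s *: v - z = u + s *: v by rewrite addrAC.
clearbody u; pose A := dot u u; pose B := dot u v; pose C := dot v v.
(* The squared distance to the centre is a quadratic polynomial in [s], positive at [t], so the
   projection is differentiated through its square root. *)
pose q (s : R) := A + (B *+ 2) * s + C * s ^+ 2.
have qE s : q s = dot (u + s *: v) (u + s *: v).
  by rewrite dotDl !dotDr !dotZl !dotZr (dotC v u) /q /A /B /C; ring.
have BE : dot u v = B by [].
have CE : dot v v = C by [].
clearbody A B C; have q0 : 0 < q t.
  by rewrite qE -eucl_sqr exprn_gt0// eucl_gt0// -pE subr_eq0.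
have dq : is_derive t 1 q (B *+ 2 + C * (2 * t)).
  have d1 : is_derive t 1 (fun s : R => s) 1 by exact: is_derive_id.
  have d2 : is_derive t 1 q (0 + (B *+ 2) *: 1 + C *: ((2%:R * t ^+ 1) *: 1)).
    exact: (is_deriveD (is_deriveD (is_derive_cst A t 1)
      (is_deriveZ (B *+ 2) d1)) (is_deriveZ C (is_deriveX 2 d1))).
  apply: (is_derive_eq d2).
  change (0 + B *+ 2 * 1 + C * ((2 * t ^+ 1) * 1) = B *+ 2 + C * (2 * t)).
  by ring.
have sq0 : 0 < Num.sqrt (q t) by rewrite sqrtr_gt0.
have ds : is_derive t 1 (Num.sqrt \o q)
   ((2 * Num.sqrt (q t))^-1 * (B *+ 2 + C * (2 * t))).
  by apply: is_derive1_comp; exact: is_derive1_sqrt.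
have dV : is_derive t 1 (fun s => ((Num.sqrt \o q) s)^-1)
   (- (Num.sqrt (q t)) ^- 2 *: ((2 * Num.sqrt (q t))^-1 * (B *+ 2 + C * (2 * t)))).
  by apply: (is_deriveV _ ds); exact: lt0r_neq0.
have d1 : is_derive t 1 (fun s : R => s) 1 by exact: is_derive_id.
have d3 := is_deriveD (is_derive_cst (z ord0 i) t 1)
  (is_deriveZ rho%:num (is_deriveM dV (is_deriveD (is_derive_cst (u ord0 i) t 1)
    (is_deriveZ (v ord0 i) d1)))).
rewrite (_ : (fun _ => _) = cst (z ord0 i) + rho%:num *:
  ((fun s => ((Num.sqrt \o q) s)^-1) * (cst (u ord0 i) + (v ord0 i *: (fun s : R => s))))); last first.
  apply/funext => s; rewrite /radial pE !mxE /eucl -qE.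
  change (z ord0 i + rho%:num / Num.sqrt (q s) * (u ord0 i + s * v ord0 i) =
    z ord0 i + rho%:num * ((Num.sqrt (q s))^-1 * (u ord0 i + v ord0 i * s))).
  by rewrite mulrA (mulrC s).
apply: (is_derive_eq d3); rewrite /radial_velocity pE !mxE.
rewrite (_ : eucl (u + t *: v) = Num.sqrt (q t)); last by rewrite /eucl qE.
rewrite dotDl dotZl BE CE.
set S := Num.sqrt (q t) in sq0 *.
change (0 + rho%:num * (S^-1 * (0 + v ord0 i * 1) +
  (u ord0 i + v ord0 i * t) * (- S ^- 2 * ((2 * S)^-1 * (B *+ 2 + C * (2 * t))))) =
  rho%:num / S * (v ord0 i - (B + t * C) / S ^+ 2 * (u ord0 i + t * v ord0 i))).
by field; exact: lt0r_neq0.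
Qed.

Lemma dot_radial_velocity p v :
  p != 0 -> dot (radial_velocity p v) p = 0.
Proof.
move=> p0; rewrite dotZl dotDl dotNl dotZl eucl_sqr (dotC v p) divfK ?subrr ?mulr0//.
by rewrite -eucl_sqr expf_neq0// gt_eqF// eucl_gt0.
Qed.

Lemma radial_velocity_le p v : p != 0 ->
  dot (radial_velocity p v) (radial_velocity p v) <=
  (rho%:num / eucl p) ^+ 2 * eucl v ^+ 2.
Proof.
move=> p0; rewrite dotZl dotZr mulrA -expr2 ler_wpM2l ?sqr_ge0//.
have p_neq0 : dot p p != 0 by rewrite -eucl_sqr expf_neq0// gt_eqF// eucl_gt0.
rewrite dotDl !dotDr !dotNl !dotNr !dotZl !dotZr (dotC v p) !eucl_sqr.
rewrite -subr_ge0.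
rewrite [leRHS](_ : _ = dot p v ^+ 2 / dot p p); last by field.
by rewrite divr_ge0 ?sqr_ge0 ?dot_ge0.
Qed.

Lemma outer_normal_radial x : x != z ->
  outer_normal z rho (radial z rho x) = (eucl (x - z))^-1 *: (x - z).
Proof.
move=> xz; rewrite /outer_normal /radial addrAC subrr add0r scalerA mulrA mulVf//.
by rewrite mul1r.
Qed.

Lemma dot_tangential_grad phi x v : x != z -> dot v (x - z) = 0 ->
  dot (tangential_grad z rho phi (radial z rho x)) v =
  dot (grad phi (radial z rho x)) v.
Proof.
move=> xz v0; have : dot (outer_normal z rho (radial z rho x)) v = 0.
  by rewrite outer_normal_radial// dotZl dotC v0 mulr0.
rewrite /tangential_grad; move: (outer_normal _ _ _) (grad _ _) => n g nv.
by rewrite dotDl dotNl dotZl nv mulr0 subr0.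
Qed.

(** The velocity of the projected path is tangent to the sphere, so only the tangential gradient
    acts on it. Its length is at most [rho |v| / |x - z|], which is where the distance [c] to the
    centre enters. *)
Lemma sqr_radial_derivative_le phi x v (c : R) : 0 < c -> c <= eucl (x - z) ->
  dot (grad phi (radial z rho x)) (radial_velocity (x - z) v) ^+ 2 <=
  (rho%:num * eucl v / c) ^+ 2 *
  dot (tangential_grad z rho phi (radial z rho x))
      (tangential_grad z rho phi (radial z rho x)).
Proof.
move=> c0 cx.
have xz : x - z != 0.
  by apply: contraTneq cx => ->; rewrite eucl0 -ltNge.
have xz' : x != z by rewrite -subr_eq0.
have <- := dot_tangential_grad phi xz' (dot_radial_velocity v xz).
move: (tangential_grad _ _ _ _) => T.
apply: le_trans (cauchy_schwarz_dot _ _) _; rewrite mulrC ler_wpM2r ?dot_ge0//.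
apply: le_trans (radial_velocity_le _ xz) _.
rewrite -exprMn mulrAC ler_sqr ?nnegrE ?mulr_ge0 ?invr_ge0 ?mulr_ge0 ?eucl_ge0 ?(ltW c0)//.
by rewrite ler_wpM2l ?mulr_ge0 ?eucl_ge0// lef_pV2 ?posrE// (lt_le_trans c0).
Qed.

Lemma continuous_radial x : x != z -> {for x, continuous (radial z rho)}.
Proof.
move=> xz.
have cs : continuous (fun y : 'rV[R]_N => y - z).
  by move=> y; apply: continuousB => //; exact: cst_continuous.
have cV : {for x, continuous (fun y : 'rV[R]_N => (eucl (y - z))^-1)}.
  apply: (@continuousV _ _ (fun y : 'rV[R]_N => eucl (y - z))).
    by rewrite gt_eqF// eucl_gt0// subr_eq0.
  exact: continuous_eucl.
have c0 (a : R) : {for x, continuous (cst a : 'rV[R]_N -> R)}.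
  exact: cst_continuous.
have cz : {for x, continuous (cst z : 'rV[R]_N -> 'rV[R]_N)}.
  exact: cst_continuous.
exact: (continuousD cz (continuousZ (continuousM (c0 rho%:num) cV) (cs x))).
Qed.

Lemma continuous_line x v : continuous (fun t : R => x + t *: v).
Proof.
move=> t.
have cx : {for t, continuous (cst x : R -> 'rV[R]_N)} by exact: cst_continuous.
have ct : {for t, continuous (fun t : R => t)} by exact: cvg_id.
exact: (continuousD cx (continuousZr_tmp (a := v) ct)).
Qed.

Lemma measurable_line x v :
  measurable_fun setT (fun t : measurableTypeR R => x + t *: v).
Proof.
apply: measurable_fun_rV => i; under eq_fun do rewrite !mxE.
by apply: measurable_funD => //; exact: measurable_funM.
Qed.

End radial_path.

(** * The Poincare inequality on the sphere *)

Section poincare.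
Variables (R : realType) (N : nat) (z : 'rV[R]_N) (rho : {posnum R}).
Implicit Types (phi : 'rV[R]_N -> R) (x u v w p y : 'rV[R]_N).
Local Notation leb := (@lebesgue_measure R).
Local Notation lam := (lebesgue_rV R N).

Definition sqr_tangential_grad phi y : R :=
  dot (tangential_grad z rho phi y) (tangential_grad z rho phi y).

Lemma continuous_tangential_grad phi : smooth phi ->
  continuous (tangential_grad z rho phi).
Proof.
move=> sphi; have cg := continuous_grad sphi.
have cn : continuous (outer_normal z rho).
  have cs : continuous (fun y : 'rV[R]_N => y - z).
    by move=> y; apply: continuousB => //; exact: cst_continuous.
  have cc : continuous (cst rho%:num^-1 : 'rV[R]_N -> R) by exact: cst_continuous.
  by move=> y; exact: (continuousZ (cc y) (cs y)).
move=> y; exact: (continuousB (cg y)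
  (continuousZ (continuous_dot cg cn (x := y)) (cn y))).
Qed.

Lemma continuous_sqr_tangential_grad phi : smooth phi ->
  continuous (sqr_tangential_grad phi).
Proof.
by move=> sphi; apply: continuous_dot; exact: continuous_tangential_grad.
Qed.

Lemma continuous_radial_velocity v p : p != 0 ->
  {for p, continuous (fun q : 'rV[R]_N => radial_velocity rho q v)}.
Proof.
move=> p0; have E0 : eucl p != 0 by rewrite gt_eqF// eucl_gt0.
have ci : continuous (fun q : 'rV[R]_N => q) by move=> q; exact: cvg_id.
have cE := @continuous_eucl R N _ _ ci.
have cv : continuous (cst v : 'rV[R]_N -> 'rV[R]_N) by exact: cst_continuous.
have c0 (a : R) : {for p, continuous (cst a : 'rV[R]_N -> R)}.
  exact: cst_continuous.
have cV : {for p, continuous (fun q : 'rV[R]_N => (eucl q)^-1)}.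
  exact: (continuousV E0 (cE p)).
have cV2 : {for p, continuous (fun q : 'rV[R]_N => (eucl q ^+ 2)^-1)}.
  rewrite (_ : (fun _ => _) =
    (fun q : 'rV[R]_N => (eucl q)^-1) \* (fun q : 'rV[R]_N => (eucl q)^-1)).
    exact: continuousM.
  by apply/funext => q; rewrite expr2 invfM.
have cd := continuous_dot ci cv.
exact: (continuousZ (continuousM (c0 rho%:num) cV)
  (continuousB (cv p) (continuousZ (continuousM (cd p) cV2) (ci p)))).
Qed.

(** Only the half of the segment nearer to [w] is travelled: there [t >= 2^-1], so
    [w |-> x + t (w - x)] shrinks volumes by a factor [2 ^ N] at most when [w] is integrated
    later. *)
Lemma radial_half_increment phi x w (c : R) : smooth phi -> 0 < c ->
  {in `[2^-1, 1], forall t : R, c <= eucl (x + t *: (w - x) - z)} ->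
  (((phi (radial z rho w) - phi (radial z rho (x + 2^-1 *: (w - x)))) ^+ 2)%R%:E <=
  \int[leb]_(t in `[2^-1%R, 1%R])
    ((rho%:num * eucl (w - x) / c) ^+ 2 *
     sqr_tangential_grad phi (radial z rho (x + t *: (w - x))))%:E)%E.
Proof.
move=> sphi c0 cx; set v := w - x in cx *.
pose h t := phi (radial z rho (x + t *: v)).
pose h' t := dot (grad phi (radial z rho (x + t *: v)))
  (radial_velocity rho (x + t *: v - z) v).
have nz (t : R) : t \in `[2^-1, 1] -> x + t *: v - z != 0.
  by move=> /cx; apply: contraTneq => ->; rewrite eucl0 -ltNge.
have nz' (t : R) : t \in `[2^-1, 1] -> x + t *: v != z.
  by move=> /nz; rewrite subr_eq0.
have dh : {in `[2^-1, 1], forall t : R, is_derive t 1 h (h' t)}.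
  move=> t tI; apply: derivable_curve.
  - exact: smooth_derivable.
  - by move=> i; exact: smooth_partial_continuous.
  - by move=> i; apply: is_derive_radial_line; exact: nz'.
have cl := @continuous_line R N x v.
have ch' : {in `[2^-1, 1], forall t : R, {for t, continuous h'}}.
  move=> t tI.
  have c1 : {for t, continuous (fun s : R => grad phi (radial z rho (x + s *: v)))}.
    have cr := continuous_comp (cl t) (@continuous_radial R N z rho _ (nz' _ tI)).
    exact: (continuous_comp cr (continuous_grad sphi (x := _))).
  have c2 : {for t, continuous (fun s : R => radial_velocity rho (x + s *: v - z) v)}.
    have cz : {for t, continuous (cst z : R -> 'rV[R]_N)} by exact: cst_continuous.
    exact: (continuous_comp (continuousB (cl t) cz)
      (@continuous_radial_velocity v _ (nz _ tI))).
  exact: continuous_dot_for c1 c2.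
have lt1 : 2^-1 < 1 :> R by lra.
have h1 : h 1 = phi (radial z rho w) by rewrite /h scale1r /v addrC subrK.
have mI : measurable (`[2^-1, 1]%classic : set (measurableTypeR R)) by [].
have ih'2 : leb.-integrable `[2^-1, 1] (EFin \o (fun t => h' t ^+ 2)).
  apply: continuous_compact_integrable; first exact: segment_compact.
  apply: continuous_in_subspaceT => t; rewrite inE => tI.
  rewrite (_ : (fun _ => _) = (h' \* h')); last by apply/funext => s; rewrite expr2.
  by apply: continuousM; exact: ch'.
have H := sqr_increment_le lt1 dh ch'.
apply: (@le_trans _ _ (\int[leb]_(t in `[2^-1, 1]) (h' t ^+ 2))%:E).
  rewrite lee_fin -h1 -/(h 2^-1); apply: le_trans H _.
  rewrite ler_piMl; [by []| |lra].
  by apply: Rintegral_ge0 => t _; exact: sqr_ge0.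
rewrite fineK; last exact: integrable_fin_num.
apply: ge0_le_integral => //=.
- by move=> t _; rewrite lee_fin sqr_ge0.
- by case/integrableP : ih'2.
- apply/measurable_EFinP/measurable_funTS.
  apply: measurable_funM => //.
  have mT := continuous_rV_measurable (continuous_sqr_tangential_grad sphi).
  have mrl := measurableT_comp (measurable_radial z rho) (@measurable_line R N x v).
  exact: (measurableT_comp mT mrl).
- by move=> t tI; rewrite lee_fin; apply: sqr_radial_derivative_le => //; exact: cx.
Qed.

Definition annulus : set 'rV[R]_N :=
  [set x | rho%:num / 2 <= eucl (x - z) < rho%:num].

Definition punctured_ball : set 'rV[R]_N :=
  [set x | 0 < eucl (x - z) < rho%:num].

Lemma measurable_annulus : measurable annulus.
Proof.
rewrite (_ : annulus = setT `&` (fun x => eucl (x - z)) @^-1`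
    `[rho%:num / 2, rho%:num[%classic); first exact: measurable_eucl_sub.
by rewrite setTI; apply/seteqP; split => x /=; rewrite in_itv.
Qed.

Lemma measurable_punctured_ball : measurable punctured_ball.
Proof.
rewrite (_ : punctured_ball = setT `&` (fun x => eucl (x - z)) @^-1`
    `]0, rho%:num[%classic); first exact: measurable_eucl_sub.
by rewrite setTI; apply/seteqP; split => x /=; rewrite in_itv.
Qed.

(* the energy density of the 0-homogeneous extension, up to a factor [|x - z|^2] *)
Definition density phi x : R :=
  \1_punctured_ball x * sqr_tangential_grad phi (radial z rho x).

Lemma density_ge0 phi x : 0 <= density phi x.
Proof. by rewrite mulr_ge0// dot_ge0. Qed.

Lemma measurable_density phi : smooth phi -> measurable_fun setT (density phi).
Proof.
move=> sphi; apply: measurable_funM.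
  by apply: measurable_indic; exact: measurable_punctured_ball.
have mT := continuous_rV_measurable (continuous_sqr_tangential_grad sphi).
exact: (measurableT_comp mT (measurable_radial z rho)).
Qed.

(** The energy met on the half of the segment nearer to [xw.2]. The time interval is encoded by an
    indicator so that Tonelli applies on full spaces. *)
Definition path_energy phi (xw : 'rV[R]_N * 'rV[R]_N) : \bar R :=
  (\int[leb]_t (\1_(`[2^-1%R, 1%R]%classic) t *
     density phi (xw.1 + t *: (xw.2 - xw.1)))%R%:E)%E.

Definition good_pair x w : Prop :=
  forall t : R, 0 <= t <= 1 -> rho%:num / 4 <= eucl (x + t *: (w - x) - z).

Lemma eball_convex x w (t : R) : eucl (x - z) < rho%:num ->
  eucl (w - z) < rho%:num -> 0 <= t <= 1 ->
  eucl (x + t *: (w - x) - z) < rho%:num.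
Proof.
move=> xb wb /andP[t0 t1].
have -> : x + t *: (w - x) - z = (1 - t) *: (x - z) + t *: (w - z).
  by apply/rowP => i; rewrite !mxE; ring.
apply: le_lt_trans (eucl_triangle _ _) _.
rewrite !euclZ !ger0_norm ?subr_ge0//.
have [->|tn0] := eqVneq t 0; first by rewrite mul0r addr0 subr0 mul1r.
have t_gt0 : 0 < t by rewrite lt_neqAle eq_sym tn0.
have -> : rho%:num = (1 - t) * rho%:num + t * rho%:num by ring.
by rewrite ler_ltD ?ler_wpM2l ?subr_ge0 ?ltr_pM2l// ltW.
Qed.

Lemma path_energyE phi x w :
  path_energy phi (x, w) =
  (\int[leb]_(t in `[2^-1%R, 1%R]) (density phi (x + t *: (w - x))%R)%:E)%E.
Proof.
rewrite [RHS]integral_mkcond; apply: eq_integral => t _ /=.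
by rewrite patchE indicE; case: ifPn => _; rewrite ?mul1r ?mul0r.
Qed.

Lemma half_increment_le_path_energy phi x w : smooth phi ->
  annulus x -> annulus w -> good_pair x w ->
  (((phi (radial z rho w) - phi (radial z rho (x + 2^-1 *: (w - x)))) ^+ 2)%R%:E <=
  (64 * rho%:num ^+ 2)%:E * path_energy phi (x, w))%E.
Proof.
move=> sphi /andP[_ xr] /andP[_ wr] gxw.
have r0 : 0 < rho%:num / 4 by rewrite divr_gt0.
apply: le_trans (radial_half_increment sphi r0 _) _.
  by move=> t; rewrite in_itv/= => /andP[t0 t1]; apply: gxw; lra.
have mI : measurable (`[2^-1, 1]%classic : set (measurableTypeR R)) by [].
have mk : measurable_fun (`[2^-1, 1]%classic : set (measurableTypeR R))
    (fun t => (density phi (x + t *: (w - x)))%:E).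
  apply/measurable_EFinP/measurable_funTS.
  exact: (measurableT_comp (measurable_density sphi) (@measurable_line R N x (w - x))).
rewrite path_energyE -ge0_integralZl//; first last.
- by move=> t _; rewrite lee_fin density_ge0.
apply: ge0_le_integral => //=.
- by move=> t _; rewrite lee_fin mulr_ge0 ?sqr_ge0 ?dot_ge0.
- apply/measurable_EFinP/measurable_funTS; apply: measurable_funM => //.
  have mT := continuous_rV_measurable (continuous_sqr_tangential_grad sphi).
  have mrl := measurableT_comp (measurable_radial z rho) (@measurable_line R N x (w - x)).
  exact: (measurableT_comp mT mrl).
- exact: measurable_funeM.
move=> t; rewrite in_itv/= => /andP[t0 t1].
have t01 : 0 <= t <= 1 by apply/andP; split => //; lra.
rewrite -EFinM lee_fin /density indicE mem_set ?mul1r; last first.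
  by rewrite /punctured_ball/= (lt_le_trans r0) ?gxw//= eball_convex.
rewrite ler_wpM2r ?dot_ge0//.
have wx : eucl (w - x) <= 2 * rho%:num.
  have -> : w - x = (w - z) + - (x - z) by rewrite opprB addrA subrK.
  by apply: le_trans (eucl_triangle _ _) _; rewrite euclN; lra.
(* The chord has length at most [2 rho] and stays at distance at least [rho / 4] from the centre. *)
have -> : 64 * rho%:num ^+ 2 = (rho%:num * (2 * rho%:num) / (rho%:num / 4)) ^+ 2.
  by field; exact: lt0r_neq0.
by rewrite ler_sqr ?nnegrE ?mulr_ge0 ?invr_ge0 ?eucl_ge0// ler_wpM2r ?invr_ge0 ?ler_wpM2l.
Qed.

Lemma good_pair_sym x w : good_pair x w -> good_pair w x.
Proof.
move=> gxw t /andP[t0 t1].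
have -> : w + t *: (x - w) = x + (1 - t) *: (w - x).
  by apply/rowP => i; rewrite !mxE; ring.
by apply: gxw; apply/andP; split; lra.
Qed.

(** The increment is split at the midpoint [m] of the segment, which both half paths reach;
    [(a - b)^2 <= 2 ((a - m)^2 + (b - m)^2)] doubles the constant. *)
Lemma increment_le_path_energy phi x w : smooth phi ->
  annulus x -> annulus w -> good_pair x w ->
  (((phi (radial z rho x) - phi (radial z rho w)) ^+ 2)%R%:E <=
  (128 * rho%:num ^+ 2)%:E * (path_energy phi (x, w) + path_energy phi (w, x)))%E.
Proof.
move=> sphi Ax Aw gxw.
have H1 := half_increment_le_path_energy sphi Ax Aw gxw.
have H2 := half_increment_le_path_energy sphi Aw Ax (good_pair_sym gxw).
move: H1 H2.
have -> : w + 2^-1 *: (x - w) = x + 2^-1 *: (w - x).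
  by apply/rowP => i; rewrite !mxE; field.
set m := phi (radial z rho (x + _)).
set a := phi _; set b := phi _ => H1 H2.
apply: (@le_trans _ _ (2%:E * (((a - m) ^+ 2)%R%:E + ((b - m) ^+ 2)%R%:E))%E).
  rewrite -EFinD -EFinM lee_fin -subr_ge0.
  rewrite (_ : _ - _ = (a + b - 2 * m) ^+ 2) ?sqr_ge0//; ring.
rewrite (_ : 128 * _ = 2 * (64 * rho%:num ^+ 2)); last by ring.
rewrite EFinM -muleA lee_pmul2l// [leRHS]muleDr//; last first.
  by rewrite ge0_adde_def// inE; apply: integral_ge0 => t _; rewrite lee_fin mulr_ge0// density_ge0.
exact: leeD H1 H2.
Qed.

End poincare.

(** * Third points visible from two given points of the annulus *)

Section common_cube.
Variables (R : realType) (N : nat) (z : 'rV[R]_N) (rho : {posnum R}).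
Implicit Types x y u v w e c : 'rV[R]_N.

(** The hypothesis bounds the angle at the centre by 120 degrees. With [a' = (1 - t) a] and
    [b' = t b], the squared distance is then at least [a'^2 - a' b' + b'^2 = ((a' + b')^2 + 3 (a' -
    b')^2) / 4], and [a' + b' >= rho / 2]. *)
Lemma good_pair_of_dot x w :
  rho%:num / 2 <= eucl (x - z) -> rho%:num / 2 <= eucl (w - z) ->
  - (eucl (x - z) * eucl (w - z) / 2) <= dot (x - z) (w - z) ->
  good_pair z rho x w.
Proof.
move=> xA wA xw t /andP[t0 t1].
have -> : x + t *: (w - x) - z = (1 - t) *: (x - z) + t *: (w - z).
  by apply/rowP => i; rewrite !mxE; ring.
move: xA wA xw; set a := eucl (x - z); set b := eucl (w - z) => xA wA xw.
have r0 : 0 < rho%:num by [].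
rewrite -ler_sqr ?nnegrE ?eucl_ge0 ?divr_ge0// eucl_sqr.
rewrite dotDl !dotDr !dotZl !dotZr -!eucl_sqr -/a -/b (dotC (w - z)).
have h1 : 0 <= ((1 - t) * a - t * b) ^+ 2 by exact: sqr_ge0.
have h2 : rho%:num / 2 <= (1 - t) * a + t * b.
  have -> : rho%:num / 2 = (1 - t) * (rho%:num / 2) + t * (rho%:num / 2) by ring.
  by rewrite lerD ?ler_wpM2l ?subr_ge0.
have h3 : (rho%:num / 2) ^+ 2 <= ((1 - t) * a + t * b) ^+ 2.
  by rewrite ler_sqr ?nnegrE ?divr_ge0// (le_trans _ h2) ?divr_ge0.
have h4 : 0 <= (t * (1 - t)) * (dot (x - z) (w - z) + a * b / 2).
  by rewrite mulr_ge0 ?mulr_ge0 ?subr_ge0//; lra.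
move: h1 h3 h4; move: (dot _ _) => d; clearbody a b.
clear; move: (rho%:num) => r h1 h3 h4; nra.
Qed.

(** A quarter turn in the plane of the first two coordinates; if [u] vanishes there, a basis vector
    of that plane will do. *)
Lemma exists_orthogonal_direction u : (1 < N)%N -> u != 0 ->
  exists2 e, e != 0 & dot e u = 0.
Proof.
move=> N1 u0; pose i0 := Ordinal (ltnW N1); pose i1 := Ordinal N1.
have i01 : i1 != i0 by [].
have dotE e : (forall i, i != i0 -> i != i1 -> e ord0 i = 0) ->
    dot e u = e ord0 i0 * u ord0 i0 + e ord0 i1 * u ord0 i1.
  move=> e0; rewrite /dot (bigD1 i0)//= (bigD1 i1)//= big1 ?addr0// => i /andP[? ?].
  by rewrite e0// mul0r.
have [/andP[/eqP u00 /eqP u01]|] := boolP ((u ord0 i0 == 0) && (u ord0 i1 == 0)).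
  exists (delta_mx 0 i0).
    apply/eqP => /rowP/(_ i0); rewrite !mxE !eqxx; apply/eqP; exact: oner_neq0.
  rewrite dotE ?u00 ?u01 ?mulr0 ?addr0// => i ii0 _.
  by rewrite mxE (negbTE ii0) andbF.
move=> unz; exists (\row_i (if i == i0 then - u ord0 i1
    else if i == i1 then u ord0 i0 else 0)).
  apply: contra unz => /eqP/rowP e0; have := e0 i0; have := e0 i1.
  by rewrite !mxE eqxx (negbTE i01) eqxx => -> /eqP; rewrite oppr_eq0 => ->; rewrite eqxx.
rewrite dotE => [|i ii0 ii1]; last by rewrite mxE (negbTE ii0) (negbTE ii1).
by rewrite !mxE eqxx (negbTE i01) eqxx; ring.
Qed.

(** The bisector [|v| u + |u| v] makes an acute or right angle with both vectors. It degenerates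
    only when they point in opposite directions, and then any direction orthogonal to one is
    orthogonal to the other. *)
Lemma exists_common_direction u v : (1 < N)%N -> u != 0 -> v != 0 ->
  exists e, [/\ eucl e = 1, 0 <= dot e u & 0 <= dot e v].
Proof.
move=> N1 u0 v0.
suff [e [e0 eu ev]] : exists e, [/\ e != 0, 0 <= dot e u & 0 <= dot e v].
  have E := eucl_gt0 e0; exists ((eucl e)^-1 *: e); split.
  - by rewrite euclZ gtr0_norm ?invr_gt0// mulVf// gt_eqF.
  - by rewrite dotZl mulr_ge0// invr_ge0 ltW.
  - by rewrite dotZl mulr_ge0// invr_ge0 ltW.
have [e0|e0] := eqVneq (eucl v *: u + eucl u *: v) 0.
  have [e en eu] := exists_orthogonal_direction N1 u0.
  exists e; split; rewrite ?eu//.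
  have : dot e (eucl v *: u + eucl u *: v) = 0 by rewrite e0 dotC dot0l.
  rewrite dotDr !dotZr eu mulr0 add0r => /eqP.
  by rewrite mulf_eq0 gt_eqF ?eucl_gt0//= => /eqP ->.
exists (eucl v *: u + eucl u *: v); split => //.
- rewrite dotDl !dotZl -eucl_sqr.
  have : - (eucl v * eucl u) <= dot v u.
    by rewrite lerNl; apply: le_trans (normr_dot_le _ _); rewrite -normrN ler_norm.
  move=> /(ler_wpM2l (eucl_ge0 u)); lra.
- rewrite dotDl !dotZl -eucl_sqr.
  have : - (eucl u * eucl v) <= dot u v.
    by rewrite lerNl; apply: le_trans (normr_dot_le _ _); rewrite -normrN ler_norm.
  move=> /(ler_wpM2l (eucl_ge0 v)); lra.
Qed.

(** With the factor [N] of [eucl_le_coords], the cube stays within Euclidean distance [rho / 8] of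
    its centre. *)
Definition cube_radius : R := rho%:num / (8 * N%:R).

(* Two points of the annulus may be antipodal, but they always share a whole
   cube of third points that both see at a distance from the centre. *)
Lemma exists_common_cube x y : (1 < N)%N ->
  annulus z rho x -> annulus z rho y ->
  exists c, forall w, cube c cube_radius w ->
    [/\ annulus z rho w, good_pair z rho x w & good_pair z rho y w].
Proof.
move=> N1 Ax Ay; have r0 : 0 < rho%:num by [].
have nz x' : annulus z rho x' -> x' - z != 0.
  move=> /andP[+ _]; apply: contraTneq => ->; rewrite eucl0 -ltNge.
  by rewrite divr_gt0.
have [e [e1 eu ev]] := exists_common_direction N1 (nz _ Ax) (nz _ Ay).
(* The radius halfway across the annulus: the cube then lies between the radii [5 / 8 rho] and
   [7 / 8 rho]. *)
exists (z + (3 / 4 * rho%:num) *: e) => w cw.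
pose dl := w - (z + (3 / 4 * rho%:num) *: e).
have dlE : eucl dl <= rho%:num / 8.
  have -> : rho%:num / 8 = N%:R * cube_radius.
    rewrite /cube_radius; field; rewrite pnatr_eq0 -lt0n; exact: ltnW.
  by apply: eucl_le_coords => i; have /ltW := cw i; rewrite !mxE.
have wE : w - z = (3 / 4 * rho%:num) *: e + dl.
  by rewrite /dl opprD !addrA [RHS]addrC; apply/rowP => i; rewrite !mxE; ring.
have e34 : eucl ((3 / 4 * rho%:num) *: e) = 3 / 4 * rho%:num.
  by rewrite euclZ e1 mulr1 ger0_norm// mulr_ge0.
have wle : eucl (w - z) <= 7 / 8 * rho%:num.
  by rewrite wE; apply: le_trans (eucl_triangle _ _) _; rewrite e34; lra.
have wge : 5 / 8 * rho%:num <= eucl (w - z).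
  have : eucl ((3 / 4 * rho%:num) *: e) <= eucl (w - z) + eucl (- dl).
    apply: le_trans (eucl_triangle _ _); rewrite wE.
    by rewrite addrK.
  by rewrite euclN e34; lra.
have Aw : annulus z rho w by apply/andP; split; lra.
(* The component along [e] makes a nonnegative contribution to the scalar product, and the deviation
   [dl] costs at most [|x' - z| rho / 8]. This is less than half of [|x' - z| |w - z|], since
   [|w - z| >= 5 / 8 rho]. *)
have good x' : annulus z rho x' -> 0 <= dot e (x' - z) -> good_pair z rho x' w.
  move=> /andP[xA _] ex; apply: good_pair_of_dot => //; first lra.
  rewrite wE dotDr dotZr (dotC _ e).
  have : - (eucl (x' - z) * (rho%:num / 8)) <= dot (x' - z) dl.
    rewrite lerNl; apply: (@le_trans _ _ `|dot (x' - z) dl|).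
      by rewrite -normrN ler_norm.
    apply: le_trans (normr_dot_le _ _) _; by rewrite ler_wpM2l ?eucl_ge0.
  have : 0 <= 3 / 4 * rho%:num * dot e (x' - z) by rewrite !mulr_ge0.
  have : eucl (x' - z) * (5 / 8 * rho%:num) <= eucl (x' - z) * eucl (w - z).
    by rewrite ler_wpM2l ?eucl_ge0.
  have : 0 <= eucl (x' - z) * rho%:num by rewrite mulr_ge0 ?eucl_ge0.
  rewrite -wE; lra.
by split => //; exact: good.
Qed.

End common_cube.

(** * Averages of path energies *)

Section averaging.
Variables (R : realType) (N : nat) (z : 'rV[R]_N) (rho : {posnum R}).
Variable phi : 'rV[R]_N -> R.
Hypothesis sphi : smooth phi.
Implicit Types x y w : 'rV[R]_N.
Local Notation leb := (@lebesgue_measure R).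
Local Notation lam := (lebesgue_rV R N).
Local Notation P := (path_energy z rho phi).
Local Notation A := (annulus z rho).

Definition total_density : \bar R := (\int[lam]_w (density z rho phi w)%:E)%E.
Local Notation J := total_density.

Let integrand (p : 'rV[R]_N * 'rV[R]_N * measurableTypeR R) : \bar R :=
  (\1_(`[2^-1%R, 1%R]%classic) p.2 *
     density z rho phi (p.1.1 + p.2 *: (p.1.2 - p.1.1)))%R%:E.

Let integrand_ge0 p : (0 <= integrand p)%E.
Proof. by rewrite lee_fin mulr_ge0// density_ge0. Qed.

Let measurable_integrand : measurable_fun setT integrand.
Proof.
apply/measurable_EFinP; apply: measurable_funM.
  by apply: (measurableT_comp _ measurable_snd); exact: measurable_indic.
apply: (measurableT_comp (measurable_density z rho sphi)).
apply: measurable_fun_rV => i; under eq_fun do rewrite !mxE.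
have m11 : measurable_fun setT
    (fun p : 'rV[R]_N * 'rV[R]_N * measurableTypeR R => p.1.1 ord0 i).
  apply: (measurableT_comp (@measurable_rV_coord R N i)).
  exact: (measurableT_comp measurable_fst measurable_fst).
have m12 : measurable_fun setT
    (fun p : 'rV[R]_N * 'rV[R]_N * measurableTypeR R => p.1.2 ord0 i).
  apply: (measurableT_comp (@measurable_rV_coord R N i)).
  exact: (measurableT_comp measurable_snd measurable_fst).
apply: measurable_funD => //; apply: measurable_funM => //.
by apply: measurable_funB.
Qed.

Lemma path_energy_ge0 p : (0 <= P p)%E.
Proof. by apply: integral_ge0 => t _; exact: (integrand_ge0 (p, t)). Qed.

Lemma measurable_path_energy : measurable_fun setT P.
Proof. exact: (measurable_fun_fubini_tonelli_F integrand). Qed.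

Lemma total_density_ge0 : (0 <= J)%E.
Proof. by apply: integral_ge0 => w _; rewrite lee_fin density_ge0. Qed.

(* For fixed [x], the map [w |-> x + t (w - x)] has Jacobian [t ^ N >= 2 ^ - N]. *)
Lemma integral_path_energy_le x :
  (\int[lam]_w P (x, w) <= (2 ^+ N)%:E * J)%E.
Proof.
rewrite /path_energy /=.
have mi : measurable_fun setT (fun p => integrand (x, p.1, p.2)).
  apply: (measurableT_comp measurable_integrand).
  apply: measurable_fun_pair => //; apply: measurable_fun_pair => //.
rewrite (fubini_tonelli (m1 := lam) (m2 := leb) (fun p => integrand (x, p.1, p.2)))//; last first.
have I0 : (0 <= (2 ^+ N)%:E * J)%E by rewrite mule_ge0 ?total_density_ge0.
apply: (@le_trans _ _ (\int[leb]_(t in `[2^-1%R, 1%R]) ((2 ^+ N)%:E * J))%E).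
  rewrite [leRHS]integral_mkcond; apply: ge0_le_integral => //.
  - by move=> t _; exact: integral_ge0.
  - exact: (measurable_fun_fubini_tonelli_G (fun p => integrand (x, p.1, p.2))).
  - have mI : measurable (`[2^-1, 1]%classic : set (measurableTypeR R)) by [].
    by apply: (measurable_restrictT _ mI).1; exact: measurable_cst.
  move=> t _; rewrite patchE; case: ifPn => [|tI]; last first.
    by rewrite integral0_eq// => w _; rewrite /integrand/= indicE (negbTE tI) mul0r.
  move=> tI; have := tI; rewrite inE/= in_itv/= => /andP[t2 t1].
  have t0 : 0 < t by apply: lt_le_trans t2; rewrite invr_gt0.
  under eq_integral => w _.
    rewrite /integrand/= indicE tI mul1r scalerBr addrCA addrC.
    over.
  rewrite (ge0_integral_rV_affine (x - t *: x) t0 (g := fun w => (density z rho phi w)%:E)).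
  - by rewrite lee_wpmul2r ?total_density_ge0// lee_fin -exprVn
      lerXn2r ?nnegrE ?invr_ge0 ?(ltW t0)// -[leRHS]invrK lef_pV2 ?posrE ?invr_gt0.
  - by apply/measurable_EFinP; exact: measurable_density.
  - by move=> w; rewrite lee_fin density_ge0.
rewrite integral_cst// [X in (_ * X)%E]lebesgue_measure_itv/= lte_fin.
rewrite ifT; last by lra.
by rewrite -[leRHS]mule1 -EFinD lee_wpmul2l// lee_fin; lra.
Qed.

(** Here the paths end at the outer variable [x], so the change of variables becomes available once
    Tonelli has put the integral over [x] inside. The indicator keeps the remaining integral over
    the starting point [w] finite. *)
Lemma integral_annulus_path_energy_le :
  (\int[lam]_x \int[lam]_w ((\1_A w)%:E * P (w, x)) <=
   lam A * ((2 ^+ N)%:E * J))%E.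
Proof.
have mA := measurable_annulus z rho.
have mi : measurable_fun setT (fun p : 'rV[R]_N * 'rV[R]_N =>
    ((\1_A p.2)%:E * P (p.2, p.1))%E).
  apply: emeasurable_funM.
    by apply/measurable_EFinP; apply: (measurableT_comp _ measurable_snd); exact: measurable_indic.
  by apply: (measurableT_comp measurable_path_energy); exact: measurable_fun_pair.
have i0 (p : 'rV[R]_N * 'rV[R]_N) : (0 <= (\1_A p.2)%:E * P (p.2, p.1))%E.
  by rewrite mule_ge0 ?path_energy_ge0// lee_fin.
rewrite (fubini_tonelli (m1 := lam) (m2 := lam)
  (fun p : 'rV[R]_N * 'rV[R]_N => ((\1_A p.2)%:E * P (p.2, p.1))%E))//=.
have I0 : (0 <= (2 ^+ N)%:E * J)%E by rewrite mule_ge0 ?total_density_ge0.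
have mPw w : measurable_fun setT (fun x => P (w, x)).
  by apply: (measurableT_comp measurable_path_energy); exact: measurable_pair1.
have -> : (lam A * ((2 ^+ N)%:E * J) =
    \int[lam]_w ((\1_A w)%:E * ((2 ^+ N)%:E * J)))%E.
  rewrite ge0_integralZr//.
  - by rewrite integral_indic// setIT.
  - by apply/measurable_EFinP; exact: measurable_indic.
apply: ge0_le_integral => //.
- by move=> w _; apply: integral_ge0 => x _; exact: (i0 (x, w)).
- exact: (measurable_fun_fubini_tonelli_G
    (fun p : 'rV[R]_N * 'rV[R]_N => ((\1_A p.2)%:E * P (p.2, p.1))%E)).
- apply: emeasurable_funM; last exact: measurable_cst.
  by apply/measurable_EFinP; exact: measurable_indic.
move=> w _; rewrite ge0_integralZl//; last by move=> x _; exact: path_energy_ge0.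
by rewrite lee_wpmul2l ?lee_fin// integral_path_energy_le.
Qed.

End averaging.

(** If [f] exceeded [a + e] everywhere on [D], its integral would be at least [m D * (a + e)]. The
    margin [e] spares a strict comparison of integrals, and is the origin of the error term in the
    Poincare inequalities below. *)
Lemma exists_le_average d (T : measurableType d) (R : realType)
    (m : {measure set T -> \bar R}) (D : set T) (f : T -> \bar R) (a e : R) :
  measurable D -> (0 < m D)%E -> (m D < +oo)%E -> measurable_fun D f ->
  0 <= a -> 0 < e ->
  (\int[m]_(x in D) f x <= m D * a%:E)%E -> exists2 y, D y & (f y <= (a + e)%:E)%E.
Proof.
move=> mD D0 Doo mf a0 e0 fa; apply: contrapT => H.
have fgt y : D y -> ((a + e)%:E <= f y)%E.
  by move=> Dy; apply/ltW; rewrite ltNge; apply/negP => fy; apply: H; exists y.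
have : (\int[m]_(x in D) (a + e)%:E <= \int[m]_(x in D) f x)%E.
  by apply: ge0_le_integral => // x _; rewrite lee_fin addr_ge0// ltW.
rewrite integral_cst// => /le_trans/(_ fa).
have fD : m D \is a fin_num by rewrite ge0_fin_numE.
rewrite muleC lee_pmul2l//.
by rewrite lee_fin gerDl leNgt e0.
Qed.

Section annulus_measure.
Variables (R : realType) (N : nat) (z : 'rV[R]_N) (rho : {posnum R}).
Local Notation lam := (lebesgue_rV R N).

Lemma lebesgue_eball_lty (B : set 'rV[R]_N) : measurable B ->
  B `<=` eball z rho -> (lam B < +oo)%E.
Proof.
move=> mB BE; apply: (@le_lt_trans _ _ (lam (cube z rho%:num))).
  apply: le_measure; rewrite ?inE//; first exact: measurable_cube.
  move=> x /BE xB i; apply: le_lt_trans xB.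
  by have := coord_le_eucl (x - z) i; rewrite !mxE.
by rewrite lebesgue_cube// ltry.
Qed.

Lemma annulus_sub_eball : annulus z rho `<=` eball z rho.
Proof. by move=> x /andP[]. Qed.

Lemma punctured_ball_sub_eball : punctured_ball z rho `<=` eball z rho.
Proof. by move=> x /andP[]. Qed.

Lemma cube_radius_gt0 : (0 < N)%N -> 0 < cube_radius N rho.
Proof. by move=> N0; rewrite divr_gt0// mulr_gt0// ltr0n. Qed.

(** The annulus contains a cube: [exists_common_cube] with the two points equal. *)
Lemma lebesgue_annulus_gt0 : (1 < N)%N -> (0 < lam (annulus z rho))%E.
Proof.
move=> N1; pose x := z + (3 / 4 * rho%:num) *: delta_mx 0 (Ordinal N1).
have Ax : annulus z rho x.
  have r0 : 0 < rho%:num by [].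
  rewrite /annulus/= /x addrAC subrr add0r euclZ.
  have -> : eucl (delta_mx 0 (Ordinal N1) : 'rV[R]_N) = 1.
    rewrite /eucl /dot (bigD1 (Ordinal N1))//= big1 ?addr0 => [|i ii].
      by rewrite mxE !eqxx mulr1 sqrtr1.
    by rewrite mxE (negbTE ii) andbF mul0r.
  rewrite mulr1 ger0_norm; last by rewrite mulr_ge0.
  by apply/andP; split; lra.
have [c cA] := exists_common_cube N1 Ax Ax.
apply: (@lt_le_trans _ _ (lam (cube c (cube_radius N rho)))).
  rewrite lebesgue_cube ?cube_radius_gt0 ?(ltnW N1)// lte_fin exprn_gt0//.
  by rewrite pmulrn_lgt0// cube_radius_gt0// ltnW.
apply: le_measure; rewrite ?inE; [exact: measurable_cube|exact: measurable_annulus|].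
by move=> w /cA[].
Qed.

End annulus_measure.

(** * The Poincare inequality on the annulus *)

Section annulus_poincare.
Variables (R : realType) (N : nat) (z : 'rV[R]_N) (rho : {posnum R}).
Hypothesis N1 : (1 < N)%N.
Variable phi : 'rV[R]_N -> R.
Hypothesis sphi : smooth phi.
Implicit Types x y w : 'rV[R]_N.
Local Notation lam := (lebesgue_rV R N).
Local Notation P := (path_energy z rho phi).
Local Notation A := (annulus z rho).
Local Notation J := (total_density z rho phi).
Local Notation Phi := (phi \o radial z rho).

(** The price of joining [x] to a third point [w]. The half path near [w] is controlled for each
    fixed [x]. The half path near [x] is controlled only on average over [x], with [w] confined to a
    set of finite measure, hence the indicator. *)
Let two_way x w : \bar R := (P (x, w) + (\1_A w)%:E * P (w, x))%E.
Let T x : \bar R := (\int[lam]_w two_way x w)%E.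

Let mA : measurable A := measurable_annulus z rho.

Let measurable_back : measurable_fun setT
  (fun p : 'rV[R]_N * 'rV[R]_N => ((\1_A p.2)%:E * P (p.2, p.1))%E).
Proof.
apply: emeasurable_funM.
  by apply/measurable_EFinP; apply: (measurableT_comp _ measurable_snd); exact: measurable_indic.
by apply: (measurableT_comp (measurable_path_energy z rho sphi)); exact: measurable_fun_pair.
Qed.

Let measurable_two_way : measurable_fun setT
  (fun p : 'rV[R]_N * 'rV[R]_N => two_way p.1 p.2).
Proof.
apply: emeasurable_funD => //.
by apply: (measurableT_comp (measurable_path_energy z rho sphi)); exact: measurable_fun_pair.
Qed.

Let back_ge0 x w : (0 <= (\1_A w)%:E * P (w, x))%E.
Proof. by rewrite mule_ge0 ?path_energy_ge0// lee_fin. Qed.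

Let two_way_ge0 x w : (0 <= two_way x w)%E.
Proof. by rewrite adde_ge0// path_energy_ge0. Qed.

Let measurable_T : measurable_fun setT T.
Proof. exact: (measurable_fun_fubini_tonelli_F (fun p => two_way p.1 p.2)). Qed.

Let T_ge0 x : (0 <= T x)%E.
Proof. exact: integral_ge0. Qed.

(** Forward and backward paths contribute [2 ^+ N] each. *)
Let integral_T_le : (\int[lam]_(x in A) T x <= lam A * ((2 ^+ N.+1)%:E * J))%E.
Proof.
have mPx x : measurable_fun setT (fun w => P (x, w)).
  by apply: (measurableT_comp (measurable_path_energy z rho sphi)); exact: measurable_pair1.
have mbx x : measurable_fun setT (fun w => ((\1_A w)%:E * P (w, x))%E).
  exact: (measurableT_comp measurable_back (measurable_pair1 x)).
pose S2 x := (\int[lam]_w ((\1_A w)%:E * P (w, x)))%E.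
have mS2 : measurable_fun setT S2.
  exact: (measurable_fun_fubini_tonelli_F
    (fun p : 'rV[R]_N * 'rV[R]_N => ((\1_A p.2)%:E * P (p.2, p.1))%E)).
have S20 x : (0 <= S2 x)%E by exact: integral_ge0.
have J0 := total_density_ge0 z rho phi.
have I0 : (0 <= (2 ^+ N)%:E * J)%E by rewrite mule_ge0.
apply: (@le_trans _ _ (\int[lam]_(x in A) ((2 ^+ N)%:E * J + S2 x))%E).
  apply: ge0_le_integral => //.
  - exact: measurable_funTS.
  - by apply: emeasurable_funD; [exact: measurable_cst|exact: measurable_funTS].
  move=> x _; rewrite /T /two_way ge0_integralD//; first last.
  - by move=> w _; exact: path_energy_ge0.
  by rewrite leeD2r// integral_path_energy_le.
rewrite ge0_integralD//; last exact: measurable_funTS.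
rewrite integral_cst// exprS EFinM -[X in (_ <= _ * X)%E]muleA.
rewrite (_ : 2%:E = 1%:E + 1%:E)%E; last by rewrite -EFinD.
rewrite [X in (_ <= _ * X)%E]ge0_muleDl ?lee_fin// mul1e.
rewrite [leRHS]ge0_muleDr// [X in (_ <= X + _)%E]muleC leeD2l//.
apply: le_trans (integral_annulus_path_energy_le z rho sphi).
by apply: ge0_subset_integral => //.
Qed.

Let m0 := (cube_radius N rho *+ 2) ^+ N.

(** The left side does not depend on the third point, so integrating [2 ((Phi x - Phi w)^2 + (Phi y
    - Phi w)^2)] over the common cube multiplies it by the volume [m0]. On the right, the cube is
    enlarged to the whole space, which removes the dependence on where it lies. *)
Let sqr_increment_le x y : A x -> A y ->
  (((Phi x - Phi y) ^+ 2)%R%:E * m0%:E <= (256 * rho%:num ^+ 2)%:E * (T x + T y))%E.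
Proof.
move=> Ax Ay; have [c cA] := exists_common_cube N1 Ax Ay.
have a0 : 0 < cube_radius N rho by apply: cube_radius_gt0; exact: ltnW.
have mC := measurable_cube c (cube_radius N rho).
have mtx x' : measurable_fun setT (two_way x').
  exact: (measurableT_comp measurable_two_way (measurable_pair1 x')).
have mtt : measurable_fun setT (fun w => (two_way x w + two_way y w)%E).
  exact: (emeasurable_funD (mtx x) (mtx y)).
have tt0 w : (0 <= two_way x w + two_way y w)%E by exact: adde_ge0.
have k0 : 0 <= 256 * rho%:num ^+ 2 by rewrite mulr_ge0// sqr_ge0.
have <- : (\int[lam]_(w in cube c (cube_radius N rho)) ((Phi x - Phi y) ^+ 2)%R%:E =
    ((Phi x - Phi y) ^+ 2)%R%:E * m0%:E)%E.
  by rewrite integral_cst//; congr (_ * _)%E; exact: lebesgue_cube.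
have -> : ((256 * rho%:num ^+ 2)%:E * (T x + T y) =
    \int[lam]_w ((256 * rho%:num ^+ 2)%:E * (two_way x w + two_way y w)))%E.
  rewrite ge0_integralZl//; congr (_ * _)%E; apply/esym.
  exact: (ge0_integralD lam measurableT (fun w _ => two_way_ge0 x w) (mtx x)
      (fun w _ => two_way_ge0 y w) (mtx y)).
have mktt : measurable_fun setT
    (fun w => (256 * rho%:num ^+ 2)%:E * (two_way x w + two_way y w))%E.
  exact: measurable_funeM.
apply: (@le_trans _ _ (\int[lam]_(w in cube c (cube_radius N rho))
    ((256 * rho%:num ^+ 2)%:E * (two_way x w + two_way y w)))%E); last first.
  have ktt0 w : (0 <= (256 * rho%:num ^+ 2)%:E * (two_way x w + two_way y w))%E.
    by apply: mule_ge0; [rewrite lee_fin|exact: tt0].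
  exact: (ge0_subset_integral lam mC measurableT mktt (fun w _ => ktt0 w) (@subsetT _ _)).
have s0 w : cube c (cube_radius N rho) w -> (0 <= ((Phi x - Phi y) ^+ 2)%R%:E)%E.
  by move=> _; rewrite lee_fin sqr_ge0.
apply: ge0_le_integral => //; first exact: measurable_funTS.
move=> w /cA[Aw gxw gyw].
have tE x' : (two_way x' w = P (x', w) + P (w, x'))%E.
  by rewrite /two_way indicE mem_set// mul1e.
rewrite !tE.
have Hx := increment_le_path_energy sphi Ax Aw gxw.
have Hy := increment_le_path_energy sphi Ay Aw gyw.
apply: (@le_trans _ _ (2%:E * (((Phi x - Phi w) ^+ 2)%R%:E + ((Phi y - Phi w) ^+ 2)%R%:E))%E).
  rewrite -EFinD -EFinM lee_fin -subr_ge0.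
  rewrite (_ : _ - _ = (Phi x + Phi y - 2 * Phi w) ^+ 2) ?sqr_ge0//=; ring.
rewrite (_ : 256 * _ = 2 * (128 * rho%:num ^+ 2)); last by ring.
rewrite EFinM -muleA lee_pmul2l// [leRHS]muleDr//; last first.
  by rewrite ge0_adde_def// inE adde_ge0// path_energy_ge0.
exact: leeD Hx Hy.
Qed.

(** The constant [a] is the value of [Phi] at a point [y] where [T] exceeds its average bound by at
    most [e]. Integrating the increment bound in [x] then counts that average once for [T x] and
    once for [T y], whence [N.+2]. *)
Lemma annulus_poincare (j e : R) : J = j%:E -> 0 < e ->
  exists a : R,
  (\int[lam]_(x in A) ((Phi x - a) ^+ 2)%R%:E * m0%:E <=
   (256 * rho%:num ^+ 2)%:E * (lam A * (2 ^+ N.+2 * j + e)%:E))%E.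
Proof.
move=> Jj e0.
have j0 : 0 <= j by rewrite -lee_fin -Jj total_density_ge0.
have m00 : 0 <= m0.
  by rewrite exprn_ge0// mulrn_wge0// ltW// cube_radius_gt0// ltnW.
have Apos := lebesgue_annulus_gt0 z rho N1.
have Afin := lebesgue_eball_lty mA (@annulus_sub_eball R N z rho).
have Afn : lam A \is a fin_num by rewrite ge0_fin_numE.
have mT : measurable_fun A T by exact: measurable_funTS.
have TJ := integral_T_le; rewrite Jj -EFinM in TJ.
have t0 : 0 <= 2 ^+ N.+1 * j by rewrite mulr_ge0// exprn_ge0.
have [y Ay Ty] := exists_le_average mA Apos Afin mT t0 e0 TJ.
exists (Phi y).
have sqle x : A x -> (((Phi x - Phi y) ^+ 2)%R%:E * m0%:E <=
  (256 * rho%:num ^+ 2)%:E * (T x + T y))%E by move=> Ax; exact: sqr_increment_le.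
have U0 := T_ge0; move: T TJ U0 mT Ty sqle => U UJ U0 mU Uy sqle.
have k0 : 0 <= 256 * rho%:num ^+ 2 by rewrite mulr_ge0// sqr_ge0.
have mPhi : measurable_fun setT Phi.
  exact: (measurableT_comp (continuous_rV_measurable (smooth_continuous sphi))
    (measurable_radial z rho)).
have mP2 : measurable_fun A (fun x => ((Phi x - Phi y) ^+ 2)%R%:E).
  apply/measurable_EFinP/measurable_funTS/measurable_funX.
  by apply: measurable_funB => //; exact: measurable_cst.
have mUy : measurable_fun A (fun x => (U x + U y)%E).
  exact: (emeasurable_funD mU (measurable_cst _)).
rewrite -ge0_integralZr//; last by move=> x _; rewrite lee_fin sqr_ge0.
apply: (@le_trans _ _ (\int[lam]_(x in A) ((256 * rho%:num ^+ 2)%:E * (U x + U y)))%E).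
  apply: ge0_le_integral => //.
  - by move=> x _; rewrite mule_ge0 ?lee_fin ?sqr_ge0.
  - by apply: emeasurable_funM => //; exact: measurable_cst.
  - exact: measurable_funeM.
rewrite ge0_integralZl//; first last.
- by move=> x _; rewrite adde_ge0.
apply: lee_wpmul2l; first by rewrite lee_fin.
rewrite ge0_integralD// integral_cst//.
have te0 : 0 <= 2 ^+ N.+1 * j + e by rewrite addr_ge0 ?(ltW e0).
have -> : (lam A * (2 ^+ N.+2 * j + e)%:E =
    lam A * (2 ^+ N.+1 * j)%:E + lam A * (2 ^+ N.+1 * j + e)%:E)%E.
  rewrite -ge0_muleDr ?lee_fin// -EFinD; congr (_ * _%:E)%E.
  by rewrite (exprS 2 N.+1); ring.
apply: leeD; first exact: UJ.
by rewrite muleC; apply: lee_wpmul2l; [exact: ltW|exact: Uy].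
Qed.

End annulus_poincare.

(** * Integrals on the sphere as integrals on the annulus *)

Section sphere_integral.
Variables (R : realType) (N : nat) (z : 'rV[R]_N) (rho : {posnum R}).
Local Notation lam := (lebesgue_rV R N).
Local Notation sigma := (sphere_measure z rho).
Local Notation S := (esphere z rho).
Local Notation B0 := (punctured_ball z rho).

Lemma radial_preimage_sphere : radial z rho @^-1` S `&` eball z rho = B0.
Proof.
apply/seteqP; split => x /=.
  move=> [xS xB]; apply/andP; split => //; apply: eucl_gt0; rewrite subr_eq0.
  by apply: contraNneq (esphere_neq xS) => ->; rewrite radial_center.
move=> /andP[x0 xB]; split => //; apply: radial_esphere.
by rewrite -subr_eq0; apply: contraTneq x0 => ->; rewrite eucl0 ltxx.
Qed.

Lemma ge0_integral_sphere_measure (D : set 'rV[R]_N) (g : 'rV[R]_N -> \bar R) :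
  measurable D -> measurable_fun setT g -> (forall x, (0 <= g x)%E) ->
  (\int[sigma]_(y in D) g y = (N%:R / rho%:num)%:E *
    \int[lam]_(x in radial z rho @^-1` D `&` eball z rho) g (radial z rho x))%E.
Proof.
move=> mD mg g0.
rewrite ge0_integral_mscale//; last exact: measurable_funTS.
congr (_ * _)%E.
transitivity (\int[pushforward (ball_measure z rho) (radial z rho)]_(y in D) g y)%E.
  by apply: eq_measure_integral => B mB _.
have mr := measurable_radial z rho.
rewrite (ge0_integral_pushforward mr _ mD)//; last exact: measurable_funTS.
rewrite ge0_integral_mrestr//.
- by rewrite -[X in measurable X]setTI; exact: mr.
- by apply: measurable_funTS; exact: measurableT_comp.
- by move=> x _; exact: g0.
Qed.

Lemma ge0_integral_sphere (g : 'rV[R]_N -> \bar R) :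
  measurable_fun setT g -> (forall x, (0 <= g x)%E) ->
  (\int[sigma]_(y in S) g y =
   (N%:R / rho%:num)%:E * \int[lam]_(x in B0) g (radial z rho x))%E.
Proof.
move=> mg g0; rewrite ge0_integral_sphere_measure ?radial_preimage_sphere//.
exact: measurable_esphere.
Qed.

Lemma sphere_measure_lty : (sigma setT < +oo)%E.
Proof.
change ((N%:R / rho%:num)%:E * lam (setT `&` eball z rho) < +oo)%E.
rewrite setTI lte_mul_pinfty ?lee_fin ?divr_ge0//.
exact: (lebesgue_eball_lty (measurable_eball z rho) (@subset_refl _ _)).
Qed.

Lemma esphere_nonempty : (0 < N)%N -> exists y, S y.
Proof.
move=> N0; exists (z + rho%:num *: delta_mx 0 (Ordinal N0)).
rewrite /esphere/= addrAC subrr add0r euclZ ger0_norm//.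
rewrite (_ : eucl _ = 1) ?mulr1// /eucl /dot (bigD1 (Ordinal N0))//=.
rewrite big1 ?addr0 => [|i ii]; first by rewrite mxE !eqxx mulr1 sqrtr1.
by rewrite mxE (negbTE ii) andbF mul0r.
Qed.

Lemma continuous_esphere_bounded (f : 'rV[R]_N -> R) : continuous f ->
  exists2 M, 0 <= M & forall y, S y -> `|f y| <= M.
Proof.
move=> cf.
have cS : compact (f @` S).
  apply: continuous_compact; last exact: esphere_compact.
  exact: continuous_subspaceT.
have [M [Mr HM]] := compact_bounded cS.
exists (`|M| + 1); first by rewrite addr_ge0.
move=> y Sy; apply: HM; last by exists y.
by rewrite (le_lt_trans (ler_norm M))// ltrDl.
Qed.

(* The punctured ball is the annulus together with a half-scale copy of itself. *)
Lemma punctured_ball_le_annulus (f : 'rV[R]_N -> R) (M : R) : (0 < N)%N ->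
  measurable_fun setT f -> (forall y, 0 <= f y) -> (forall y, S y -> f y <= M) ->
  (\int[lam]_(x in B0) (f (radial z rho x))%:E <=
   2%:E * \int[lam]_(x in annulus z rho) (f (radial z rho x))%:E)%E.
Proof.
move=> N0 mf f0 fM.
pose B1 : set 'rV[R]_N := [set x | 0 < eucl (x - z) < rho%:num / 2].
have r0 : 0 < rho%:num by [].
have BE : B0 = B1 `|` annulus z rho.
  apply/seteqP; split => x /=; rewrite /B1 /annulus /punctured_ball/=.
    by move=> /andP[x0 xr]; have [xh|xh] := ltP (eucl (x - z)) (rho%:num / 2);
      [left; rewrite x0|right; rewrite xr].
  by case=> /andP[h1 h2]; apply/andP; split; lra.
have mB1 : measurable B1.
  rewrite (_ : B1 = setT `&` (fun x => eucl (x - z)) @^-1`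
      `]0, rho%:num / 2[%classic); first exact: measurable_eucl_sub.
  by rewrite setTI; apply/seteqP; split => x /=; rewrite in_itv.
have mA := measurable_annulus z rho.
have mB0 := measurable_punctured_ball z rho.
pose F x := (f (radial z rho x))%:E.
have mF : measurable_fun setT F.
  by apply/measurable_EFinP; exact: (measurableT_comp mf (measurable_radial z rho)).
have F0 x : (0 <= F x)%E by rewrite lee_fin.
(* The homothety of ratio [2^-1] about [z] leaves [F] invariant, so the inner integral is [2 ^- N],
   hence at most [2^-1], times the whole. *)
have H1 : (\int[lam]_(x in B1) F x <= (2^-1)%:E * \int[lam]_(x in B0) F x)%E.
  pose G x := (F x * (\1_B1 x)%:E)%E.
  have mG : measurable_fun setT G.
    by apply: emeasurable_funM => //; apply/measurable_EFinP; exact: measurable_indic.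
  have G0 x : (0 <= G x)%E by rewrite mule_ge0// lee_fin.
  have h0 : 0 < 2^-1 :> R by rewrite invr_gt0.
  have := ge0_integral_rV_affine (2^-1 *: z) h0 mG G0.
  have -> : (\int[lam]_x G (2^-1 *: z + 2^-1 *: x)%R = \int[lam]_(x in B0) F x)%E.
    rewrite [RHS]integral_mkcond; apply: eq_integral => x _.
    have -> : 2^-1 *: z + 2^-1 *: x = z + 2^-1 *: (x - z).
      by apply/rowP => i; rewrite !mxE; field.
    rewrite /G /F radial_homogeneous// patchE indicE.
    have -> : (z + 2^-1 *: (x - z) \in B1) = (x \in B0).
      apply/idP/idP; rewrite !inE /B1 /punctured_ball/= addrAC subrr add0r euclZ;
        rewrite ger0_norm ?invr_ge0// => /andP[h1 h2]; apply/andP; split; lra.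
    by case: ifPn => _; rewrite ?mule1 ?mule0.
  move=> ->.
  have -> : (\int[lam]_x G x = \int[lam]_(x in B1) F x)%E.
    rewrite [RHS]integral_mkcond; apply: eq_integral => x _.
    by rewrite /G patchE indicE; case: ifPn => _; rewrite ?mule1 ?mule0.
  rewrite muleA -EFinM -[leLHS]mul1e; apply: lee_wpmul2r; first exact: integral_ge0.
  rewrite lee_fin exprVn invrK -(prednK N0) exprS mulrA mulVf// mul1r.
  by rewrite exprn_ege1// ler1n.
(* Needed to subtract half of the integral from both sides. *)
have fin : (\int[lam]_(x in B0) F x)%E \is a fin_num.
  rewrite ge0_fin_numE; last exact: integral_ge0.
  have bound : (\int[lam]_(x in B0) F x <= \int[lam]_(x in B0) M%:E)%E.
    apply: ge0_le_integral => //; first exact: measurable_funTS.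
    move=> x; rewrite -radial_preimage_sphere => -[xS _].
    by rewrite lee_fin; exact: fM.
  apply: le_lt_trans bound _; rewrite integral_cst//.
  have : (lam B0 < +oo)%E by apply: lebesgue_eball_lty => //; exact: punctured_ball_sub_eball.
  move=> Boo; rewrite -[X in (_ * X)%E]fineK; first by rewrite -EFinM ltry.
  by rewrite ge0_fin_numE.
have E : (\int[lam]_(x in B0) F x = \int[lam]_(x in B1) F x + \int[lam]_(x in annulus z rho) F x)%E.
  rewrite {1}BE ge0_integral_setU//.
  - exact: measurable_funTS.
  - apply/disj_setPS => x [/= /andP[_ x1] /andP[x2 _]].
    by move: x1; rewrite ltNge x2.
move: fin H1 E; rewrite -/F.
have A0 : (0 <= \int[lam]_(x in annulus z rho) F x)%E by exact: integral_ge0.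
have B10 : (0 <= \int[lam]_(x in B1) F x)%E by exact: integral_ge0.
move: A0 B10; rewrite /F.
move: (\int[lam]_(x in B0) _)%E (\int[lam]_(x in B1) _)%E
  (\int[lam]_(x in annulus z rho) _)%E => b0 b1 a.
move: b0 b1 a => [b0| |] [b1| |] [a| |]//= a0 b10 _ H1 [E] //.
rewrite -!EFinM !lee_fin in H1 *; lra.
Qed.

End sphere_integral.

Section sphere_poincare.
Variables (R : realType) (N : nat) (z : 'rV[R]_N) (rho : {posnum R}).
Local Notation lam := (lebesgue_rV R N).
Local Notation sigma := (sphere_measure z rho).
Local Notation S := (esphere z rho).
Local Notation B0 := (punctured_ball z rho).
Local Notation A := (annulus z rho).

Lemma integral_sphere_lty (f : 'rV[R]_N -> R) (M : R) :
  measurable_fun setT f -> (forall y, 0 <= f y) -> (forall y, S y -> f y <= M) ->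
  (\int[sigma]_(y in S) (f y)%:E < +oo)%E.
Proof.
move=> mf f0 fM; have mS := measurable_esphere z rho.
have bound : (\int[sigma]_(y in S) (f y)%:E <= \int[sigma]_(y in S) M%:E)%E.
  apply: ge0_le_integral => //.
  - by move=> y _; rewrite lee_fin.
  - exact/measurable_EFinP/measurable_funTS.
apply: le_lt_trans bound _; rewrite integral_cst//.
rewrite -[X in (_ * X)%E]fineK; first by rewrite -EFinM ltry.
rewrite ge0_fin_numE//; apply: le_lt_trans (sphere_measure_lty z rho).
by apply: le_measure => //; rewrite inE.
Qed.

Lemma total_densityE phi : total_density z rho phi =
  (\int[lam]_(x in B0) (sqr_tangential_grad z rho phi (radial z rho x))%:E)%E.
Proof.
rewrite [RHS]integral_mkcond; apply: eq_integral => x _.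
by rewrite patchE /density indicE; case: ifPn => _; rewrite ?mul1r ?mul0r.
Qed.

(** Both sides are [N / rho] times integrals over the punctured ball, so this factor cancels;
    passing from the ball to the annulus on the left costs a factor [2]. The constant [C] depends on
    [N] and [rho] only, while [a] may depend on [e]. *)
Lemma poincare_sphere : (1 < N)%N -> exists2 C : R, 0 < C &
  forall phi, smooth phi -> forall e : R, 0 < e -> exists a : R,
    \int[sigma]_(y in S) ((phi y - a) ^+ 2) <=
    C * \int[sigma]_(y in S) sqr_tangential_grad z rho phi y + e.
Proof.
move=> N1; have N0 : (0 < N)%N := ltnW N1.
pose c := N%:R / rho%:num.
have c0 : 0 < c by rewrite divr_gt0// ltr0n.
pose m0 := (cube_radius N rho *+ 2) ^+ N.
have m00 : 0 < m0 by rewrite exprn_gt0// pmulrn_lgt0// cube_radius_gt0.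
pose LA := fine (lam A).
have Afin : lam A = LA%:E.
  have Aoo := lebesgue_eball_lty (measurable_annulus z rho) (@annulus_sub_eball R N z rho).
  by rewrite fineK// ge0_fin_numE.
have LA0 : 0 < LA.
  by rewrite -lte_fin -Afin; exact: lebesgue_annulus_gt0.
pose K := 256 * rho%:num ^+ 2 * LA / m0.
have K0 : 0 < K by rewrite divr_gt0// !mulr_gt0// exprn_gt0.
exists (2 * K * 2 ^+ N.+2); first by apply: mulr_gt0; [exact: mulr_gt0|exact: exprn_gt0].
move=> phi sphi e e0.
have mT2 := continuous_rV_measurable (@continuous_sqr_tangential_grad R N z rho phi sphi).
have T20 y : 0 <= sqr_tangential_grad z rho phi y by exact: dot_ge0.
have [M M0 HM] := continuous_esphere_bounded z rho (@continuous_sqr_tangential_grad R N z rho phi sphi).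
have IT : (\int[sigma]_(y in S) (sqr_tangential_grad z rho phi y)%:E =
    c%:E * total_density z rho phi)%E.
  rewrite total_densityE ge0_integral_sphere//.
  exact/measurable_EFinP.
have ITfin : (\int[sigma]_(y in S) (sqr_tangential_grad z rho phi y)%:E < +oo)%E.
  apply: (integral_sphere_lty mT2 T20 (M := M)) => y /HM; exact/le_trans/ler_norm.
have Jfin : total_density z rho phi \is a fin_num.
  have J0 := total_density_ge0 z rho phi.
  rewrite ge0_fin_numE// ltNge leye_eq; apply/negP => /eqP Joo.
  by move: ITfin; rewrite IT Joo gt0_muley ?lte_fin// ltxx.
pose j := fine (total_density z rho phi).
have Jj : total_density z rho phi = j%:E by rewrite fineK.
(* The error of the annulus inequality is multiplied by [2 * c * K] in the end, which gives back
   [e]. *)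
have e'0 : 0 < e / (2 * c * K) by apply: divr_gt0 => //; apply: mulr_gt0 => //; exact: mulr_gt0.
have [a Ha0] := annulus_poincare N1 sphi Jj e'0.
have Ha : (\int[lam]_(x in A) ((phi (radial z rho x) - a) ^+ 2)%R%:E * m0%:E <=
    (256 * rho%:num ^+ 2 * (LA * (2 ^+ N.+2 * j + e / (2 * c * K))))%:E)%E.
  by rewrite (EFinM (256 * _)) (EFinM LA) -Afin; exact: Ha0.
exists a.
pose f y := (phi y - a) ^+ 2.
have cf : continuous f.
  have cp := smooth_continuous sphi.
  move=> y; rewrite /f.
  have cpa : {for y, continuous (fun y => phi y - a)}.
    by apply: continuousB; [exact: cp|exact: cst_continuous].
  rewrite (_ : (fun _ => _) = (fun y => phi y - a) \* (fun y => phi y - a)).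
    exact: continuousM.
  by apply/funext => u; rewrite expr2.
have mf := continuous_rV_measurable cf.
have f0 y : 0 <= f y by exact: sqr_ge0.
have [M' M'0 HM'] := continuous_esphere_bounded z rho cf.
have fM y : S y -> f y <= M' by move=> /HM'; exact/le_trans/ler_norm.
have If : (\int[sigma]_(y in S) (f y)%:E =
    c%:E * \int[lam]_(x in B0) (f (radial z rho x))%:E)%E.
  by rewrite ge0_integral_sphere//; exact/measurable_EFinP.
have Iffin := integral_sphere_lty mf f0 fM.
have If0 : (0 <= \int[sigma]_(y in S) (f y)%:E)%E.
  by apply: integral_ge0 => y _; rewrite lee_fin.
have H2 := punctured_ball_le_annulus N0 mf f0 fM.
have IA : (\int[lam]_(x in A) (f (radial z rho x))%:E <=
    (K * (2 ^+ N.+2 * j + e / (2 * c * K)))%:E)%E.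
  rewrite -(lee_pmul2r (x := m0%:E)) ?lte_fin//; apply: le_trans Ha _.
  rewrite -EFinM lee_fin le_eqVlt; apply/orP; left; apply/eqP.
  rewrite /K; move: (2 ^+ N.+2 * j + _) => X; clearbody m0.
  by field; rewrite gt_eqF.
rewrite -lee_fin [X in (X <= _)%E]fineK ?ge0_fin_numE//.
rewrite /Rintegral IT Jj -EFinM [fine _]/= If.
apply: (@le_trans _ _ (c%:E * (2%:E * (K * (2 ^+ N.+2 * j + e / (2 * c * K)))%:E))%E).
  rewrite lee_pmul2l ?lte_fin//; apply: le_trans H2 _.
  by rewrite lee_pmul2l ?lte_fin.
rewrite -!EFinM lee_fin le_eqVlt; apply/orP; left; apply/eqP.
by field; rewrite !gt_eqF.
Qed.

End sphere_poincare.

(** * Limits in L^2 *)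

Section L2_limits.
Context (R : realType) (N : nat) (m : {measure set 'rV[R]_N -> \bar R}).
Implicit Types (D : set 'rV[R]_N) (f u w : 'rV[R]_N -> R).

Lemma L2_measurable f : L2 m f -> measurable_fun setT f.
Proof. by rewrite /L2 inE => /andP[]; rewrite inE. Qed.

Lemma L2B f u : L2 m f -> L2 m u -> L2 m (fun x => f x - u x).
Proof.
move=> Lf Lu; have p1 : (1%E <= 2%:E :> \bar R)%E by rewrite lee_fin ler1n.
by apply: (Lfun_addr_closed m p1).2 => //; exact: Lfun_oppr_closed.
Qed.

Lemma L2_integrable_weight D f w (K : R) : measurable D -> L2 m f ->
  measurable_fun D w -> (forall x, D x -> `|w x| <= K) ->
  m.-integrable D (EFin \o (fun x => w x * f x ^+ 2)).
Proof.
move=> mD Lf mw wK.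
have if2 : m.-integrable D (EFin \o (fun x => K * f x ^+ 2)).
  rewrite (_ : _ \o _ = fun x => K%:E * (f x ^+ 2)%R%:E)%E//.
  apply: integrableZl => //; apply: (integrableS measurableT) => //.
  exact: Lfun2_integrable_sqr.
apply: le_integrable if2 => //.
  apply/measurable_EFinP; apply: measurable_funM => //.
  by apply: measurable_funX; apply: measurable_funTS; exact: L2_measurable.
move=> x Dx; rewrite /= lee_fin normrM [leRHS]normrM.
by rewrite ler_wpM2r// (le_trans (wK _ Dx))// ler_norm.
Qed.

Lemma L2_integrable_sqr D f : measurable D -> L2 m f ->
  m.-integrable D (EFin \o (fun x => f x ^+ 2)).
Proof.
move=> mD Lf; apply: (integrableS measurableT) => //.
exact: Lfun2_integrable_sqr.
Qed.

(** Translates convergence of an extended real norm, eventually finite, into smallness of real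
    integrals of squares. *)
Lemma L2_cvg_sqr_lt (u : nat -> 'rV[R]_N -> R) f :
  (forall k, L2 m (u k)) -> L2 m f -> L2_cvg m u f ->
  forall D, measurable D -> forall e : R, 0 < e ->
  \forall k \near \oo, \int[m]_(x in D) ((u k x - f x) ^+ 2) < e.
Proof.
move=> Lu Lf uf D mD e e0.
have s0 : 0 < Num.sqrt e by rewrite sqrtr_gt0.
have [finN cN] := (fine_cvgP _ _).1 uf.
have N0 k : (0 <= 'N[m]_2%:E%E [EFin \o (u k \- f)%R])%E by exact: Lnorm_ge0.
have lt_near : \forall k \near \oo,
    fine ('N[m]_2%:E%E [EFin \o (u k \- f)%R]%E) < Num.sqrt e.
  exact: (cvgr_lt _ cN _ s0).
near=> k.
have fN : 'N[m]_2%:E%E [EFin \o (u k \- f)%R]%E \is a fin_num by near: k.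
have lN : fine ('N[m]_2%:E%E [EFin \o (u k \- f)%R]%E) < Num.sqrt e by near: k.
have mg : measurable_fun setT (u k \- f).
  by apply: measurable_funB; exact: L2_measurable.
have E2 : (\int[m]_x ((u k x - f x) ^+ 2)%:E =
    ((fine 'N[m]_2%:E%E [EFin \o (u k \- f)%R]) ^+ 2)%:E)%E.
  have := poweR_Lnorm m (EFin \o (u k \- f)) (lt0r_neq0 (ltr0Sn R 1)).
  rewrite -(fineK fN) poweR_EFin powR_mulrn ?fine_ge0// => ->.
  apply: eq_integral => x _; rewrite /= powR_mulrn//.
  by rewrite real_normK ?num_real.
apply: (@le_lt_trans _ _ ((fine 'N[m]_2%:E%E [EFin \o (u k \- f)%R]) ^+ 2)).
  rewrite -lee_fin -E2.
  have m2 : measurable_fun setT (fun x => ((u k x - f x) ^+ 2)%:E).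
    by apply/measurable_EFinP; exact: measurable_funX.
  have le2 : (\int[m]_(x in D) ((u k x - f x) ^+ 2)%:E <=
      \int[m]_x ((u k x - f x) ^+ 2)%:E)%E.
    by apply: ge0_subset_integral => // x _; rewrite lee_fin sqr_ge0.
  rewrite fineK// ge0_fin_numE; last first.
    by apply: integral_ge0 => x _; rewrite lee_fin sqr_ge0.
  by apply: le_lt_trans le2 _; rewrite E2 ltry.
rewrite -[X in _ < X](sqr_sqrtr (ltW e0)) ltr_sqr ?nnegrE ?sqrtr_ge0//.
exact: fine_ge0.
Unshelve. all: by end_near. Qed.

(** Young's inequality for the cross term of [a^2 - b^2 = (a - b)^2 + 2 (a - b) b]. The right side
    involves [a] only through [a - b], which is what L^2 convergence controls. *)
Lemma sqr_diff_le (a b dl : R) : 0 < dl ->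
  `|a ^+ 2 - b ^+ 2| <= (1 + dl^-1) * (a - b) ^+ 2 + dl * b ^+ 2.
Proof.
move=> d0; have -> : a ^+ 2 - b ^+ 2 = (a - b) ^+ 2 + 2 * ((a - b) * b) by ring.
have h0 : 0 <= dl^-1 * ((a - b) - dl * b) ^+ 2 by rewrite mulr_ge0 ?sqr_ge0 ?invr_ge0 ?ltW.
have h1 : 0 <= dl^-1 * ((a - b) + dl * b) ^+ 2 by rewrite mulr_ge0 ?sqr_ge0 ?invr_ge0 ?ltW.
have e0 : dl^-1 * ((a - b) - dl * b) ^+ 2 =
  dl^-1 * (a - b) ^+ 2 - 2 * ((a - b) * b) + dl * b ^+ 2 by field; rewrite gt_eqF.
have e1 : dl^-1 * ((a - b) + dl * b) ^+ 2 =
  dl^-1 * (a - b) ^+ 2 + 2 * ((a - b) * b) + dl * b ^+ 2 by field; rewrite gt_eqF.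
have h2 : 0 <= (a - b) ^+ 2 by exact: sqr_ge0.
rewrite ler_norml; apply/andP; split; lra.
Qed.

Lemma L2_cvg_weight (u : nat -> 'rV[R]_N -> R) f D w (K : R) :
  (forall k, L2 m (u k)) -> L2 m f -> L2_cvg m u f ->
  measurable D -> measurable_fun D w -> (forall x, D x -> `|w x| <= K) ->
  forall e : R, 0 < e -> \forall k \near \oo,
    `|\int[m]_(x in D) (w x * u k x ^+ 2) - \int[m]_(x in D) (w x * f x ^+ 2)| < e.
Proof.
move=> Lu Lf uf mD mw wK e e0.
pose I := \int[m]_(x in D) (f x ^+ 2).
have I0 : 0 <= I by apply: Rintegral_ge0 => x _; exact: sqr_ge0.
have K1 : 0 < `|K| + 1 by rewrite ltr_wpDl.
(* [dl] makes the share of [f ^+ 2] at most [e / 2]; once it is fixed, [e'] does the same for the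
   squared distance. The added [1] keep the denominators positive. *)
pose dl := e / (2 * (`|K| + 1) * (I + 1)).
have I1 : 0 < I + 1 by rewrite ltr_wpDl.
have dl0 : 0 < dl by apply: divr_gt0 => //; apply: mulr_gt0 => //; exact: mulr_gt0.
have c0 : 0 < 1 + dl^-1 by rewrite addr_gt0 ?invr_gt0.
pose e' := e / (2 * (`|K| + 1) * (1 + dl^-1)).
have e'0 : 0 < e' by apply: divr_gt0 => //; apply: mulr_gt0 => //; exact: mulr_gt0.
have := L2_cvg_sqr_lt Lu Lf uf mD e'0; apply: filterS => k Hk.
have iu := L2_integrable_weight mD (Lu k) mw wK.
have iff := L2_integrable_weight mD Lf mw wK.
have Ld : L2 m (fun x => u k x - f x).
  exact: L2B (Lu k) Lf.
have id2 := L2_integrable_sqr mD Ld.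
have if2 := L2_integrable_sqr mD Lf.
have iB : m.-integrable D (EFin \o (fun x => w x * u k x ^+ 2 - w x * f x ^+ 2)).
  by rewrite (_ : _ \o _ = (EFin \o (fun x => w x * u k x ^+ 2)%R) \-
    (EFin \o (fun x => w x * f x ^+ 2)%R))%E//; exact: integrableB.
have iZ1 : m.-integrable D (EFin \o (fun x => (1 + dl^-1) * (u k x - f x) ^+ 2)).
  by rewrite (_ : _ \o _ = fun x => (1 + dl^-1)%:E * ((u k x - f x) ^+ 2)%R%:E)%E//; exact: integrableZl.
have iZ2 : m.-integrable D (EFin \o (fun x => dl * f x ^+ 2)).
  by rewrite (_ : _ \o _ = fun x => dl%:E * (f x ^+ 2)%R%:E)%E//; exact: integrableZl.
have iS : m.-integrable D (EFin \o (fun x => (1 + dl^-1) * (u k x - f x) ^+ 2 + dl * f x ^+ 2)).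
  by rewrite (_ : _ \o _ = (EFin \o (fun x => (1 + dl^-1) * (u k x - f x) ^+ 2)%R) \+
    (EFin \o (fun x => dl * f x ^+ 2)%R))%E//; exact: integrableD.
have iK : m.-integrable D (EFin \o (fun x => (`|K| + 1) * ((1 + dl^-1) * (u k x - f x) ^+ 2 + dl * f x ^+ 2))).
  by rewrite (_ : _ \o _ = fun x => (`|K| + 1)%:E *
    ((1 + dl^-1) * (u k x - f x) ^+ 2 + dl * f x ^+ 2)%R%:E)%E//; exact: integrableZl.
rewrite -RintegralB//; apply: le_lt_trans (le_normr_Rintegral mD iB) _.
apply: (@le_lt_trans _ _ (\int[m]_(x in D)
    ((`|K| + 1) * ((1 + dl^-1) * (u k x - f x) ^+ 2 + dl * f x ^+ 2)))).
  apply: le_Rintegral => //.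
    by have := integrable_abse iB; apply: eq_integrable.
  move=> x Dx; rewrite -mulrBr normrM ler_pM//.
    by rewrite (le_trans (wK _ Dx))// (le_trans (ler_norm K))// lerDl.
  exact: sqr_diff_le.
rewrite RintegralZl// RintegralD// !RintegralZl// -/I.
have h1 : (`|K| + 1) * ((1 + dl^-1) * e') = e / 2.
  rewrite /e'; move: (1 + dl^-1) (`|K| + 1) c0 K1 => c K' c0 K1.
  by field; rewrite !gt_eqF.
have h2 : (`|K| + 1) * (dl * (I + 1)) = e / 2.
  rewrite /dl; move: (I + 1) (`|K| + 1) I1 K1 => I' K' I1 K1.
  by field; rewrite !gt_eqF.
rewrite [ltRHS](_ : e = (`|K| + 1) * ((1 + dl^-1) * e' + dl * (I + 1))); last first.
  by rewrite mulrDr h1 h2 -splitr.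
by rewrite ltr_pM2l// ltrD ?ltr_pM2l// ltrDl.
Qed.

End L2_limits.

(** * The linearized reaction term *)

Section right_derivative_on_sphere.
Variables (R : realType) (N : nat) (z : 'rV[R]_N) (rho : {posnum R}).
Variables (r : R) (g : 'rV[R]_N -> R -> R).
Hypothesis r0 : 0 < r.
Hypothesis hg : C1_holder r [set p | esphere z rho p.1 /\ 0 <= p.2] g.
Local Notation S := (esphere z rho).
Local Notation q := (fun y => right_derive0 (g y)).

(** The points [(y, t)] with [t >= 0] belong to the domain where [F] and [g] agree, so the quotient
    of [g] is that of [F] from the right. *)
Lemma right_derive0_extension (F : 'rV[R]_N * R -> R) y :
  (forall t : R, 0 <= t -> F (y, t) = g y t) -> differentiable F (y, 0) ->
  right_derive0 (g y) = 'D_(0, 1) F (y, 0).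
Proof.
move=> Fg dF.
have : derivable F (y, 0) ((0, 1) : 'rV[R]_N * R) by exact: diff_derivable.
move=> /cvg_dnbhs_at_right H; apply: cvg_lim => //; apply: cvg_trans H.
apply: near_eq_cvg; near=> t.
have t0 : 0 < t by near: t; exact: nbhs_right_gt.
have E : t *: (0, 1) + (y, 0) = (y, t) :> 'rV[R]_N * R.
  apply: injective_projections => /=; first by rewrite scaler0 add0r.
  by rewrite addr0 [LHS]mulr1.
rewrite /= -(Fg t (ltW t0)) -(Fg 0)// E.
exact: mulrC.
Unshelve. all: by end_near. Qed.

(** The Hoelder clause of [C1_holder], in the direction [(0, 1)] and on the compact set of points
    [(y, 0)] with [y] on the sphere. *)
Lemma right_derive0_holder : exists2 C : R, 0 <= C &
  forall y y', S y -> S y' -> `|q y - q y'| <= C * eucl (y - y') `^ r.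
Proof.
have [Om [F [_ AO Fg dF HF]]] := hg.
pose K : set ('rV[R]_N * R) := S `*` [set 0].
have cK : compact K by apply: compact_setX; [exact: esphere_compact|exact: compact_set1].
have KO : K `<=` Om by move=> [y t] [/= Sy ->]; apply: AO.
have [C HC] := HF (0, 1) K cK KO.
have qE y : S y -> q y = 'D_(0, 1) F (y, 0).
  move=> Sy; apply: right_derive0_extension.
    by move=> t t0; rewrite Fg.
  by apply: dF; apply: AO.
exists `|C| => // y y' Sy Sy'; rewrite !qE//.
apply: le_trans (HC (y, 0) (y', 0) _ _) _ => //.
have -> : `|(y, 0) - (y', 0) : 'rV[R]_N * R| = `|y - y'|.
  by rewrite prod_normE/= subrr normr0 max_l.
apply: (@le_trans _ _ (`|C| * `|y - y'| `^ r)).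
  by rewrite ler_wpM2r ?powR_ge0// ler_norm.
rewrite ler_wpM2l//; apply: ge0_ler_powR; rewrite ?nnegrE ?eucl_ge0//; first exact: ltW.
exact: rV_norm_le_eucl.
Qed.

Lemma right_derive0_continuous y : S y -> forall e : R, 0 < e ->
  exists2 d : R, 0 < d & forall y', S y' -> eucl (y - y') < d -> `|q y - q y'| < e.
Proof.
move=> Sy e e0; have [C C0 HC] := right_derive0_holder.
have C1 : 0 < C + 1 by rewrite ltr_wpDl.
exists ((e / (C + 1)) `^ r^-1).
  by rewrite powR_gt0// divr_gt0.
move=> y' Sy' yd; apply: le_lt_trans (HC _ _ Sy Sy') _.
have : eucl (y - y') `^ r < e / (C + 1).
  have e1 : 0 <= e / (C + 1) by rewrite ltW// divr_gt0.
  have -> : e / (C + 1) = ((e / (C + 1)) `^ r^-1) `^ r.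
    by rewrite -powRrM mulVf ?powRr1// gt_eqF.
  by apply: gt0_ltr_powR; rewrite ?nnegrE ?eucl_ge0 ?powR_ge0.
rewrite ltr_pdivlMr// => H; apply: le_lt_trans H.
by rewrite mulrC ler_wpM2l ?powR_ge0// lerDl.
Qed.

Lemma right_derive0_measurable : measurable_fun S q.
Proof.
apply: continuous_in_rV_measurable; first exact: measurable_esphere.
move=> y Sy e e0; have [d d0 Hd] := right_derive0_continuous Sy e0.
case: (posnP N) => [N00|N0].
  exists 1 => // y' _ _; rewrite (_ : y = y') ?subrr ?normr0//.
  by apply/rowP => i; have := ltn_ord i; rewrite [X in (_ < X)%N]N00.
exists (d / N%:R); first by rewrite divr_gt0// ltr0n.
move=> y' Sy'; rewrite ltr_pdivlMr ?ltr0n// mulrC => H; apply: Hd => //.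
exact: le_lt_trans (eucl_le_rV_norm _) H.
Qed.

Lemma right_derive0_bounded : exists2 K : R, 0 <= K & forall y, S y -> `|q y| <= K.
Proof.
have [[y0 Sy0]|noS] := pselect (exists y, S y); last first.
  by exists 0 => // y Sy; case: noS; exists y.
have [C C0 HC] := right_derive0_holder.
exists (`|q y0| + C * (rho%:num + rho%:num) `^ r).
  by rewrite addr_ge0// mulr_ge0// powR_ge0.
move=> y Sy; rewrite -(subrK (q y0) (q y)) addrC (le_trans (ler_normD _ _))//.
rewrite lerD2l (le_trans (HC _ _ Sy Sy0))// ler_wpM2l//.
apply: ge0_ler_powR; rewrite ?nnegrE ?eucl_ge0//; first exact: ltW.
have -> : y - y0 = (y - z) + - (y0 - z) by rewrite opprB addrA subrK.
by rewrite (le_trans (eucl_triangle _ _))// euclN Sy Sy0.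
Qed.

End right_derivative_on_sphere.

(** * Test functions *)

Section polynomial_functions.
Variables (R : realType) (N : nat).
Implicit Types phi psi : 'rV[R]_N -> R.

(** A class stable under [partial], which turns the condition on all iterated derivatives in
    [smooth] into an induction. *)
Inductive polyfun : ('rV[R]_N -> R) -> Prop :=
| polyfun_cst c : polyfun (cst c)
| polyfun_coord i : polyfun (fun x => x ord0 i)
| polyfun_add phi psi : polyfun phi -> polyfun psi -> polyfun (phi + psi)
| polyfun_mul phi psi : polyfun phi -> polyfun psi -> polyfun (phi * psi).

Lemma is_derive_coord (j : 'I_N) x (v : 'rV[R]_N) :
  is_derive x v (fun x : 'rV[R]_N => x ord0 j) (v ord0 j).
Proof.
have H : (fun h : R => h^-1 *: ((h *: v + x) ord0 j - x ord0 j)) @ 0^' --> v ord0 j.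
  apply: (@cvg_trans _ (cst (v ord0 j) @ (0 : R)^')); last exact: cvg_cst.
  apply: near_eq_cvg; near=> h.
  have h0 : h != 0 by near: h; exact: nbhs_dnbhs_neq.
  by rewrite !mxE addrK /= [RHS]mulrA mulVf// mul1r.
split; first by apply/cvg_ex; exists (v ord0 j).
exact: cvg_lim H.
Unshelve. all: by end_near. Qed.

Lemma polyfun_derivable phi : polyfun phi -> forall x v, derivable phi x v.
Proof.
elim=> [c|i|f g _ Hf _ Hg|f g _ Hf _ Hg] x v.
- exact: derivable_cst.
- by case: (is_derive_coord i x v).
- exact: derivableD.
- exact: derivableM.
Qed.

Lemma polyfun_continuous phi : polyfun phi -> continuous phi.
Proof.
elim=> [c|i|f g _ Hf _ Hg|f g _ Hf _ Hg].
- have : continuous (cst c : 'rV[R]_N -> R) by exact: cst_continuous.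
  by [].
- exact: (@coord_continuous R 1 N ord0 i).
- by move=> x; exact: (continuousD (Hf x) (Hg x)).
- by move=> x; exact: (continuousM (Hf x) (Hg x)).
Qed.

Lemma polyfun_partial phi : polyfun phi -> forall i, polyfun (partial i phi).
Proof.
elim=> [c|j|f g pf Hf pg Hg|f g pf Hf pg Hg] i.
- rewrite (_ : partial i _ = cst 0); first exact: polyfun_cst.
  by apply/funext => x; rewrite /partial derive_cst.
- rewrite (_ : partial i _ = cst ((delta_mx 0 i : 'rV[R]_N) ord0 j)).
    exact: polyfun_cst.
  by apply/funext => x; rewrite /partial; case: (is_derive_coord j x (delta_mx 0 i)).
- rewrite (_ : partial i _ = partial i f + partial i g).
    exact: polyfun_add.
  by apply/funext => x; rewrite /partial deriveD//; exact: polyfun_derivable.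
- rewrite (_ : partial i _ = f * partial i g + g * partial i f).
    by apply: polyfun_add; exact: polyfun_mul.
  by apply/funext => x; rewrite /partial deriveM//; exact: polyfun_derivable.
Qed.

Lemma polyfun_smooth phi : polyfun phi -> smooth phi.
Proof.
move=> pphi s /=.
have ps : polyfun (foldr (@partial R N) phi s).
  by elim: s => //= i s IH; exact: polyfun_partial.
by split; [exact: polyfun_continuous|move=> i x; exact: polyfun_derivable].
Qed.

Lemma polyfun_expr phi k : polyfun phi -> polyfun (phi ^+ k).
Proof.
by move=> p; elim: k => [|k IH]; [exact: polyfun_cst|rewrite exprS; exact: polyfun_mul].
Qed.

Lemma polyfun_sqr_dist (y : 'rV[R]_N) : polyfun (fun x => dot (x - y) (x - y)).
Proof.
rewrite (_ : (fun _ => _) = \sum_(i < N)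
  ((fun x : 'rV[R]_N => x ord0 i) + cst (- y ord0 i)) *
  ((fun x : 'rV[R]_N => x ord0 i) + cst (- y ord0 i))).
  elim/big_ind : _ => [|f g|i _]; [exact: polyfun_cst|exact: polyfun_add|].
  by apply: polyfun_mul; apply: polyfun_add;
    (exact: polyfun_coord || exact: polyfun_cst).
apply/funext => x; rewrite fct_sumE; apply: eq_bigr => i _.
by rewrite !mxE.
Qed.

End polynomial_functions.

Section continuous_L2.
Variables (R : realType) (N : nat) (z : 'rV[R]_N) (rho : {posnum R}).
Local Notation sigma := (sphere_measure z rho).

Lemma continuous_L2_sphere (f : 'rV[R]_N -> R) : continuous f -> L2 sigma f.
Proof.
move=> cf; have mf := continuous_rV_measurable cf.
have [M M0 HM] := continuous_esphere_bounded z rho cf.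
rewrite /L2 inE; apply/andP; split; rewrite inE//= /finite_norm unlock.
apply: poweR_lty.
have -> : (\int[sigma]_x (`|(EFin \o f) x| `^ 2) = \int[sigma]_x (f x ^+ 2)%:E)%E.
  apply: eq_integral => x _; rewrite /= powR_mulrn//.
  by rewrite real_normK ?num_real.
have mf2 : measurable_fun setT (fun x => (f x ^+ 2)%:E).
  by apply/measurable_EFinP; exact: measurable_funX.
rewrite ge0_integral_sphere_measure//; last by move=> x; rewrite lee_fin sqr_ge0.
rewrite preimage_setT setTI.
have mB := measurable_eball z rho.
(* [L2] integrates over the whole space and [radial] fixes the centre; adding [|f z|] covers that
   point too. *)
pose M' := M + `|f z|.
have bound : (\int[lebesgue_rV R N]_(x in eball z rho) (f (radial z rho x) ^+ 2)%:E <=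
    \int[lebesgue_rV R N]_(x in eball z rho) (M' ^+ 2)%:E)%E.
  apply: ge0_le_integral => //.
  - by move=> x _; rewrite lee_fin sqr_ge0.
  - apply: measurable_funTS.
    exact: (measurableT_comp mf2 (measurable_radial z rho)).
  move=> x _; rewrite lee_fin -[leLHS]real_normK ?num_real//.
  rewrite ler_sqr ?nnegrE ?addr_ge0//.
  have [->|xz] := eqVneq x z; first by rewrite radial_center lerDr.
  by apply: le_trans (HM _ (radial_esphere rho xz)) _; rewrite lerDl.
rewrite lte_mul_pinfty ?lee_fin ?divr_ge0//.
apply: le_lt_trans bound _; rewrite integral_cst//.
rewrite -[X in (_ * X)%E]fineK; first by rewrite -EFinM ltry.
rewrite ge0_fin_numE//.
exact: (lebesgue_eball_lty mB (@subset_refl _ _)).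
Qed.

End continuous_L2.

(** * Functions concentrating at a point of the sphere *)

Section concentration.
Variables (R : realType) (N : nat) (z : 'rV[R]_N) (rho : {posnum R}).
Local Notation lam := (lebesgue_rV R N).
Local Notation sigma := (sphere_measure z rho).
Local Notation S := (esphere z rho).

Definition cap (y0 : 'rV[R]_N) (a : R) : set 'rV[R]_N :=
  [set y | S y /\ eucl (y - y0) < a].

Lemma measurable_cap y0 a : measurable (cap y0 a).
Proof.
rewrite (_ : cap y0 a = S `&` (fun y => eucl (y - y0)) @^-1` `]-oo, a[%classic).
  apply: measurableI; first exact: measurable_esphere.
  rewrite -[X in measurable X]setTI.
  exact: (measurable_eucl_sub y0 measurableT (measurable_itv `]-oo, a[)).
by apply/seteqP; split => y /=; rewrite in_itv.
Qed.

(** The cone over the cap contains a cube around [w0], the midpoint of the radius through [y0],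
    because [radial] is continuous there. *)
Lemma sphere_measure_cap_gt0 y0 a : (0 < N)%N -> S y0 -> 0 < a ->
  (0 < sigma (cap y0 a))%E.
Proof.
move=> N0 Sy0 a0; have y0z := esphere_neq Sy0.
have c0 : 0 < N%:R / rho%:num by rewrite divr_gt0// ltr0n.
pose w0 := z + 2^-1 *: (y0 - z).
have h0 : 0 < 2^-1 :> R by rewrite invr_gt0.
have rw0 : radial z rho w0 = y0 by rewrite /w0 radial_homogeneous// radial_id.
have w0z : w0 - z = 2^-1 *: (y0 - z) by rewrite /w0 addrAC subrr add0r.
have w0nz : w0 != z by rewrite -subr_eq0 w0z scaler_eq0 negb_or gt_eqF//= subr_eq0.
have ew0 : eucl (w0 - z) = rho%:num / 2.
  by rewrite w0z euclZ ger0_norm ?invr_ge0// Sy0 mulrC.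
clearbody w0.
have cr : {for w0, continuous (fun w => radial z rho w - y0)}.
  have cy : {for w0, continuous (cst y0 : 'rV[R]_N -> 'rV[R]_N)}.
    exact: cst_continuous.
  exact: (continuousB (continuous_radial (rho := rho) w0nz) cy).
have aN : 0 < a / N%:R by rewrite divr_gt0// ltr0n.
have /cvgrPdist_lt/(_ _ aN)/nbhs_ballP[e1 /= e10 He1] := cr.
(* The second bound keeps the cube within [rho / 4] of [w0], hence inside the ball and away from the
   centre. *)
pose e := Num.min e1 (rho%:num / (4 * N%:R)).
have e0 : 0 < e by rewrite lt_min e10 divr_gt0// mulr_gt0// ltr0n.
have sub : cube w0 e `<=` radial z rho @^-1` cap y0 a `&` eball z rho.
  move=> w Cw.
  have wle : eucl (w - w0) <= rho%:num / 4.
    have -> : rho%:num / 4 = N%:R * (rho%:num / (4 * N%:R)).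
      by field; rewrite pnatr_eq0 -lt0n.
    apply: eucl_le_coords => i; rewrite !mxE; apply/ltW; apply: lt_le_trans (Cw i) _.
    by rewrite ge_min lexx orbT.
  have wzE : w - z = (w - w0) + (w0 - z) by rewrite addrA subrK.
  have wB : eucl (w - z) < rho%:num.
    rewrite wzE; apply: le_lt_trans (eucl_triangle _ _) _; rewrite ew0.
    have : 0 < rho%:num by []. lra.
  have wz : w != z.
    apply/eqP => wz; move: wle; rewrite wz -euclN opprB ew0.
    have : 0 < rho%:num by []. lra.
  split; last exact: wB.
  split; first exact: radial_esphere.
  have : ball w0 e1 w.
    rewrite -ball_normE /=; apply: rV_mxnorm_ltP => // i.
    by rewrite !mxE distrC; apply: lt_le_trans (Cw i) _; rewrite ge_min lexx.
  move=> /He1; rewrite rw0 subrr sub0r normrN => H.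
  apply: le_lt_trans (eucl_le_rV_norm _) _.
  by rewrite mulrC -ltr_pdivlMr// ltr0n.
change (0 < (N%:R / rho%:num)%:E * lam (radial z rho @^-1` cap y0 a `&` eball z rho))%E.
apply: mule_gt0; first by rewrite lte_fin.
apply: (@lt_le_trans _ _ (lam (cube w0 e))).
  by rewrite lebesgue_cube// lte_fin exprn_gt0// pmulrn_lgt0.
apply: le_measure => //; rewrite inE; first exact: measurable_cube.
apply: measurableI; last exact: measurable_eball.
by rewrite -[X in measurable X]setTI; apply: measurable_radial => //; exact: measurable_cap.
Qed.

(** The function [p = 1 - |y - y0|^2 / (4 rho^2)] is nonnegative on the sphere, whose diameter is
    [2 rho], and peaks at [y0]. It is at least [s1] within [dl / 2] of [y0] and at most [s2 < s1]
    beyond [dl]; in between the weight is positive and can only help. For a high power of [p] the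
    gain near [y0] outweighs the loss far away, however large [K] is. *)
Lemma exists_concentrated (w : 'rV[R]_N -> R) (y0 : 'rV[R]_N) (K e dl : R) :
  (0 < N)%N -> S y0 -> measurable_fun S w -> (forall y, S y -> `|w y| <= K) ->
  0 < e -> 0 < dl ->
  (forall y, S y -> eucl (y - y0) < dl -> e <= w y) ->
  exists2 phi, polyfun phi &
    \int[sigma]_(y in S) (phi y ^+ 2) = 1 /\
    0 < \int[sigma]_(y in S) (w y * phi y ^+ 2).
Proof.
move=> N0 Sy0 mw wK e0 dl0' wdl'.
have r0 : 0 < rho%:num by [].
(* Capping [dl] at the diameter keeps [s2] nonnegative. *)
have [dl0 wdl dlr] : [/\ 0 < Num.min dl (2 * rho%:num),
    forall y, S y -> eucl (y - y0) < Num.min dl (2 * rho%:num) -> e <= w y &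
    Num.min dl (2 * rho%:num) <= 2 * rho%:num].
  split; first by rewrite lt_min dl0' mulr_gt0.
    by move=> y Sy; rewrite lt_min => /andP[+ _]; exact: wdl'.
  by rewrite ge_min lexx orbT.
move: {dl0' wdl' dl} (Num.min dl _) dl0 wdl dlr => dl dl0 wdl dlr.
have mS := measurable_esphere z rho.
have K0 : 0 <= K by exact: le_trans (wK _ Sy0).
have sfin : (sigma S < +oo)%E.
  by apply: le_lt_trans (sphere_measure_lty z rho); apply: le_measure => //; rewrite inE.
pose p (y : 'rV[R]_N) : R := 1 - eucl (y - y0) ^+ 2 / (4 * rho%:num ^+ 2).
have pp : polyfun p.
  rewrite (_ : p = cst 1 + cst (- (4 * rho%:num ^+ 2)^-1) *
      (fun y => dot (y - y0) (y - y0))).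
    apply: polyfun_add; first exact: polyfun_cst.
    by apply: polyfun_mul; [exact: polyfun_cst|exact: polyfun_sqr_dist].
  by apply/funext => y; rewrite /p eucl_sqr /= fctE mulNr mulrC.
have p0 y : S y -> 0 <= p y.
  move=> Sy; rewrite subr_ge0 ler_pdivrMr ?mulr_gt0 ?exprn_gt0// mul1r.
  rewrite (_ : 4 * _ = (rho%:num + rho%:num) ^+ 2); last by ring.
  rewrite ler_sqr ?nnegrE ?eucl_ge0 ?addr_ge0//.
  have -> : y - y0 = (y - z) + - (y0 - z) by rewrite opprB addrA subrK.
  by rewrite (le_trans (eucl_triangle _ _))// euclN Sy Sy0.
pose s1 : R := 1 - (dl / 2) ^+ 2 / (4 * rho%:num ^+ 2).
pose s2 : R := 1 - dl ^+ 2 / (4 * rho%:num ^+ 2).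
have q0 : 0 < 4 * rho%:num ^+ 2 by rewrite mulr_gt0// exprn_gt0.
have s20 : 0 <= s2.
  rewrite subr_ge0 ler_pdivrMr// mul1r (_ : 4 * _ = (2 * rho%:num) ^+ 2); last by ring.
  by rewrite ler_sqr ?nnegrE ?mulr_ge0 ?(ltW dl0).
have s12 : s2 < s1.
  rewrite ltrD2l ltrN2 ltr_pM2r ?invr_gt0// ltr_sqr ?nnegrE ?divr_ge0 ?(ltW dl0)//.
  by rewrite ltr_pdivrMr// ltr_pMr// ltr1n.
have s10 : 0 < s1 by exact: le_lt_trans s12.
have p_near y : eucl (y - y0) < dl / 2 -> s1 <= p y.
  move=> yd; rewrite lerD2l lerN2 ler_pM2r ?invr_gt0//.
  by rewrite ler_sqr ?nnegrE ?eucl_ge0 ?divr_ge0 ?(ltW dl0)// ltW.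
have p_far y : dl <= eucl (y - y0) -> p y <= s2.
  move=> yd; rewrite lerD2l lerN2 ler_pM2r ?invr_gt0//.
  by rewrite ler_sqr ?nnegrE ?eucl_ge0 ?(ltW dl0).
pose C := cap y0 (dl / 2).
have mC : measurable C by exact: measurable_cap.
have CS : C `<=` S by move=> y [].
have C0 : (0 < sigma C)%E by apply: sphere_measure_cap_gt0 => //; rewrite divr_gt0.
have Cfin : (sigma C < +oo)%E.
  by apply: le_lt_trans sfin; apply: le_measure => //; rewrite inE.
pose c := fine (sigma C); pose s := fine (sigma S).
have c0 : 0 < c by rewrite fine_gt0// C0.
have s0 : 0 <= s by exact: fine_ge0.
pose x := (s2 / s1) ^+ 2.
have x0 : 0 <= x by exact: sqr_ge0.
have x1 : x < 1.
  rewrite -(expr1n _ 2) ltr_sqr ?nnegrE ?divr_ge0 ?(ltW s10)//.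
  by rewrite ltr_pdivrMr// mul1r.
have xE : s2 ^+ 2 = x * s1 ^+ 2 by rewrite -exprMn divfK ?gt_eqF.
clearbody x.
(* The gain is at least [e * c] times [s1 ^ (2 k)], the loss at most [K * s] times [s2 ^ (2 k)], and
   [x] is the square of [s2 / s1]. *)
have [k Hk] : exists k, x ^+ k * (K * s) < e * c.
  have Ks : 0 < K * s + 1 by rewrite ltr_wpDl// mulr_ge0.
  have ec : 0 < e * c / (K * s + 1) by rewrite divr_gt0// mulr_gt0.
  have cx : x ^+ n @[n --> \oo] --> 0 by apply: cvg_expr; rewrite ger0_norm.
  have /cvgrPdist_lt/(_ _ ec)[k _ /(_ k (leqnn k))] := cx.
  rewrite /= sub0r normrN ger0_norm ?exprn_ge0// => H.
  exists k; rewrite ltr_pdivlMr// in H; apply: le_lt_trans H; rewrite ler_wpM2l ?exprn_ge0// lerDl//.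
pose u := p ^+ k.
have pu : polyfun u by exact: polyfun_expr.
have uE y : u y ^+ 2 = (p y ^+ 2) ^+ k by rewrite /u exprfctE -!exprM mulnC.
have Lu := continuous_L2_sphere z rho (polyfun_continuous pu).
have iu := L2_integrable_sqr mS Lu.
have iwu := L2_integrable_weight mS Lu mw wK.
have s1k : 0 < (s1 ^+ 2) ^+ k by rewrite !exprn_gt0.
have s2k : 0 <= (s2 ^+ 2) ^+ k by rewrite !exprn_ge0.
pose low y := e * (s1 ^+ 2) ^+ k * \1_C y - K * (s2 ^+ 2) ^+ k.
have low_le y : S y -> low y <= w y * u y ^+ 2.
  move=> Sy; rewrite /low uE indicE.
  have pk0 : 0 <= (p y ^+ 2) ^+ k by rewrite exprn_ge0// sqr_ge0.
  have Ks0 : 0 <= K * (s2 ^+ 2) ^+ k by rewrite mulr_ge0.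
  have [yC|yC] := boolP (y \in C).
    move: (yC); rewrite inE => -[_ yd].
    rewrite mulr1 lerBlDr (le_trans (y := w y * (p y ^+ 2) ^+ k)) ?lerDl//.
    apply: ler_pM => //; [exact: ltW|exact: ltW| |].
      apply: wdl => //; apply: lt_trans yd _.
      by rewrite ltr_pdivrMr// ltr_pMr// ltr1n.
    rewrite lerXn2r ?nnegrE ?sqr_ge0//.
    by rewrite ler_sqr ?nnegrE ?p0 ?(ltW s10)// p_near.
  rewrite mulr0 sub0r; have [yd|yd] := ltP (eucl (y - y0)) dl.
    rewrite (le_trans (y := 0)) ?oppr_le0// mulr_ge0//.
    by apply: le_trans (wdl _ Sy yd); exact: ltW.
  have pk : (p y ^+ 2) ^+ k <= (s2 ^+ 2) ^+ k.
    rewrite lerXn2r ?nnegrE ?sqr_ge0//.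
    by rewrite ler_sqr ?nnegrE ?p0 ?p_far.
  have := wK _ Sy; rewrite ler_norml => /andP[wy _].
  rewrite lerNl -mulNr; apply: le_trans (_ : K * (p y ^+ 2) ^+ k <= _).
    by rewrite ler_wpM2r// lerNl.
  by rewrite ler_wpM2l.
have sfn : sigma S \is a fin_num by rewrite ge0_fin_numE.
have icst (a : R) : sigma.-integrable S (EFin \o (fun=> a)).
  apply: (measurable_bounded_integrable mS sfin); first exact: measurable_cst.
  by exists `|a|; split => // M aM y _; exact: ltW.
have i1 : sigma.-integrable S (EFin \o (\1_C : _ -> R)).
  apply: le_integrable (icst 1) => //.
    by apply/measurable_EFinP/measurable_funTS; exact: measurable_indic.
  by move=> y _; rewrite /= lee_fin indicE normr1 ger0_norm//; case: (_ \in _).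
have iC : sigma.-integrable S (EFin \o (fun y => e * (s1 ^+ 2) ^+ k * \1_C y)).
  by rewrite (_ : _ \o _ = fun y => (e * (s1 ^+ 2) ^+ k)%:E * (\1_C y)%:E)%E//; exact: integrableZl.
have ilow : sigma.-integrable S (EFin \o low).
  by rewrite (_ : _ \o _ = (EFin \o (fun y => e * (s1 ^+ 2) ^+ k * \1_C y)%R) \-
    (EFin \o (fun=> K * (s2 ^+ 2) ^+ k)%R))%E//; exact: integrableB.
have pos : 0 < \int[sigma]_(y in S) (w y * u y ^+ 2).
  apply: lt_le_trans (le_Rintegral mS ilow iwu low_le).
  rewrite /low RintegralB// Rintegral_cst//.
  have -> : \int[sigma]_(y in S) (e * (s1 ^+ 2) ^+ k * \1_C y) = e * (s1 ^+ 2) ^+ k * c.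
    by rewrite RintegralZl// /Rintegral integral_indic// setIidl.
  have -> : (s2 ^+ 2) ^+ k = x ^+ k * (s1 ^+ 2) ^+ k.
    by rewrite -exprMn -xE.
  rewrite -/s subr_gt0 (_ : K * _ * s = x ^+ k * (K * s) * (s1 ^+ 2) ^+ k); last by ring.
  by rewrite [ltRHS]mulrAC ltr_pM2r.
pose b := \int[sigma]_(y in S) (u y ^+ 2).
(* The weight is at most [K], so a vanishing norm would contradict [pos]. *)
have b0 : 0 < b.
  have Kb : 0 < K * b.
    apply: lt_le_trans pos _; rewrite /b -RintegralZl//.
    apply: le_Rintegral => //.
      rewrite (_ : _ \o _ = fun y => K%:E * (u y ^+ 2)%R%:E)%E//; exact: integrableZl.
    by move=> y Sy; rewrite ler_wpM2r ?sqr_ge0// (le_trans (ler_norm _))// wK.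
  by rewrite -(pmulr_rgt0 _ (_ : 0 < K))//; rewrite lt_neqAle K0 andbT;
    apply: contraTneq Kb => <-; rewrite mul0r ltxx.
exists (cst (Num.sqrt b)^-1 * u); first by apply: polyfun_mul => //; exact: polyfun_cst.
have nE y : (cst (Num.sqrt b)^-1 * u) y ^+ 2 = b^-1 * u y ^+ 2.
  by rewrite fctE exprMn exprVn sqr_sqrtr// ltW.
split.
  under eq_Rintegral do rewrite nE.
  by rewrite RintegralZl// mulVf// gt_eqF.
under eq_Rintegral do rewrite nE mulrCA.
by rewrite RintegralZl// mulr_gt0// invr_gt0.
Qed.

End concentration.

(** * The principal eigenvalue *)

Section L2_basics.
Variables (R : realType) (N : nat) (m : {measure set 'rV[R]_N -> \bar R}).

Lemma L2_0 : L2 m (cst 0).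
Proof.
have p1 : (1%E <= 2%:E :> \bar R)%E by rewrite lee_fin ler1n.
exact: (Lfun_addr_closed m p1).1.
Qed.

Lemma L2_cvg_cst f : L2_cvg m (fun=> f) f.
Proof.
rewrite /L2_cvg (_ : (fun _ => _) = cst 0%E); first exact: cvg_cst.
apply/funext => k; rewrite (_ : _ \o _ = cst 0%E); last first.
  by apply/funext => x; rewrite /= subrr.
by rewrite Lnorm0// eqe pnatr_eq0.
Qed.

End L2_basics.

(** * The functional on admissible tuples *)

Section eigenvalue_problem.
Variables (R : realType) (N : nat) (z : 'rV[R]_N) (rho : {posnum R}).
Variables (d mu nu r : R) (kappa : 'rV[R]_N -> R) (f g : 'rV[R]_N -> R -> R).
Local Notation E := 'rV[R]_N.
Local Notation leb := (ball_measure z rho).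
Local Notation sigma := (sphere_measure z rho).
Local Notation B := (eball z rho).
Local Notation S := (esphere z rho).
Local Notation q := (fun y => right_derive0 (g y)).
Local Notation F := (functional z rho d mu nu kappa f g).
Local Notation L := (Lambda z rho d mu nu kappa f g).
Hypothesis hN : (0 < N)%N.
Hypothesis hd : 0 < d.
Hypothesis hr : 0 < r.
Hypothesis hg : C1_holder r [set p | S p.1 /\ 0 <= p.2] g.
Hypothesis hdf : forall y, B y -> right_derive0 (f y) = -1.
Hypothesis hkappa : forall y, S y -> kappa y = 1.
Implicit Types (U V T : E -> R) (G H : E -> E).

Definition admissible U G V H T : Prop :=
  [/\ H1_sphere z rho U G, H1_ball z rho V H, is_trace z rho V H T &
    \int[sigma]_(y in S) (U y ^+ 2) + \int[leb]_(x in B) (V x ^+ 2) = 1].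

Let mS : measurable S := measurable_esphere z rho.
Let mB : measurable B := measurable_eball z rho.

Lemma integrable_potential U : L2 sigma U ->
  sigma.-integrable S (EFin \o (fun y => right_derive0 (g y) * U y ^+ 2)).
Proof.
move=> LU; have [K _ qK] := right_derive0_bounded hr hg.
exact: (L2_integrable_weight mS LU (right_derive0_measurable hr hg) qK).
Qed.

(** Isolates the dependence on [alpha]; the value [-1] of the linearized reaction in the ball
    appears as a positive square of [V]. *)
Lemma functional_expand D alpha U G V H T : admissible U G V H T ->
  F D alpha U G V H T =
  D * \int[sigma]_(y in S) dot (G y) (G y)
  - \int[sigma]_(y in S) (right_derive0 (g y) * U y ^+ 2)
  + d * \int[leb]_(x in B) dot (H x) (H x) + \int[leb]_(x in B) (V x ^+ 2)
  + \int[sigma]_(y in S) (kappa y * (Num.sqrt mu * U y - Num.sqrt nu * T y) ^+ 2)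
  - alpha ^+ 2 * (D * \int[sigma]_(y in S) (U y ^+ 2) + d * \int[leb]_(x in B) (V x ^+ 2)).
Proof.
move=> [[LU _ _] [LV _ _] _ _]; rewrite /functional.
have iU := L2_integrable_sqr mS LU; have iV := L2_integrable_sqr mB LV.
have iqU := integrable_potential LU.
have -> : \int[sigma]_(y in S) ((D * alpha ^+ 2 + right_derive0 (g y)) * U y ^+ 2) =
    D * alpha ^+ 2 * \int[sigma]_(y in S) (U y ^+ 2) +
    \int[sigma]_(y in S) (right_derive0 (g y) * U y ^+ 2).
  under eq_Rintegral do rewrite mulrDl.
  rewrite RintegralD//; first by rewrite RintegralZl.
  by rewrite (_ : _ \o _ = fun y => (D * alpha ^+ 2)%:E * (U y ^+ 2)%R%:E)%E//; exact: integrableZl.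
have -> : \int[leb]_(x in B) ((d * alpha ^+ 2 + right_derive0 (f x)) * V x ^+ 2) =
    (d * alpha ^+ 2 - 1) * \int[leb]_(x in B) (V x ^+ 2).
  rewrite -RintegralZl//; apply: eq_Rintegral => x; rewrite inE => Bx.
  by rewrite hdf.
by ring.
Qed.

Lemma functional_shift D alpha U G V H T : admissible U G V H T ->
  F D alpha U G V H T = F D 0 U G V H T
  - alpha ^+ 2 * (D * \int[sigma]_(y in S) (U y ^+ 2) + d * \int[leb]_(x in B) (V x ^+ 2)).
Proof. by move=> adm; rewrite !functional_expand// expr0n /= mul0r subr0. Qed.

Lemma functional_ge D U G V H T : admissible U G V H T ->
  D * \int[sigma]_(y in S) dot (G y) (G y)
  - \int[sigma]_(y in S) (right_derive0 (g y) * U y ^+ 2)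
  + \int[leb]_(x in B) (V x ^+ 2) <= F D 0 U G V H T.
Proof.
move=> adm; rewrite functional_expand// expr0n /= mul0r subr0.
have h1 : 0 <= d * \int[leb]_(x in B) dot (H x) (H x).
  by rewrite mulr_ge0 ?(ltW hd)//; apply: Rintegral_ge0 => x _; exact: dot_ge0.
have h2 : 0 <= \int[sigma]_(y in S)
    (kappa y * (Num.sqrt mu * U y - Num.sqrt nu * T y) ^+ 2).
  by apply: Rintegral_ge0 => y Sy; rewrite hkappa// mul1r sqr_ge0.
lra.
Qed.

(** By the normalization the weight is a convex combination of [D] and [d]. The lower bound gives
    the decrease of [Lambda] in [alpha ^+ 2], the upper one its Lipschitz constant. *)
Lemma weight_bounds D U G V H T : 0 < D -> admissible U G V H T ->
  Num.min D d <= D * \int[sigma]_(y in S) (U y ^+ 2) + d * \int[leb]_(x in B) (V x ^+ 2)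
  <= D + d.
Proof.
move=> D0 [_ _ _ UV1].
have U0 : 0 <= \int[sigma]_(y in S) (U y ^+ 2).
  by apply: Rintegral_ge0 => y _; exact: sqr_ge0.
have V0 : 0 <= \int[leb]_(x in B) (V x ^+ 2).
  by apply: Rintegral_ge0 => y _; exact: sqr_ge0.
move: U0 V0 UV1; set a := \int[sigma]_(y in S) (U y ^+ 2).
set b := \int[leb]_(x in B) (V x ^+ 2) => a0 b0 ab; clearbody a b.
have hm1 : Num.min D d * a <= D * a by rewrite ler_wpM2r// ge_min lexx.
have hm2 : Num.min D d * b <= d * b by rewrite ler_wpM2r// ge_min lexx orbT.
have hm3 : Num.min D d = Num.min D d * a + Num.min D d * b by rewrite -mulrDr ab mulr1.
have hD : D * a <= D by rewrite ler_piMr ?(ltW D0)//; lra.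
have hd' : d * b <= d by rewrite ler_piMr ?(ltW hd)//; lra.
by apply/andP; split; lra.
Qed.

(** Ensures that [Lambda] is a genuine infimum and not the default value of [inf] on an unbounded
    set. *)
Lemma functional_lower_bound : exists K : R, forall D, 0 < D ->
  forall U G V H T, admissible U G V H T -> - K <= F D 0 U G V H T.
Proof.
have [K K0 qK] := right_derive0_bounded hr hg.
exists K => D D0 U G V H T adm; apply: le_trans (functional_ge D adm).
have [[LU LG _] _ _ UV1] := adm.
have iU := L2_integrable_sqr mS LU; have iqU := integrable_potential LU.
have G0 : 0 <= D * \int[sigma]_(y in S) dot (G y) (G y).
  by rewrite mulr_ge0 ?(ltW D0)//; apply: Rintegral_ge0 => y _; exact: dot_ge0.
have V0 : 0 <= \int[leb]_(x in B) (V x ^+ 2).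
  by apply: Rintegral_ge0 => y _; exact: sqr_ge0.
have U0 : 0 <= \int[sigma]_(y in S) (U y ^+ 2).
  by apply: Rintegral_ge0 => y _; exact: sqr_ge0.
have qU : \int[sigma]_(y in S) (right_derive0 (g y) * U y ^+ 2) <=
    K * \int[sigma]_(y in S) (U y ^+ 2).
  rewrite -RintegralZl//; apply: le_Rintegral => //.
    by rewrite (_ : _ \o _ = fun y => K%:E * (U y ^+ 2)%R%:E)%E//; exact: integrableZl.
  by move=> y Sy; rewrite ler_wpM2r ?sqr_ge0// (le_trans (ler_norm _))// qK.
have : K * \int[sigma]_(y in S) (U y ^+ 2) <= K by rewrite ler_piMr//; lra.
lra.
Qed.

(** A smooth function approximates itself, so constant sequences witness both the membership in H^1
    of the sphere and the zero trace. *)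
Lemma test_admissible phi : polyfun phi ->
  \int[sigma]_(y in S) (phi y ^+ 2) = 1 ->
  admissible phi (tangential_grad z rho phi) (cst 0) (cst 0) (cst 0).
Proof.
move=> pphi phi1; have sphi := polyfun_smooth pphi.
have scst : smooth (cst 0 : E -> R) by apply: polyfun_smooth; exact: polyfun_cst.
have g0 : grad (cst 0 : E -> R) = cst 0.
  by apply/funext => x; apply/rowP => i; rewrite !mxE /partial derive_cst.
have i0 (m : {measure set E -> \bar R}) D (h : E -> R) : (forall x, h x = 0) ->
    \int[m]_(x in D) h x = 0.
  by move=> h0; rewrite /Rintegral integral0_eq// => x _; rewrite h0.
have Lv0 (m : {measure set E -> \bar R}) : L2_vec m (cst 0 : E -> E).
  move=> i; rewrite (_ : (fun _ => _) = cst 0); first exact: L2_0.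
  by apply/funext => x; rewrite mxE.
split.
- split; first exact/continuous_L2_sphere/polyfun_continuous.
    by move=> i; apply: continuous_L2_sphere; apply: continuous_coord; exact: continuous_tangential_grad.
  exists (fun=> phi); split => //; first exact: L2_cvg_cst.
  by move=> i; exact: L2_cvg_cst.
- split; [exact: L2_0|exact: Lv0|].
  move=> psi _ i; rewrite !i0 ?oppr0// => x; first by rewrite mxE mul0r.
  by rewrite mul0r.
- split; first exact: L2_0.
  exists (fun=> cst 0); split => //; try exact: L2_cvg_cst.
  by move=> i; rewrite g0; exact: L2_cvg_cst.
- by rewrite phi1 i0 ?addr0// => x; rewrite expr0n.
Qed.

End eigenvalue_problem.

(** * Two lemmas on real numbers *)

Lemma le_of_forall_add (R : realType) (a b c : R) : 0 <= c ->
  (forall e, 0 < e -> a <= b + c * e) -> a <= b.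
Proof.
move=> c0 H; apply/ler_addgt0Pr => e e0.
have c1 : 0 < c + 1 by rewrite ltr_wpDl.
apply: le_trans (H (e / (c + 1)) _) _; first by rewrite divr_gt0.
rewrite lerD2l mulrA ler_pdivrMr// mulrC ler_wpM2l ?(ltW e0)//.
by rewrite lerDl.
Qed.

(** The first bound gives [h x >= - L 0 / x + c x], which is positive and large near [0] and at
    infinity; the second gives continuity. The extreme value theorem on a compact interval then
    yields a global minimum. *)
Lemma exists_min_ratio (R : realType) (L : R -> R) (c M : R) : 0 < c -> L 0 < 0 ->
  (forall x, L x <= L 0 - x ^+ 2 * c) ->
  (forall x y, L y <= L x + M * `|x ^+ 2 - y ^+ 2|) ->
  exists2 s, is_min [set - L x / x | x in [set x | 0 < x]] s & 0 < s.
Proof.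
move=> c0 L0 Lc LM.
pose h x := - L x / x.
have hge x : 0 < x -> - L 0 / x + c * x <= h x.
  move=> x0; rewrite /h ler_pdivlMr// mulrDl divfK ?gt_eqF//.
  by have := Lc x; lra.
have cL x : {for x, continuous L}.
  apply/cvgrPdist_lt => e e0.
  have ck (a : R) : {for x, continuous (cst a : R -> R)} by exact: cst_continuous.
  have c2 : {for x, continuous (fun y : R => y ^+ 2)} by exact: exprn_continuous.
  have cn := continuous_comp (continuousB (ck (x ^+ 2)) c2)
    (@norm_continuous _ _ (x ^+ 2 - x ^+ 2)).
  have cb : (fun y => M * `|x ^+ 2 - y ^+ 2|) @ x --> M * `|x ^+ 2 - x ^+ 2|.
    exact: (continuousM (ck M) cn).
  rewrite subrr normr0 mulr0 in cb.
  have cb_near : \forall y \near x, M * `|x ^+ 2 - y ^+ 2| < e.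
    exact: (cvgr_lt _ cb _ e0).
  apply: filterS cb_near => y /= Hy.
  apply: le_lt_trans Hy; rewrite ler_norml.
  have := LM x y; have := LM y x; rewrite (distrC (y ^+ 2)) => h1 h2.
  by apply/andP; split; lra.
have ch x : 0 < x -> {for x, continuous h}.
  move=> x0; have ci : {for x, continuous (fun x : R => x^-1)}.
    by apply: inv_continuous; rewrite gt_eqF.
  have cN : {for x, continuous (fun x => - L x)} by apply: continuousN; exact: cL.
  exact: (continuousM cN ci).
have h1 : 0 < h 1.
  by apply: lt_le_trans (hge 1 ltr01); rewrite divr1 mulr1 addr_gt0// oppr_gt0.
(* Left of [a] the term [- L 0 / x] alone exceeds [h 1], and right of [b] the term [c * x] does,
   while [1] lies in [[a, b]]. *)
pose a := Num.min 1 (- L 0 / h 1); pose b := Num.max 1 (h 1 / c).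
have a0 : 0 < a by rewrite lt_min ltr01 divr_gt0// oppr_gt0.
have a1 : a <= 1 by rewrite ge_min lexx.
have b1 : 1 <= b by rewrite le_max lexx.
have [s sab smin] : exists2 s, s \in `[a, b] & forall t, t \in `[a, b] -> h s <= h t.
  apply: EVT_min; first exact: le_trans b1.
  apply: continuous_in_subspaceT => x; rewrite inE/= in_itv/= => /andP[ax _].
  by apply: ch; exact: lt_le_trans ax.
have s0 : 0 < s.
  by move: sab; rewrite in_itv/= => /andP[+ _]; exact: lt_le_trans.
have hs1 : h s <= h 1 by apply: smin; rewrite in_itv/= a1 b1.
exists (h s).
  split; first by exists s.
  move=> _ [t t0 <-]; rewrite -/(h t).
  have [ta|at_] := ltP t a.
    apply: le_trans hs1 _; apply: le_trans (hge _ t0).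
    have : h 1 < - L 0 / t.
      rewrite ltr_pdivlMr// mulrC -ltr_pdivlMr//.
      by apply: lt_le_trans ta _; rewrite ge_min lexx orbT.
    have : 0 < c * t by exact: mulr_gt0.
    lra.
  have [tb|bt] := leP t b; first by apply: smin; rewrite in_itv/= at_ tb.
  apply: le_trans hs1 _; apply: le_trans (hge _ t0).
  have : h 1 < c * t.
    rewrite mulrC -ltr_pdivrMr//.
    by apply: le_lt_trans bt; rewrite le_max lexx orbT.
  have : 0 < - L 0 / t by rewrite divr_gt0// oppr_gt0.
  lra.
apply: lt_le_trans (hge _ s0); apply: addr_gt0; last exact: mulr_gt0.
by rewrite divr_gt0// oppr_gt0.
Qed.

(** * Coercivity on the sphere for large diffusion *)

Section coercivity.
Variables (R : realType) (N : nat) (z : 'rV[R]_N) (rho : {posnum R}).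
Variables (q : 'rV[R]_N -> R) (K : R).
Local Notation E := 'rV[R]_N.
Local Notation sigma := (sphere_measure z rho).
Local Notation S := (esphere z rho).
Hypothesis N1 : (1 < N)%N.
Hypothesis mq : measurable_fun S q.
Hypothesis qK : forall y, S y -> `|q y| <= K.
Hypothesis qmean : sphere_mean z rho q < 0.

Let mS : measurable S := measurable_esphere z rho.

Let sfin : (sigma S < +oo)%E.
Proof.
by apply: le_lt_trans (sphere_measure_lty z rho); apply: le_measure => //; rewrite inE.
Qed.

Let bounded_integrable (w : E -> R) (K' : R) : measurable_fun S w ->
  (forall y, S y -> `|w y| <= K') -> sigma.-integrable S (EFin \o w).
Proof.
move=> mw wK; apply: (measurable_bounded_integrable mS sfin) => //.
exists K'; split; first exact: num_real.
by move=> M KM y Sy; apply: le_trans (wK _ Sy) (ltW KM).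
Qed.

Let s := fine (sigma S).
Let Q := \int[sigma]_(y in S) q y.

(** If the area were zero, its inverse would be [0] by convention and so would the mean, against
    [qmean]. *)
Let s_gt0 : 0 < s.
Proof.
have s0 : 0 <= s by exact: fine_ge0.
rewrite lt_neqAle s0 andbT eq_sym; apply/eqP => s00.
by move: qmean; rewrite /sphere_mean -/s s00 invr0 mul0r ltxx.
Qed.

Let Q_lt0 : Q < 0.
Proof. by move: qmean; rewrite /sphere_mean -/s pmulr_rlt0 ?invr_gt0. Qed.

(** Half of the absolute mean of [q]: then [q + 2 * ep] has mean zero, which leaves a term
    [ep * a ^+ 2] to absorb the cross term. *)
Let ep := - Q / (2 * s).

Let ep_gt0 : 0 < ep.
Proof. by rewrite divr_gt0 ?oppr_gt0// mulr_gt0. Qed.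

Let K_ge0 : 0 <= K.
Proof. by have [y Sy] := esphere_nonempty z rho (ltnW N1); apply: le_trans (qK Sy). Qed.

(** The price of the remainder: the first term comes from Young's inequality for the cross term, the
    second bounds the weight on its square. *)
Let k := (K + ep) ^+ 2 / ep + (K + ep).

Let k_ge0 : 0 <= k.
Proof.
have ep0 := ltW ep_gt0; apply: addr_ge0; last exact: addr_ge0.
by apply: divr_ge0 => //; exact: sqr_ge0.
Qed.

(* Splitting [phi] into a constant and a remainder, the constant part sees only
   the negative mean of [q]. *)
Let potential_le (phi : E -> R) (a : R) : L2 sigma phi -> L2 sigma (fun y => phi y - a) ->
  \int[sigma]_(y in S) ((q y + ep) * phi y ^+ 2) <=
  k * \int[sigma]_(y in S) ((phi y - a) ^+ 2).
Proof.
move=> Lphi Lpsi.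
have ipsi := L2_integrable_sqr mS Lpsi.
have mqe : measurable_fun S (fun y => q y + ep).
  by apply: measurable_funD => //; exact: measurable_cst.
have qeK y : S y -> `|q y + ep| <= K + ep.
  by move=> Sy; rewrite (le_trans (ler_normD _ _))// (gtr0_norm ep_gt0) lerD2r qK.
have iqphi := L2_integrable_weight mS Lphi mqe qeK.
have iq := bounded_integrable mq qK.
have icst (b : R) : sigma.-integrable S (EFin \o (fun=> b)).
  by apply: (@bounded_integrable _ `|b|) => //; exact: measurable_cst.
have iqe : sigma.-integrable S (EFin \o (fun y => q y + 2 * ep)).
  by rewrite (_ : _ \o _ = (EFin \o q) \+ (EFin \o (fun=> 2 * ep)%R))%E//; exact: integrableD.
have i1 : sigma.-integrable S (EFin \o (fun y => a ^+ 2 * (q y + 2 * ep))).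
  by rewrite (_ : _ \o _ = fun y => (a ^+ 2)%:E * (q y + 2 * ep)%R%:E)%E//; exact: integrableZl.
have i2 : sigma.-integrable S (EFin \o (fun y => k * (phi y - a) ^+ 2)).
  by rewrite (_ : _ \o _ = fun y => k%:E * ((phi y - a) ^+ 2)%R%:E)%E//; exact: integrableZl.
have i12 : sigma.-integrable S
    (EFin \o (fun y => a ^+ 2 * (q y + 2 * ep) + k * (phi y - a) ^+ 2)).
  by rewrite (_ : _ \o _ = (EFin \o (fun y => a ^+ 2 * (q y + 2 * ep))%R) \+
    (EFin \o (fun y => k * (phi y - a) ^+ 2)%R))%E//; exact: integrableD.
apply: (@le_trans _ _ (\int[sigma]_(y in S)
    (a ^+ 2 * (q y + 2 * ep) + k * (phi y - a) ^+ 2))).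
  apply: le_Rintegral => // y Sy.
  have := qeK _ Sy; rewrite ler_norml => /andP[h1 h2].
  have h3 : (q y + ep) * (phi y - a) ^+ 2 <= (K + ep) * (phi y - a) ^+ 2.
    by rewrite ler_wpM2r ?sqr_ge0.
  (* Young's inequality for the cross term; its share [ep * a ^+ 2] turns [q + ep] into
     [q + 2 * ep]. *)
  have h4 : 0 <= (ep * a - (q y + ep) * (phi y - a)) ^+ 2 / ep.
    by rewrite divr_ge0 ?sqr_ge0// ltW.
  have h4E : (ep * a - (q y + ep) * (phi y - a)) ^+ 2 / ep =
      ep * a ^+ 2 - 2 * ((q y + ep) * a * (phi y - a)) +
      (q y + ep) ^+ 2 * (phi y - a) ^+ 2 / ep by field; exact: lt0r_neq0.
  have h5 : (q y + ep) ^+ 2 * (phi y - a) ^+ 2 / ep <=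
      (K + ep) ^+ 2 * (phi y - a) ^+ 2 / ep.
    rewrite ler_pM2r ?invr_gt0// ler_wpM2r ?sqr_ge0//.
    rewrite -[leLHS]real_normK ?num_real// ler_sqr ?nnegrE ?addr_ge0 ?(ltW ep_gt0)//.
    exact: qeK.
  have -> : k * (phi y - a) ^+ 2 = (K + ep) ^+ 2 * (phi y - a) ^+ 2 / ep +
    (K + ep) * (phi y - a) ^+ 2 by rewrite /k; ring.
  have -> : (q y + ep) * phi y ^+ 2 = (q y + ep) * a ^+ 2 +
    2 * ((q y + ep) * a * (phi y - a)) + (q y + ep) * (phi y - a) ^+ 2 by ring.
  lra.
rewrite RintegralD// !RintegralZl//.
have -> : \int[sigma]_(y in S) (q y + 2 * ep) = 0.
  rewrite RintegralD// Rintegral_cst// -/s -/Q /ep; field.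
  exact: lt0r_neq0.
by rewrite mulr0 add0r.
Qed.

Lemma smooth_coercive : exists D1 : R, forall D, D1 < D ->
  forall phi, smooth phi ->
  \int[sigma]_(y in S) ((q y + ep) * phi y ^+ 2) <=
  D * \int[sigma]_(y in S) sqr_tangential_grad z rho phi y.
Proof.
have [C C0 HC] := poincare_sphere z rho N1.
exists (k * C) => D D1 phi sphi.
(* The constant [a] of the Poincare inequality depends on [e], but it disappears from the final
   estimate, so [e] may tend to zero. *)
apply: (le_of_forall_add k_ge0) => e e0.
have [a Ha] := HC phi sphi e e0.
have cphi := smooth_continuous sphi.
have Lphi := continuous_L2_sphere z rho cphi.
have cst_a : continuous (cst a : E -> R) by exact: cst_continuous.
have cpsi : continuous (fun y => phi y - a).
  by move=> y; exact: (continuousB (cphi y) (cst_a y)).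
have Lpsi := continuous_L2_sphere z rho cpsi.
apply: le_trans (potential_le Lphi Lpsi) _.
apply: le_trans (ler_wpM2l k_ge0 Ha) _.
rewrite mulrDr mulrA lerD2r ler_wpM2r ?(ltW D1)//.
by apply: Rintegral_ge0 => y _; exact: dot_ge0.
Qed.

(** Both sides are limits along the smooth sequence provided by [H1_sphere]: the weight is bounded,
    and the gradients converge coordinate by coordinate. The threshold is enlarged to be
    positive. *)
Lemma sphere_coercive : exists ep' D1 : R, [/\ 0 < ep', 0 < D1 &
  forall D, D1 < D -> forall U G, H1_sphere z rho U G ->
  \int[sigma]_(y in S) ((q y + ep') * U y ^+ 2) <=
  D * \int[sigma]_(y in S) dot (G y) (G y)].
Proof.
have [D1 HD1] := smooth_coercive.
exists ep, (`|D1| + 1); split => //.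
move=> D DD1 U G [LU LG [phi [sphi cU cG]]].
have D1D : D1 < D.
  by apply: lt_trans DD1; rewrite (le_lt_trans (ler_norm D1))// ltrDl.
have D0 : 0 < D by apply: le_lt_trans DD1; rewrite addr_ge0.
have Lphi j : L2 sigma (phi j).
  exact: (continuous_L2_sphere z rho (smooth_continuous (sphi j))).
have LT j i : L2 sigma (fun y => tangential_grad z rho (phi j) y ord0 i).
  by apply: continuous_L2_sphere; apply: continuous_coord; exact: continuous_tangential_grad.
have mqe : measurable_fun S (fun y => q y + ep).
  by apply: measurable_funD => //; exact: measurable_cst.
have qeK y : S y -> `|q y + ep| <= K + ep.
  by move=> Sy; rewrite (le_trans (ler_normD _ _))// (gtr0_norm ep_gt0) lerD2r qK.
have dotE (H : E -> E) : (forall i, L2 sigma (fun y => H y ord0 i)) ->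
    \int[sigma]_(y in S) dot (H y) (H y) =
    \sum_(i < N) \int[sigma]_(y in S) (H y ord0 i ^+ 2).
  move=> LH; rewrite /dot.
  have iH i := L2_integrable_sqr mS (LH i).
  elim: (index_enum _) => [|i t IH].
    by rewrite big_nil; under eq_Rintegral do rewrite big_nil; rewrite Rintegral_cst// mul0r.
  rewrite big_cons -IH -RintegralD//; last first.
    rewrite (_ : _ \o _ = (fun y => \sum_(j <- t) (H y ord0 j ^+ 2)%:E)%E).
      by apply: integrable_sum => // j _; exact: iH.
    by apply/funext => y; rewrite /= sumEFin.
  by apply: eq_Rintegral => y _; rewrite big_cons expr2.
(* An error [e] for each of the [N] coordinates of the gradient, multiplied by [D], and one for the
   potential. *)
have c0 : 0 <= D * N%:R + 1 by rewrite addr_ge0// mulr_ge0// ltW.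
apply: (le_of_forall_add c0) => e e0.
have near1 := L2_cvg_weight Lphi LU cU mS mqe qeK e0.
have near2 : \forall j \near \oo, forall i : 'I_N,
   `|\int[sigma]_(y in S) (tangential_grad z rho (phi j) y ord0 i ^+ 2) -
     \int[sigma]_(y in S) (G y ord0 i ^+ 2)| < e.
  apply: filter_forall => i.
  have m1 : measurable_fun S (cst 1 : E -> R) by exact: measurable_cst.
  have b1 (y : E) : S y -> `|cst 1 y : R| <= 1 by move=> _; rewrite normr1.
  have := L2_cvg_weight (fun j => LT j i) (LG i) (cG i) mS m1 b1 e0.
  apply: filterS => j; rewrite /= => H.
  have E1 (h : E -> R) : \int[sigma]_(y in S) (1 * h y ^+ 2) = \int[sigma]_(y in S) (h y ^+ 2).
    by apply: eq_Rintegral => y _; rewrite mul1r.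
  by rewrite !E1 in H.
have [j [/= Hj1 Hj2]] := filter_ex (filterI near1 near2).
have := HD1 D D1D (phi j) (sphi j).
rewrite /sqr_tangential_grad !dotE// => H.
have H2 : \sum_(i < N) \int[sigma]_(y in S) (tangential_grad z rho (phi j) y ord0 i ^+ 2) <=
    \sum_(i < N) \int[sigma]_(y in S) (G y ord0 i ^+ 2) + N%:R * e.
  have -> : N%:R * e = \sum_(i < N) e by rewrite sumr_const card_ord mulr_natl.
  rewrite -big_split; apply: ler_sum => i _.
  have := Hj2 i; rewrite ltr_norml => /andP[_ h2] /=.
  by rewrite -lerBlDl; exact: ltW.
have := ler_wpM2l (ltW D0) H2; rewrite mulrDr => H3.
move: Hj1; rewrite ltr_norml => /andP[H4 _].
have -> : (D * N%:R + 1) * e = D * (N%:R * e) + e by ring.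
lra.
Qed.

End coercivity.

(** * Sign of the principal eigenvalue and spreading speed *)

Section principal_eigenvalue.
Variables (R : realType) (N : nat) (z : 'rV[R]_N) (rho : {posnum R}).
Variables (d mu nu r : R) (kappa : 'rV[R]_N -> R) (f g : 'rV[R]_N -> R -> R).
Local Notation E := 'rV[R]_N.
Local Notation leb := (ball_measure z rho).
Local Notation sigma := (sphere_measure z rho).
Local Notation B := (eball z rho).
Local Notation S := (esphere z rho).
Local Notation F := (functional z rho d mu nu kappa f g).
Local Notation L := (Lambda z rho d mu nu kappa f g).
Local Notation admissible := (admissible z rho).
Hypothesis hN : (0 < N)%N.
Hypothesis hd : 0 < d.
Hypothesis hmu : 0 < mu.
Hypothesis hr : 0 < r.
Hypothesis hg : C1_holder r [set p | S p.1 /\ 0 <= p.2] g.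
Hypothesis hdf : forall y, B y -> right_derive0 (f y) = -1.
Hypothesis hkappa : forall y, S y -> kappa y = 1.
Hypothesis hmax : exists2 m, is_max [set right_derive0 (g y) | y in S] m & mu < m.

Let mS : measurable S := measurable_esphere z rho.

(** Concentration for the weight [right_derive0 (g y) - mu], which by continuity stays above half of
    its positive maximum near a maximum point. *)
Lemma exists_test_function : exists2 phi : E -> R, polyfun phi &
  \int[sigma]_(y in S) (phi y ^+ 2) = 1 /\
  mu < \int[sigma]_(y in S) (right_derive0 (g y) * phi y ^+ 2).
Proof.
have [m [[y0 Sy0 qy0] _] mum] := hmax.
have e0 : 0 < (m - mu) / 2 by rewrite divr_gt0// subr_gt0.
have [dl dl0 Hdl] := right_derive0_continuous hr hg Sy0 e0.
have [K K0 qK] := right_derive0_bounded hr hg.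
pose w y := right_derive0 (g y) - mu.
have mw : measurable_fun S w.
  by apply: measurable_funB; [exact: right_derive0_measurable hr hg|exact: measurable_cst].
have wK y : S y -> `|w y| <= K + mu.
  by move=> Sy; rewrite (le_trans (ler_normB _ _))// (gtr0_norm hmu) lerD2r qK.
have wdl y : S y -> eucl (y - y0) < dl -> (m - mu) / 2 <= w y.
  move=> Sy yd; have := Hdl y Sy; rewrite -opprB euclN => /(_ yd).
  by rewrite qy0 ltr_norml => /andP[_]; rewrite /w; lra.
have [phi pphi [phi1 wphi]] := exists_concentrated hN Sy0 mw wK e0 dl0 wdl.
exists phi => //; split => //.
have Lphi := continuous_L2_sphere z rho (polyfun_continuous pphi).
have iphi := L2_integrable_sqr mS Lphi.
have iq := integrable_potential hr hg Lphi.
move: wphi; rewrite /w; under eq_Rintegral do rewrite mulrBl.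
rewrite RintegralB//; last first.
  by rewrite (_ : _ \o _ = fun y => mu%:E * (phi y ^+ 2)%R%:E)%E//; exact: integrableZl.
by rewrite RintegralZl// phi1 mulr1 subr_gt0.
Qed.

Let energies D alpha : set R := [set l | exists U G V H T,
  [/\ H1_sphere z rho U G, H1_ball z rho V H, is_trace z rho V H T,
    \int[sigma]_(y in S) (U y ^+ 2) + \int[leb]_(x in B) (V x ^+ 2) = 1 &
    l = F D alpha U G V H T]].

Let energies_nonempty D alpha : energies D alpha !=set0.
Proof.
have [phi pphi [phi1 _]] := exists_test_function.
have [h1 h2 h3 h4] := test_admissible pphi phi1.
by eexists; exists phi, (tangential_grad z rho phi), (cst 0), (cst 0), (cst 0); split.
Qed.

Lemma Lambda_le D alpha U G V H T : 0 < D -> admissible U G V H T ->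
  L D alpha <= F D alpha U G V H T.
Proof.
move=> D0 [h1 h2 h3 h4]; apply: ge_inf; last by exists U, G, V, H, T.
have [K HK] := functional_lower_bound mu nu hd hr hg hdf hkappa.
exists (- K - alpha ^+ 2 * (D + d)) => _ [U' [G' [V' [H' [T' [a1 a2 a3 a4 ->]]]]]].
have adm : admissible U' G' V' H' T' by split.
rewrite (functional_shift d mu nu kappa hr hg hdf _ _ adm).
have /andP[_ ub] := weight_bounds hd D0 adm.
by apply: lerB; [exact: HK|rewrite ler_wpM2l ?sqr_ge0].
Qed.

Lemma le_Lambda D alpha c :
  (forall U G V H T, admissible U G V H T -> c <= F D alpha U G V H T) ->
  c <= L D alpha.
Proof.
move=> H; apply: lb_le_inf; first exact: energies_nonempty.
by move=> _ [U [G [V [H' [T [a1 a2 a3 a4 ->]]]]]]; apply: H.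
Qed.

Lemma Lambda_neg : exists2 D0 : R, 0 < D0 & forall D, 0 < D < D0 -> L D 0 < 0.
Proof.
have [phi pphi [phi1 qphi]] := exists_test_function.
have adm := test_admissible pphi phi1.
pose A := \int[sigma]_(y in S)
  dot (tangential_grad z rho phi y) (tangential_grad z rho phi y).
have A0 : 0 <= A by apply: Rintegral_ge0 => y _; exact: dot_ge0.
have A1 : 0 < A + 1 by rewrite ltr_wpDl.
pose P := \int[sigma]_(y in S) (right_derive0 (g y) * phi y ^+ 2) - mu.
have P0 : 0 < P by rewrite subr_gt0.
(* With [V = 0] the exchange term equals [mu], so the functional is [D * A - P]. *)
exists (P / (A + 1)); first by rewrite divr_gt0.
move=> D /andP[D0 DP]; apply: le_lt_trans (Lambda_le 0 D0 adm) _.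
rewrite (functional_expand d mu nu kappa hr hg hdf _ _ adm) -/A.
have i0 (h : E -> R) : (forall x, h x = 0) -> \int[leb]_(x in B) h x = 0.
  by move=> h0; rewrite /Rintegral integral0_eq// => x _; rewrite h0.
rewrite !i0; [|by move=> x; rewrite expr0n|by move=> x; rewrite dot0l].
have -> : \int[sigma]_(y in S)
    (kappa y * (Num.sqrt mu * phi y - Num.sqrt nu * cst 0 y) ^+ 2) = mu.
  rewrite -[RHS]mulr1 -phi1 -RintegralZl//; last first.
    exact/(L2_integrable_sqr mS)/continuous_L2_sphere/polyfun_continuous.
  apply: eq_Rintegral => y; rewrite inE => Sy.
  by rewrite hkappa// mul1r mulr0 subr0 exprMn sqr_sqrtr// ltW.
have : D * (A + 1) < P by rewrite -ltr_pdivlMr.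
rewrite /P expr0n /=; lra.
Qed.

(** For a fixed tuple the functional is affine in [alpha ^+ 2] with slope between [- (D + d)] and
    [- Num.min D d]; both estimates required by [exists_min_ratio] survive the infimum. *)
Lemma spreading_speed_exists D : 0 < D -> L D 0 < 0 ->
  exists2 c, is_spreading_speed z rho d mu nu kappa f g D c & 0 < c.
Proof.
move=> D0 L0; apply: (@exists_min_ratio _ _ (Num.min D d) (D + d)) => //.
- by rewrite lt_min D0.
- move=> x; rewrite lerBrDr; apply: le_Lambda => U G V H T adm.
  rewrite -lerBrDr; apply: le_trans (Lambda_le x D0 adm) _.
  rewrite (functional_shift d mu nu kappa hr hg hdf _ _ adm) lerD2l lerN2.
  by have /andP[lb _] := weight_bounds hd D0 adm; rewrite ler_wpM2l ?sqr_ge0.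
move=> x y; rewrite -lerBlDr; apply: le_Lambda => U G V H T adm.
rewrite lerBlDr; apply: le_trans (Lambda_le y D0 adm) _.
rewrite (functional_shift d mu nu kappa hr hg hdf D y adm).
rewrite (functional_shift d mu nu kappa hr hg hdf D x adm).
have /andP[lb ub] := weight_bounds hd D0 adm.
move: lb ub; set s := (D * _ + _) => lb ub.
have s0 : 0 <= s by apply: le_trans lb; rewrite le_min !ltW.
have H1 : (x ^+ 2 - y ^+ 2) * s <= `|x ^+ 2 - y ^+ 2| * (D + d).
  by apply: le_trans (ler_wpM2r s0 (ler_norm _)) _; rewrite ler_wpM2l.
rewrite (mulrC (D + d)); lra.
Qed.

Lemma Lambda_pos : (1 < N)%N ->
  sphere_mean z rho (fun y => right_derive0 (g y)) < 0 ->
  exists2 D1 : R, 0 < D1 & forall D, D1 < D -> 0 < L D 0.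
Proof.
move=> N1 hmean.
have [K K0 qK] := right_derive0_bounded hr hg.
have [ep [D1 [ep0 D10 HD1]]] :=
  sphere_coercive N1 (right_derive0_measurable hr hg) qK hmean.
exists D1 => // D D1D.
(* Coercivity leaves [ep] times the integral of [U ^+ 2] and the ball contributes that of [V ^+ 2];
   the two integrals add up to [1]. *)
apply: (@lt_le_trans _ _ (Num.min ep 1)); first by rewrite lt_min ep0 ltr01.
apply: le_Lambda => U G V H T adm.
apply: le_trans (functional_ge mu nu hd hr hg hdf hkappa D adm).
have [hU _ _ UV1] := adm; have [LU _ _] := hU.
have := HD1 D D1D U G hU.
under eq_Rintegral do rewrite mulrDl.
have iU := L2_integrable_sqr mS LU.
have iqU := integrable_potential hr hg LU.
have ieU : sigma.-integrable S (EFin \o (fun y => ep * U y ^+ 2)).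
  by rewrite (_ : _ \o _ = fun y => ep%:E * (U y ^+ 2)%R%:E)%E//; exact: integrableZl.
rewrite RintegralD// RintegralZl//.
have U0 : 0 <= \int[sigma]_(y in S) (U y ^+ 2).
  by apply: Rintegral_ge0 => y _; exact: sqr_ge0.
have V0 : 0 <= \int[leb]_(x in B) (V x ^+ 2).
  by apply: Rintegral_ge0 => y _; exact: sqr_ge0.
move: U0 V0 UV1; set a := \int[sigma]_(y in S) (U y ^+ 2).
set b := \int[leb]_(x in B) (V x ^+ 2) => a0 b0 ab H1.
have hm1 : Num.min ep 1 * a <= ep * a by rewrite ler_wpM2r// ge_min lexx.
have hm2 : Num.min ep 1 * b <= 1 * b by rewrite ler_wpM2r// ge_min lexx orbT.
have hm3 : Num.min ep 1 = Num.min ep 1 * a + Num.min ep 1 * b by rewrite -mulrDr ab mulr1.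
lra.
Qed.

End principal_eigenvalue.
Unset Implicit Arguments.
Set Strict Implicit.
Set Printing Implicit Defensive.

Theorem proposition3p5 (R : realType) (N : nat) (hN : (0 < N)%N)
  (z : 'rV[R]_N) (rho : {posnum R})
  (d mu nu r : R) (hd : 0 < d) (hmu : 0 < mu) (hnu : 0 < nu)
  (hr : 0 < r < 1)
  (kappa : 'rV[R]_N -> R) (f g : 'rV[R]_N -> R -> R)
  (hf : C1_holder r [set p | eball z rho p.1 /\ 0 <= p.2] f)
  (hg : C1_holder r [set p | esphere z rho p.1 /\ 0 <= p.2] g)
  (hf0 : forall y, eball z rho y -> f y 0 = 0)
  (hg0 : forall y, esphere z rho y -> g y 0 = 0)
  (hfdec : forall y, eball z rho y ->
     forall v w, 0 < v -> v < w -> f y w / w < f y v / v)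
  (hgdec : forall y, esphere z rho y ->
     forall u w, 0 < u -> u <= w -> g y w / w <= g y u / u)
  (hM : exists2 M : R, 0 < M &
     (forall v, M <= v -> forall y, eball z rho y -> f y v <= 0) /\
     (forall u, M <= u -> forall y, esphere z rho y -> g y u <= 0))
  (hdf : forall y, eball z rho y -> right_derive0 (f y) = -1)
  (hkappa : forall y, esphere z rho y -> kappa y = 1)
  (hmean : sphere_mean z rho (fun y => right_derive0 (g y)) < 0)
  (hmax : exists2 m,
     is_max [set right_derive0 (g y) | y in esphere z rho] m & mu < m) :
  (exists2 D0 : R, 0 < D0 & forall D, 0 < D < D0 ->
     Lambda z rho d mu nu kappa f g D 0 < 0 /\
     exists2 c, is_spreading_speed z rho d mu nu kappa f g D c & 0 < c) /\
  ((1 < N)%N -> exists2 D1 : R, 0 < D1 & forall D, D1 < D ->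
     0 < Lambda z rho d mu nu kappa f g D 0).
Proof.
have r0 : 0 < r by case/andP: hr.
split; last first.
  move=> N1; exact: (Lambda_pos nu hN hd hmu r0 hg hdf hkappa hmax N1 hmean).
have [D0 D00 HD0] := Lambda_neg nu hN hd hmu r0 hg hdf hkappa hmax.
exists D0 => // D D0D; have L0 := HD0 D D0D; split => //.
case/andP: D0D => Dpos _.
exact: (spreading_speed_exists hN hd hmu r0 hg hdf hkappa hmax Dpos L0).
Qed.
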